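(* For all $0<r<\infty$ and all $m\in\mathbb{N}$, the optimal constant $K_{m,r}$ in the multiple Khintchine inequality equals $(\mathrm{A}_r)^m$. Explicitly: $K_{m,r}=1$ for $r\ge2$; $K_{m,r}=\left(2^{\frac1r-\frac12}\right)^m$ for $0<r\le p_0$; and $K_{m,r}=\left(\frac{1}{\sqrt2}\left(\frac{\Gamma(\frac{r+1}{2})}{\sqrt\pi}\right)^{-1/r}\right)^m$ for $p_0<r<2$.
   Context: $r_j(t)=\operatorname{sign}(\sin(2^j\pi t))$, $t\in[0,1]$, are the Rademacher functions. For $0<r<\infty$, $\mathrm{A}_r$ is the optimal constant such that $\left(\sum_{j=1}^n|a_j|^2\right)^{1/2}\le \mathrm{A}_r\left(\int_0^1|\sum_{j=1}^n a_jr_j(t)|^rdt\right)^{1/r}$ for all $n$ and real $a_j$. It is known (Haagerup) that $\mathrm{A}_r=1$ for $r\ge2$, $\mathrm{A}_r=2^{\frac1r-\frac12}$ for $0<r\le p_0$, and $\mathrm{A}_r=\frac{1}{\sqrt2}\left(\frac{\Gamma(\frac{r+1}{2})}{\sqrt\pi}\right)^{-1/r}$ for $p_0<r<2$, where $p_0\in(1,2)$ ($p_0\approx1.85$) is the unique solution of $\Gamma\left(\frac{p_0+1}{2}\right)=\frac{\sqrt\pi}{2}$. $K_{m,r}$ denotes the smallest constant $K$ such that for all $N\in\mathbb{N}$ and all real arrays $(y_{i_1\dots i_m})_{i_1,\dots,i_m=1}^N$, $\left(\sum_{i_1,\dots,i_m=1}^N|y_{i_1\dots i_m}|^2\right)^{1/2}\le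 K\left(\int_{[0,1]^m}\left|\sum_{i_1,\dots,i_m=1}^N r_{i_1}(t_1)\cdots r_{i_m}(t_m)y_{i_1\dots i_m}\right|^r dt_1\cdots dt_m\right)^{1/r}$. *)

(* Defs.v *)
From Stdlib Require Import Reals List Factorial ClassicalEpsilon.
Open Scope R_scope.

Definition sgn (x : R) : R :=
  if Rlt_dec 0 x then 1 else if Rlt_dec x 0 then -1 else 0.

Definition rad (j : nat) (t : R) : R := sgn (sin (2 ^ j * PI * t)).

(* x^r for x >= 0, r > 0, with 0^r = 0 (Stdlib's Rpower 0 r = 1) *)
Definition rpow (x r : R) : R := if Req_EM_T x 0 then 0 else Rpower x r.

Fixpoint sumN (n : nat) (g : nat -> R) : R :=
  match n with O => 0 | S k => sumN k g + g (S k) end.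

Fixpoint msum (m N : nat) (f : list nat -> R) : R :=
  match m with
  | O => f nil
  | S k => sumN N (fun i => msum k N (fun l => f (i :: l)))
  end.

Fixpoint rprod (is_ : list nat) (ts : list R) : R :=
  match is_, ts with
  | i :: is', t :: ts' => rad i t * rprod is' ts'
  | _, _ => 1
  end.

(* is_iint m F I : I is the iterated Riemann integral over [0,1]^m of F
   (F takes the coordinate list [t_1;...;t_m]; t_1 is integrated last). *)
Fixpoint is_iint (m : nat) (F : list R -> R) (I : R) : Prop :=
  match m with
  | O => I = F nil
  | S k => exists g : R -> R,
      (forall t, 0 <= t <= 1 -> is_iint k (fun l => F (t :: l)) (g t)) /\
      exists pr : Riemann_integrable g 0 1, RiemannInt pr = I
  end.

Definition khintchine1 (r K : R) : Prop :=
  forall (n : nat) (a : nat -> R)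
    (pr : Riemann_integrable
            (fun t => rpow (Rabs (sumN n (fun j => a j * rad j t))) r) 0 1),
    sqrt (sumN n (fun j => (a j) ^ 2)) <= K * rpow (RiemannInt pr) (1 / r).

Definition khintchine_multi (m : nat) (r K : R) : Prop :=
  forall (N : nat) (y : list nat -> R) (I : R),
    is_iint m (fun ts => rpow (Rabs (msum m N (fun is_ => rprod is_ ts * y is_))) r) I ->
    sqrt (msum m N (fun is_ => (y is_) ^ 2)) <= K * rpow I (1 / r).

Definition is_smallest (P : R -> Prop) (K : R) : Prop :=
  P K /\ forall K', P K' -> K <= K'.

(* Euler's limit definition of the Gamma function (x > 0):
   Gamma x = lim n! n^x / (x (x+1) ... (x+n)) *)
Fixpoint gprod (x : R) (n : nat) : R :=
  match n with O => x | S k => gprod x k * (x + INR (S k)) end.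
Definition gamma_seq (x : R) (n : nat) : R :=
  INR (fact n) * Rpower (INR n) x / gprod x n.
Definition Gamma (x : R) : R :=
  epsilon (inhabits 0) (fun g => Un_cv (gamma_seq x) g).

(* Main.v *)
(* By the formula c_p |x|^p = int_0^oo (1 - cos (x t)) t^(-p-1) dt (0 < p < 2), the moment
   E|sum a_k eps_k|^p is an integral of 1 - prod_k cos (a_k t). If sum a_k^2 = 1 and all
   a_k^2 <= 1/2, the weighted AM-GM inequality reduces the lower bound to comparing
   |cos t|^s with exp (- s t^2 / 2) for s = 1/a_k^2 >= 2, and this follows from the case s = 2 by
   the Nazarov-Podkorytov argument, because the distribution functions of |cos t| and
   exp (- t^2 / 2) with respect to t^(-p-1) dt cross only once. A coefficient with a_k^2 > 1/2 is
   treated by induction on the number of terms. The case s = 2 is the assumption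
   Gamma ((p + 1) / 2) <= sqrt pi / 2, which holds for p0 <= p < 2 by log-convexity; smaller
   exponents follow from p0 by Hoelder interpolation. The Gaussian moment is identified with
   Euler's limit for Gamma through E|S_n|^(p+2) ~ (p + 1) n E|S_n|^p and Lyapunov's inequality, which
   also gives the optimality of the constant by the central limit phenomenon. The multiple
   inequality follows by iterating the scalar one, concavity of x^(r/2) (convexity if r >= 2)
   passing from scalars to vectors, and its optimality by testing on tensor powers. *)

Require Import Defs.
From Coquelicot Require Import Coquelicot.
From Stdlib Require Import Reals Lra Lia ZArith Factorial List Permutation.
From Stdlib Require Import ClassicalEpsilon FunctionalExtensionality.
Import ListNotations.
Open Scope R_scope.

(** * Powers *)

(** The delicate point is the single crossing. At level cos x the two distribution functions differ,
    up to the factor p, by theta - T, where T = [Tinf p x] collects the arches of |cos| beyond the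
    first. T / x increases by convexity. That theta / x decreases is proved for x <= 6/5, where
    Taylor and Padé bounds reduce it to a polynomial inequality in x^2; closer to pi/2, where - ln
    (cos x) blows up, theta <= T is proved directly. Both estimates use p >= 7/4. Of p0 only 1 < p0
    < 2 and its equation are given, so p0 > 7/4 has to be derived, by an exact integer computation
    with Gaussian moments of high order. Improper integrals are suprema over compact windows.
    [Gamma] is a limit chosen by [epsilon], so its value is reached by squeezing moments of order p
    + 2k between even ones, which reduces Euler's product to Wallis'. The induction for a large
    coefficient proves more than Khintchine's inequality, with [hphi] in place of (1 + x)^(p/2): the
    latter is concave, and merging two coefficients needs midpoint convexity. *)

Lemma exp_ge_1x (x : R) : 1 + x <= exp x.
Proof. destruct (Req_dec x 0) as [->|H]; [rewrite exp_0; lra|]. left; now apply exp_ineq1. Qed.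

Lemma ln_le_sub1 (x : R) : 0 < x -> ln x <= x - 1.
Proof.
  intros Hx. pose proof (exp_ge_1x (ln x)) as H. rewrite exp_ln in H by easy. lra.
Qed.

(** Both values lie above the tangent of [exp] at the convex combination. *)
Lemma exp_convex (q a b : R) :
  0 <= q <= 1 -> exp (q * a + (1 - q) * b) <= q * exp a + (1 - q) * exp b.
Proof.
  intros Hq. set (c := q * a + (1 - q) * b).
  assert (Ha : exp c * (1 + (a - c)) <= exp a).
  { replace a with (c + (a - c)) at 2 by ring. rewrite exp_plus.
    apply Rmult_le_compat_l; [left; apply exp_pos | apply exp_ge_1x]. }
  assert (Hb : exp c * (1 + (b - c)) <= exp b).
  { replace b with (c + (b - c)) at 2 by ring. rewrite exp_plus.
    apply Rmult_le_compat_l; [left; apply exp_pos | apply exp_ge_1x]. }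
  apply (Rmult_le_compat_l q) in Ha; [|lra].
  apply (Rmult_le_compat_l (1 - q)) in Hb; [|lra].
  replace (exp c) with (q * (exp c * (1 + (a - c))) + (1 - q) * (exp c * (1 + (b - c))))
    by (unfold c; ring).
  lra.
Qed.

Lemma rpow_0 (r : R) : rpow 0 r = 0.
Proof. unfold rpow. destruct (Req_EM_T 0 0); lra. Qed.

Lemma rpow_pos (x r : R) : 0 < x -> rpow x r = Rpower x r.
Proof. intros. unfold rpow. destruct (Req_EM_T x 0); lra. Qed.

Lemma rpow_ge0 (x r : R) : 0 <= rpow x r.
Proof. unfold rpow. destruct (Req_EM_T x 0); [lra|]. left; apply exp_pos. Qed.

Lemma Rpower_gt0 (x r : R) : 0 < Rpower x r.
Proof. apply exp_pos. Qed.

Lemma rpow_gt0 (x r : R) : 0 < x -> 0 < rpow x r.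
Proof. intros. rewrite rpow_pos by easy. apply exp_pos. Qed.

Lemma Rpower_1_l (r : R) : Rpower 1 r = 1.
Proof. unfold Rpower. rewrite ln_1, Rmult_0_r. apply exp_0. Qed.

Lemma rpow_1_l (r : R) : rpow 1 r = 1.
Proof. rewrite rpow_pos by lra. apply Rpower_1_l. Qed.

Lemma rpow_1 (x : R) : 0 <= x -> rpow x 1 = x.
Proof.
  intros [H| <-]; [|apply rpow_0]. rewrite rpow_pos by easy. now apply Rpower_1.
Qed.

Lemma Rpower_2 (x : R) : 0 < x -> Rpower x 2 = x ^ 2.
Proof. intros. replace 2 with (INR 2) at 1 by (simpl; ring). now apply Rpower_pow. Qed.

Lemma rpow_2 (x : R) : 0 <= x -> rpow x 2 = x ^ 2.
Proof.
  intros [H| <-]; [|rewrite rpow_0; ring]. rewrite rpow_pos by easy. now apply Rpower_2.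
Qed.

Lemma rpow_mult (x y r : R) : 0 <= x -> 0 <= y -> rpow (x * y) r = rpow x r * rpow y r.
Proof.
  intros [Hx| <-] [Hy| <-]; rewrite ?Rmult_0_l, ?Rmult_0_r, ?rpow_0, ?Rmult_0_l, ?Rmult_0_r;
    try easy.
  rewrite !rpow_pos by (try apply Rmult_lt_0_compat; easy).
  symmetry; now apply Rpower_mult_distr.
Qed.

Lemma rpow_plus (x r s : R) : 0 <= x -> rpow x (r + s) = rpow x r * rpow x s.
Proof.
  intros [Hx| <-]; [|rewrite !rpow_0; ring]. rewrite !rpow_pos by easy. apply Rpower_plus.
Qed.

Lemma rpow_rpow (x r s : R) : 0 <= x -> rpow (rpow x r) s = rpow x (r * s).
Proof.
  intros [Hx| <-]; [|now rewrite !rpow_0]. rewrite (rpow_pos (rpow x r)) by now apply rpow_gt0.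
  rewrite !rpow_pos by easy. apply Rpower_mult.
Qed.

Lemma rpow_le (x y r : R) : 0 <= r -> 0 <= x <= y -> rpow x r <= rpow y r.
Proof.
  intros Hr [[Hx| <-] Hy]; [|rewrite rpow_0; apply rpow_ge0].
  rewrite !rpow_pos by lra. apply Rle_Rpower_l; lra.
Qed.

Lemma rpow_le_inv (x y r : R) : 0 < r -> 0 <= x -> 0 <= y -> rpow x r <= rpow y r -> x <= y.
Proof.
  intros Hr Hx Hy H. destruct (Rle_or_lt x y) as [|Hl]; [easy|exfalso].
  destruct Hy as [Hy| <-].
  - rewrite !rpow_pos in H by lra. assert (Rpower y r < Rpower x r) by (apply Rlt_Rpower_l; lra). lra.
  - rewrite rpow_0 in H. pose proof (rpow_gt0 x r Hl). lra.
Qed.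

Lemma rpow_inv (x r : R) : 0 < x -> rpow (/ x) r = / rpow x r.
Proof.
  intros Hx. assert (0 < / x) by now apply Rinv_0_lt_compat.
  apply (Rmult_eq_reg_l (rpow x r)); [|apply Rgt_not_eq; now apply rpow_gt0].
  rewrite <- rpow_mult by lra. rewrite Rinv_r by lra. rewrite rpow_1_l.
  rewrite Rinv_r; [easy|]. apply Rgt_not_eq; now apply rpow_gt0.
Qed.

(** Convexity of [exp] between the exponents ln t and 0. *)
Lemma bernoulli_concave (t q : R) : 0 < q <= 1 -> 0 <= t -> rpow t q <= 1 + q * (t - 1).
Proof.
  intros Hq [Ht| <-]; [|rewrite rpow_0; lra].
  rewrite rpow_pos by easy. unfold Rpower.
  pose proof (exp_convex q (ln t) 0 ltac:(lra)) as H.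
  rewrite Rmult_0_r, Rplus_0_r, exp_0, exp_ln in H by easy. lra.
Qed.

Lemma bernoulli_convex (t q : R) : 1 <= q -> 0 <= t -> 1 + q * (t - 1) <= rpow t q.
Proof.
  intros Hq Ht.
  assert (Hi : 0 < / q <= 1).
  { split; [apply Rinv_0_lt_compat; lra|]. rewrite <- Rinv_1. apply Rinv_le_contravar; lra. }
  pose proof (bernoulli_concave (rpow t q) (/ q) Hi (rpow_ge0 _ _)) as H.
  rewrite rpow_rpow, Rinv_r, rpow_1 in H by lra.
  apply (Rmult_le_compat_l q) in H; [|lra].
  replace (q * (1 + / q * (rpow t q - 1))) with (q + (rpow t q - 1)) in H by (field; lra).
  lra.
Qed.

Lemma rpow_tangent_scale (S z q : R) : 0 < S -> 0 <= z -> rpow z q = rpow S q * rpow (z / S) q.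
Proof.
  intros HS Hz. rewrite <- rpow_mult; [f_equal; field; lra|lra|].
  apply Rmult_le_pos; [easy|]. left; now apply Rinv_0_lt_compat.
Qed.

(** Concavity as a tangent bound at [S]: averaging it over [z] is the form in which Jensen's
    inequality is applied to finite sums. *)
Lemma rpow_tangent_concave (S z q : R) :
  0 < q <= 1 -> 0 < S -> 0 <= z -> rpow z q <= rpow S q + q * rpow S (q - 1) * (z - S).
Proof.
  intros Hq HS Hz. rewrite (rpow_tangent_scale S z q) by easy.
  assert (Hd : 0 <= z / S) by (apply Rmult_le_pos; [easy|left; now apply Rinv_0_lt_compat]).
  pose proof (bernoulli_concave (z / S) q Hq Hd) as H.
  apply (Rmult_le_compat_l (rpow S q)) in H; [|apply rpow_ge0].
  replace (rpow S (q - 1)) with (rpow S q / S); [|].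
  - replace (rpow S q + q * (rpow S q / S) * (z - S))
      with (rpow S q * (1 + q * (z / S - 1))) by (field; lra). easy.
  - replace q with ((q - 1) + 1) at 1 by ring. rewrite rpow_plus, rpow_1 by lra. field; lra.
Qed.

Lemma rpow_tangent_convex (S z q : R) :
  1 <= q -> 0 < S -> 0 <= z -> rpow S q + q * rpow S (q - 1) * (z - S) <= rpow z q.
Proof.
  intros Hq HS Hz. rewrite (rpow_tangent_scale S z q) by easy.
  assert (Hd : 0 <= z / S) by (apply Rmult_le_pos; [easy|left; now apply Rinv_0_lt_compat]).
  pose proof (bernoulli_convex (z / S) q Hq Hd) as H.
  apply (Rmult_le_compat_l (rpow S q)) in H; [|apply rpow_ge0].
  replace (rpow S (q - 1)) with (rpow S q / S); [|].
  - replace (rpow S q + q * (rpow S q / S) * (z - S))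
      with (rpow S q * (1 + q * (z / S - 1))) by (field; lra). easy.
  - replace q with ((q - 1) + 1) at 1 by ring. rewrite rpow_plus, rpow_1 by lra. field; lra.
Qed.

Lemma rpow_chord (S L t q : R) :
  0 < q <= 1 -> 0 <= S -> 0 <= L -> 0 <= t <= 1 ->
  t * rpow S q + (1 - t) * rpow L q <= rpow (t * S + (1 - t) * L) q.
Proof.
  intros Hq HS HL Ht. set (c := t * S + (1 - t) * L).
  assert (Hc : 0 <= c) by (unfold c; nra).
  destruct Hc as [Hc|Hc].
  - pose proof (rpow_tangent_concave c S q Hq Hc HS) as H1.
    pose proof (rpow_tangent_concave c L q Hq Hc HL) as H2.
    apply (Rmult_le_compat_l t) in H1; [|lra].
    apply (Rmult_le_compat_l (1 - t)) in H2; [|lra].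
    replace (rpow c q) with (t * (rpow c q + q * rpow c (q - 1) * (S - c))
      + (1 - t) * (rpow c q + q * rpow c (q - 1) * (L - c))) by (unfold c; ring).
    lra.
  - assert (H1 : t * S = 0) by (unfold c in Hc; nra).
    assert (H2 : (1 - t) * L = 0) by (unfold c in Hc; nra).
    rewrite <- Hc. rewrite rpow_0.
    assert (E1 : t * rpow S q = 0).
    { apply Rmult_integral in H1 as [-> | ->]; [ring|rewrite rpow_0; ring]. }
    assert (E2 : (1 - t) * rpow L q = 0).
    { apply Rmult_integral in H2 as [-> | ->]; [ring|rewrite rpow_0; ring]. }
    lra.
Qed.

Lemma continuous_Rpower (p x : R) : 0 < x -> continuous (fun y => Rpower y p) x.
Proof.
  intros Hx. apply (ex_derive_continuous (fun y => Rpower y p)).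
  exists (p * Rpower x (p - 1)). apply is_derive_Reals. now apply derivable_pt_lim_power.
Qed.

Lemma is_derive_Rpower (p x : R) :
  0 < x -> is_derive (fun y => Rpower y p) x (p * Rpower x (p - 1)).
Proof. intros. apply is_derive_Reals. now apply derivable_pt_lim_power. Qed.

Lemma continuous_rpow_abs (p x : R) : 0 < p -> continuous (fun y => rpow (Rabs y) p) x.
Proof.
  intros Hp. destruct (Req_dec x 0) as [->|Hx].
  - intros P [e He]. rewrite Rabs_R0, rpow_0 in He.
    assert (Hd : 0 < rpow e (/ p)) by (apply rpow_gt0; apply e).
    exists (mkposreal _ Hd). intros y Hy. apply He.
    unfold ball in *; simpl in *; unfold AbsRing_ball, abs, minus, plus, opp in *; simpl in *.
    rewrite Ropp_0, Rplus_0_r in *. rewrite Rabs_pos_eq by apply rpow_ge0.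
    destruct (Rle_or_lt e (rpow (Rabs y) p)) as [H|H]; [exfalso|easy].
    assert (H2 : rpow e (/ p) <= rpow (rpow (Rabs y) p) (/ p)).
    { apply rpow_le; [left; now apply Rinv_0_lt_compat|].
      split; [left; apply (cond_pos e) | apply H]. }
    rewrite (rpow_rpow (Rabs y)), Rinv_r, rpow_1 in H2 by (try apply Rabs_pos; lra).
    simpl in Hy. lra.
  - apply continuous_ext_loc with (fun y => Rpower (Rabs y) p).
    + assert (Hd : 0 < Rabs x) by now apply Rabs_pos_lt.
      exists (mkposreal _ Hd). intros y Hy. symmetry. apply rpow_pos.
      unfold ball in Hy; simpl in Hy; unfold AbsRing_ball, abs, minus, plus, opp in Hy; simpl in Hy.
      apply Rabs_pos_lt. intros ->. rewrite Rplus_0_l, Rabs_Ropp in Hy. lra.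
    + apply (continuous_comp Rabs (fun y => Rpower y p)).
      * apply continuous_Rabs.
      * apply continuous_Rpower. now apply Rabs_pos_lt.
Qed.

(** * Elementary inequalities and polynomial certificates *)

Lemma derive_nonneg_le (f df : R -> R) (a b : R) : a <= b ->
  (forall x, a <= x <= b -> is_derive f x (df x)) ->
  (forall x, a <= x <= b -> 0 <= df x) -> f a <= f b.
Proof.
  intros Hab Hd Hp.
  destruct (MVT_gen f a b df) as [c [Hc E]].
  - intros x Hx. rewrite Rmin_left, Rmax_right in Hx by easy. apply Hd; lra.
  - intros x Hx. rewrite Rmin_left, Rmax_right in Hx by easy.
    apply continuity_pt_filterlim. apply (ex_derive_continuous f). eexists. apply Hd; lra.
  - rewrite Rmin_left, Rmax_right in Hc by easy.
    assert (0 <= df c * (b - a)) by (apply Rmult_le_pos; [apply Hp|]; lra). lra.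
Qed.

Lemma exp_ge_quadratic (x : R) : 0 <= x -> 1 + x + x ^ 2 / 2 <= exp x.
Proof.
  intros Hx.
  pose proof (derive_nonneg_le (fun y => exp y - (1 + y + y ^ 2 / 2))
    (fun y => exp y - (1 + y)) 0 x Hx) as H.
  simpl in H. rewrite exp_0 in H.
  assert (0 <= exp x - (1 + x + x ^ 2 / 2)); [|lra].
  replace 0 with (1 - (1 + 0 + 0 * (0 * 1) / 2)) by field. apply H.
  - intros y _. auto_derive; [easy|field].
  - intros y _. pose proof (exp_ge_1x y). lra.
Qed.

Lemma ln_ge_pade (u : R) : 1 <= u -> 2 * (u - 1) / (u + 1) <= ln u.
Proof.
  intros Hu.
  pose proof (derive_nonneg_le (fun y => ln y - 2 * (y - 1) / (y + 1))
    (fun y => (y - 1) ^ 2 / (y * (y + 1) ^ 2)) 1 u Hu) as H.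
  simpl in H. rewrite ln_1 in H.
  assert (0 <= ln u - 2 * (u - 1) / (u + 1)); [|lra].
  replace 0 with (0 - 2 * (1 - 1) / (1 + 1)) by field. apply H.
  - intros y Hy. auto_derive; [split; [lra|split; [lra|easy]]|field; lra].
  - intros y Hy. apply Rmult_le_pos; [nra|]. left; apply Rinv_0_lt_compat.
    apply Rmult_lt_0_compat; nra.
Qed.

Lemma ln_1p_le_cubic (w : R) : 0 <= w -> ln (1 + w) <= w - w ^ 2 / 2 + w ^ 3 / 3.
Proof.
  intros Hw.
  pose proof (derive_nonneg_le (fun y => (y - y ^ 2 / 2 + y ^ 3 / 3) - ln (1 + y))
    (fun y => y ^ 3 / (1 + y)) 0 w Hw) as H.
  simpl in H. rewrite Rplus_0_r, ln_1 in H.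
  assert (0 <= (w - w ^ 2 / 2 + w ^ 3 / 3) - ln (1 + w)); [|lra].
  replace 0 with (0 - 0 * (0 * 1) / 2 + 0 * (0 * (0 * 1)) / 3 - 0) by field. apply H.
  - intros y Hy. auto_derive; [lra|field; lra].
  - intros y Hy. apply Rmult_le_pos; [|left; apply Rinv_0_lt_compat; lra].
    apply (pow_le y 3); lra.
Qed.

Lemma ln_1m_le_cubic (w : R) : 0 <= w < 1 -> ln (1 - w) <= - w - w ^ 2 / 2 - w ^ 3 / 3.
Proof.
  intros Hw.
  pose proof (derive_nonneg_le (fun y => (- y - y ^ 2 / 2 - y ^ 3 / 3) - ln (1 - y))
    (fun y => y ^ 3 / (1 - y)) 0 w ltac:(lra)) as H.
  simpl in H. rewrite Rminus_0_r, ln_1 in H.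
  assert (0 <= (- w - w ^ 2 / 2 - w ^ 3 / 3) - ln (1 - w)); [|lra].
  replace 0 with (- 0 - 0 * (0 * 1) / 2 - 0 * (0 * (0 * 1)) / 3 - 0) by field. apply H.
  - intros y Hy. auto_derive; [lra|field; lra].
  - intros y Hy. apply Rmult_le_pos; [|left; apply Rinv_0_lt_compat; lra].
    apply (pow_le y 3); lra.
Qed.

Lemma ln_2_gt : 69 / 100 < ln 2.
Proof.
  (* Since 2 = (5/4)^3 (128/125), with factors close enough to 1 for the Padé bound to be sharp. *)
  assert (H : ln 2 = 3 * ln (5 / 4) + ln (128 / 125)).
  { replace (3 * ln (5 / 4)) with (ln (5 / 4) + ln (5 / 4) + ln (5 / 4)) by ring.
    rewrite <- !ln_mult by lra. f_equal. field. }
  pose proof (ln_ge_pade (5 / 4) ltac:(lra)). pose proof (ln_ge_pade (128 / 125) ltac:(lra)).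
  lra.
Qed.

Lemma exp_1_gt : 1 / (37 / 100) <= exp 1.
Proof.
  (* The quadratic bound is too weak at 1 but accurate enough at 1/8. *)
  replace (exp 1) with (exp (1 / 8) ^ 8)
    by (simpl; rewrite Rmult_1_r, <- !exp_plus; f_equal; field).
  pose proof (exp_ge_quadratic (1 / 8) ltac:(lra)) as H.
  apply Rle_trans with ((1 + 1 / 8 + (1 / 8) ^ 2 / 2) ^ 8); [lra|].
  apply pow_incr; lra.
Qed.

Lemma PI_bounds : 314 / 100 < PI < 3143 / 1000.
Proof.
  pose proof (PI_2_3_7_ineq 2) as H.
  unfold tg_alt, PI_2_3_7_tg, Ratan_seq in H. simpl in H. lra.
Qed.

Lemma INR_fact_S (n : nat) : INR (fact (S n)) = INR (S n) * INR (fact n).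
Proof. now rewrite fact_simpl, mult_INR. Qed.

(** Evaluates indices and factorials in an alternating partial sum, leaving an explicit polynomial
    for [lra]. *)
Ltac taylor H :=
  repeat change (2 * (0 + 1))%nat with 2%nat in H; repeat change (2 * (1 + 1))%nat with 4%nat in H;
  change (2 * 1 + 1)%nat with 3%nat in H; cbn [sum_f_R0] in H;
  repeat match type of H with context[(2 * ?k)%nat] =>
     let v := eval compute in (2 * k)%nat in change (2 * k)%nat with v in H end;
  repeat match type of H with context[(?k + 1)%nat] =>
     let v := eval compute in (k + 1)%nat in change (k + 1)%nat with v in H end;
  rewrite ?INR_fact_S in H; change (INR (fact 0)) with 1 in H; rewrite !S_INR in H;
  change (INR 0) with 0 in H; simpl pow in *.

Lemma cos_lower (x : R) : 0 <= x <= PI / 2 -> 1 - x ^ 2 / 2 + x ^ 4 / 24 - x ^ 6 / 720 <= cos x.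
Proof.
  intros H. destruct (cos_bound x 1 ltac:(lra) ltac:(lra)) as [H1 _].
  unfold cos_approx, cos_term in H1. taylor H1. lra.
Qed.

Lemma cos_upper (x : R) :
  0 <= x <= PI / 2 -> cos x <= 1 - x ^ 2 / 2 + x ^ 4 / 24 - x ^ 6 / 720 + x ^ 8 / 40320.
Proof.
  intros H. destruct (cos_bound x 1 ltac:(lra) ltac:(lra)) as [_ H1].
  unfold cos_approx, cos_term in H1. taylor H1. lra.
Qed.

Lemma sin_lower (x : R) : 0 <= x <= PI -> x - x ^ 3 / 6 + x ^ 5 / 120 - x ^ 7 / 5040 <= sin x.
Proof.
  intros H. destruct (sin_bound x 1 ltac:(lra) ltac:(lra)) as [H1 _].
  unfold sin_approx, sin_term in H1. taylor H1. lra.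
Qed.

Lemma sin_upper (x : R) : 0 <= x <= PI -> sin x <= x - x ^ 3 / 6 + x ^ 5 / 120.
Proof.
  intros H. destruct (sin_bound x 0 ltac:(lra) ltac:(lra)) as [_ H1].
  unfold sin_approx, sin_term in H1. taylor H1. lra.
Qed.

Ltac positivity := repeat first
  [ match goal with |- 0 <= _ / _ => lra | |- 0 <= _ - _ => lra end
  | apply Rplus_le_le_0_compat | apply Rmult_le_pos | apply pow_le | lra ].

(* The certificates below are expansions in the Bernstein basis of the interval. *)
Lemma pade_certificate (z : R) : 0 <= z <= 36 / 25 ->
  let D := 1 - 17 * z / 56 in let N := D * (1 + z / 6) + 2 / 45 * z ^ 2 in
  32 * ((1 - z / 6 + z ^ 2 / 120) * D * (N + D) ^ 2) <=
  (1 - z / 2 + z ^ 2 / 24 - z ^ 3 / 720) * N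
    * (32 * (N + D) ^ 2 + 88 * ((N - D) * (N + D)) + 77 * (N - D) ^ 2).
Proof.
  intros Hz D N. apply Rminus_le_0.
  match goal with |- _ <= ?e => replace e with
    (z^1 * ((152587890625/352638738432) * (z^0 * ((36/25) - z)^8) + (54632568359375/19747769352192) * (z^1 * ((36/25) - z)^7) + (697569091796875/92156256976896) * (z^2 * ((36/25) - z)^6) + (44473409283203125/3870562793029632) * (z^3 * ((36/25) - z)^5) + (80917703269765625/7741125586059264) * (z^4 * ((36/25) - z)^4) + (1839110099385875/322546899419136) * (z^5 * ((36/25) - z)^3) + (239052456128345/138234385465344) * (z^6 * ((36/25) - z)^2) + (626643833699167/2764687709306880) * (z^7 * ((36/25) - z)^1) + (2823637981037/3656994324480000) * (z^8 * ((36/25) - z)^0)))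
    by (unfold N, D; field) end.
  positivity.
Qed.

(** With z = x^2: compares tan x with half the derivative of x^2 [pade] (x^2), after bounding cos
    above and sin below by Taylor polynomials and clearing denominators. *)
Lemma tan_certificate (z : R) : 0 <= z <= 36 / 25 ->
  (1 - z / 2 + z ^ 2 / 24 - z ^ 3 / 720 + z ^ 4 / 40320)
    * (1 - 23 / 84 * z + 1087 / 47040 * z ^ 2 + 527 / 141120 * z ^ 3) <=
  (1 - z / 6 + z ^ 2 / 120 - z ^ 3 / 5040) * (1 - 17 * z / 56) ^ 2.
Proof.
  intros Hz. apply Rminus_le_0.
  match goal with |- _ <= ?e => replace e with
    (z^4 * ((3671875/7900913664) * (z^0 * ((36/25) - z)^3) + (6125725/4608866304) * (z^1 * ((36/25) - z)^2) + (93446959/73741860864) * (z^2 * ((36/25) - z)^1) + (2227452181/5530639564800) * (z^3 * ((36/25) - z)^0)))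
    by field end.
  positivity.
Qed.

(** Here d = pi/2 - x. The numbers 157/100 and 15715/10000 bracket pi/2, 3715/10000 exceeds pi/2 -
    6/5, 37/100 exceeds 1/e, and 204/1000 exceeds (8/25) / (157/100). *)
Lemma endpoint_certificate (d : R) : 0 <= d <= 3715 / 10000 ->
  2 * (37 / 100 + 172 / 1000 * d ^ 3) * (4 * (15715 / 10000) + 204 / 1000 * (15715 / 10000 + d) ^ 2)
  <= ((157 / 100) ^ 2 - d ^ 2) ^ 2.
Proof.
  intros Hd. apply Rminus_le_0.
  match goal with |- _ <= ?e => replace e with
    (d^0 * ((33640939031680000/226435267111943) * (d^0 * ((743/2000) - d)^5) + (162564228133760000/226435267111943) * (d^1 * ((743/2000) - d)^4) + (291408894400320000/226435267111943) * (d^2 * ((743/2000) - d)^3) + (7231829996304875462601/7076102097248218750) * (d^3 * ((743/2000) - d)^2) + (1111527083010626078402/3538051048624109375) * (d^4 * ((743/2000) - d)^1) + (34201381372800101602/3538051048624109375) * (d^5 * ((743/2000) - d)^0)))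
    by field end.
  positivity.
Qed.

(** Here d = 1 - a in the two-point inequality, and 169/100 = 1 + 69/100 comes from ln d <= d - 1
    and ln 2 > 69/100. *)
Lemma entropy_certificate (d : R) : 0 <= d <= 1 ->
  let w := (1 - (1 - d) ^ 2) / 2 in
  1 / 2 * (2 - d) ^ 2 * (- (d / 2) - d ^ 2 / 8 - d ^ 3 / 24) + 1 / 2 * d ^ 2 * (d - 169 / 100)
    + (1 + w) * (w - w ^ 2 / 2 + w ^ 3 / 3) <= 0.
Proof.
  intros Hd w. apply Ropp_le_cancel. rewrite Ropp_0.
  match goal with |- _ <= ?e => replace e with
    (d^2 * ((19/200) * (d^0 * (1 - d)^6) + (41/50) * (d^1 * (1 - d)^5) + (467/240) * (d^2 * (1 - d)^4) + (551/240) * (d^3 * (1 - d)^3) + (22/15) * (d^4 * (1 - d)^2) + (559/1200) * (d^5 * (1 - d)^1) + (4/75) * (d^6 * (1 - d)^0)))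
    by (unfold w; field) end.
  positivity.
Qed.

(** * The logarithm of the cosine *)

(** Makes the Gaussian level sets explicit: exp (- t^2 / 2) < cos x exactly when t^2 > [hcos x]. *)
Definition hcos (x : R) : R := - 2 * ln (cos x).

Lemma cos_gt0 (x : R) : 0 <= x < PI / 2 -> 0 < cos x.
Proof. intros H. apply cos_gt_0; lra. Qed.

Lemma is_derive_hcos (x : R) : 0 <= x < PI / 2 -> is_derive hcos x (2 * (sin x / cos x)).
Proof.
  intros H. pose proof (cos_gt0 x H). unfold hcos. auto_derive; [easy|]. field; lra.
Qed.

Lemma hcos_0 : hcos 0 = 0.
Proof. unfold hcos. rewrite cos_0, ln_1. ring. Qed.

Lemma tan_ge (x : R) : 0 <= x < PI / 2 -> x <= sin x / cos x.
Proof.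
  intros Hx.
  pose proof (derive_nonneg_le (fun y => sin y / cos y - y)
    (fun y => (sin y) ^ 2 / (cos y) ^ 2) 0 x ltac:(lra)) as H.
  simpl in H. rewrite sin_0 in H.
  assert (0 <= sin x / cos x - x); [|lra].
  replace 0 with (0 / cos 0 - 0) by (rewrite cos_0; field). apply H.
  - intros y Hy. pose proof (cos_gt0 y ltac:(lra)). auto_derive; [lra|].
    pose proof (sin2_cos2 y) as E. unfold Rsqr in E.
    apply (Rmult_eq_reg_r (cos y * cos y)); [|nra]. field_simplify; try lra.
  - intros y Hy. pose proof (cos_gt0 y ltac:(lra)).
    apply Rmult_le_pos; [nra|]. left; apply Rinv_0_lt_compat; nra.
Qed.

Lemma hcos_ge_sqr (x : R) : 0 <= x < PI / 2 -> x ^ 2 <= hcos x.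
Proof.
  intros Hx.
  pose proof (derive_nonneg_le (fun y => hcos y - y ^ 2)
    (fun y => 2 * (sin y / cos y) - 2 * y) 0 x ltac:(lra)) as H.
  cbv beta in H. rewrite hcos_0 in H.
  assert (0 <= hcos x - x ^ 2); [|lra].
  replace 0 with (0 - 0 ^ 2) by ring. apply H.
  - intros y Hy. apply (is_derive_minus hcos (fun y => y ^ 2)).
    + apply is_derive_hcos; lra.
    + auto_derive; [easy|ring].
  - intros y Hy. pose proof (tan_ge y ltac:(lra)). lra.
Qed.

(* Pade approximant of [hcos x / x^2] in [z = x^2]. *)
Definition pade (z : R) : R := 1 + z / 6 + 2 / 45 * z ^ 2 / (1 - 17 * z / 56).

(** Differentiation removes the logarithm and leaves a rational lower bound for tan. The
    coefficients of [pade] reproduce the expansion 1 + z/6 + 2 z^2/45 + 17 z^3/1260 + ... of hcos x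
    / x^2. *)
Lemma hcos_ge_pade (x : R) : 0 <= x <= 6 / 5 -> x ^ 2 * pade (x ^ 2) <= hcos x.
Proof.
  intros Hx. pose proof PI_bounds as HP.
  pose proof (derive_nonneg_le (fun y => hcos y - y ^ 2 * pade (y ^ 2))
    (fun y => 2 * (sin y / cos y) - 2 * (y * (1 - 23 / 84 * y ^ 2 + 1087 / 47040 * (y ^ 2) ^ 2
       + 527 / 141120 * (y ^ 2) ^ 3) / (1 - 17 * y ^ 2 / 56) ^ 2)) 0 x ltac:(lra)) as H.
  cbv beta in H. rewrite hcos_0 in H.
  assert (0 <= hcos x - x ^ 2 * pade (x ^ 2)); [|lra].
  replace 0 with (0 - 0 ^ 2 * pade (0 ^ 2)) by ring.
  assert (HD : forall y, 0 <= y <= x -> 0 <= y ^ 2 <= 36 / 25 /\ 0 < 1 - 17 * y ^ 2 / 56).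
  { intros y Hy. assert (0 <= y ^ 2 <= 36 / 25) by nra. lra. }
  apply H.
  - intros y Hy. destruct (HD y Hy) as [_ HDy]. apply (is_derive_minus hcos (fun y => y ^ 2 * pade (y ^ 2))).
    + apply is_derive_hcos; lra.
    + unfold pade. auto_derive; [simpl in *; lra|]. simpl in *. field; lra.
  - intros y Hy. destruct (HD y Hy) as [Hz HDy].
    pose proof (cos_gt0 y ltac:(lra)) as Hc.
    pose proof (tan_certificate (y ^ 2) Hz) as C.
    pose proof (sin_lower y ltac:(lra)) as Hs.
    pose proof (cos_upper y ltac:(lra)) as Hu.
    set (D := 1 - 17 * y ^ 2 / 56) in *.
    set (N := 1 - 23 / 84 * y ^ 2 + 1087 / 47040 * (y ^ 2) ^ 2 + 527 / 141120 * (y ^ 2) ^ 3) in *.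
    assert (HN : 0 <= N) by (unfold N; pose proof (pow_le (y ^ 2) 3 ltac:(lra)); nra).
    assert (E : y * N * cos y <= sin y * D ^ 2).
    { apply Rle_trans with (y * ((1 - y ^ 2 / 6 + (y ^ 2) ^ 2 / 120 - (y ^ 2) ^ 3 / 5040) * D ^ 2)).
      - apply Rle_trans with (y * ((1 - y ^ 2 / 2 + (y ^ 2) ^ 2 / 24 - (y ^ 2) ^ 3 / 720 + (y ^ 2) ^ 4 / 40320) * N)).
        + rewrite Rmult_assoc. apply Rmult_le_compat_l; [lra|]. rewrite Rmult_comm.
          apply Rmult_le_compat_r; [easy|]. rewrite <- !pow_mult. simpl Nat.mul. lra.
        + apply Rmult_le_compat_l; [lra|easy].
      - rewrite <- Rmult_assoc. apply Rmult_le_compat_r; [nra|]. rewrite <- !pow_mult. simpl Nat.mul.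
        lra. }
    assert (E2 : y * N / D ^ 2 <= sin y / cos y); [|lra].
    apply (Rmult_le_reg_r (cos y * D ^ 2)); [apply Rmult_lt_0_compat; nra|].
    replace (y * N / D ^ 2 * (cos y * D ^ 2)) with (y * N * cos y) by (field; lra).
    replace (sin y / cos y * (cos y * D ^ 2)) with (sin y * D ^ 2) by (field; lra). easy.
Qed.

(** Gives the sign of the derivative of theta p x / x, in terms of t = tan x / x and r = hcos x /
    x^2. With l = (r - 1) / (r + 1) <= ln r / 2, the power r^(p/2) is at least 1 + p l + (p l)^2 /
    2, so it is enough to bound t above by a function of r. *)
Lemma slope_inequality (p x : R) : 7 / 4 <= p -> 0 < x <= 6 / 5 ->
  p * (sin x / (x * cos x)) / (hcos x / x ^ 2) + 1 <= (p + 1) * Rpower (hcos x / x ^ 2) (p / 2).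
Proof.
  intros Hp Hx. pose proof PI_bounds as HP.
  set (t := sin x / (x * cos x)). set (r := hcos x / x ^ 2).
  assert (Hz : 0 < x ^ 2 <= 36 / 25) by nra.
  pose proof (cos_gt0 x ltac:(lra)) as Hc.
  assert (HD : 0 < 1 - 17 * x ^ 2 / 56) by lra.
  assert (Hq1 : 1 <= pade (x ^ 2)).
  { unfold pade. assert (0 <= 2 / 45 * (x ^ 2) ^ 2 / (1 - 17 * x ^ 2 / 56)); [|lra].
    apply Rmult_le_pos; [nra|]. left; now apply Rinv_0_lt_compat. }
  assert (Hr : pade (x ^ 2) <= r).
  { unfold r. pose proof (hcos_ge_pade x ltac:(lra)).
    apply (Rmult_le_reg_l (x ^ 2)); [lra|].
    replace (x ^ 2 * (hcos x / x ^ 2)) with (hcos x) by (field; lra). easy. }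
  (* The coefficients 11/4 and 77/32 are p + 1 and p (p + 1) / 2 at p = 7/4. *)
  set (F := fun r : R => r * (1 + 11 / 4 * ((r - 1) / (r + 1)) + 77 / 32 * ((r - 1) / (r + 1)) ^ 2)).
  assert (Ht : t <= F (pade (x ^ 2))).
  { pose proof (pade_certificate (x ^ 2) ltac:(lra)) as C. cbv zeta in C.
    pose proof (sin_upper x ltac:(lra)) as Hs.
    pose proof (cos_lower x ltac:(lra)) as Hl.
    set (D := 1 - 17 * x ^ 2 / 56) in *.
    set (N := D * (1 + x ^ 2 / 6) + 2 / 45 * (x ^ 2) ^ 2) in *.
    set (B := 1 - x ^ 2 / 2 + (x ^ 2) ^ 2 / 24 - (x ^ 2) ^ 3 / 720) in *.
    assert (HB : 0 < B) by (unfold B; nra).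
    assert (EN : pade (x ^ 2) = N / D) by (unfold pade, N; fold D; field; lra).
    assert (HN : 0 < N) by (unfold N; nra).
    assert (Ht1 : t <= (1 - x ^ 2 / 6 + (x ^ 2) ^ 2 / 120) / B).
    { unfold t. apply (Rmult_le_reg_r (x * cos x * B)).
      { apply Rmult_lt_0_compat; [apply Rmult_lt_0_compat|]; lra. }
      replace (sin x / (x * cos x) * (x * cos x * B)) with (sin x * B) by (field; lra).
      replace ((1 - x ^ 2 / 6 + (x ^ 2) ^ 2 / 120) / B * (x * cos x * B))
        with (x * (1 - x ^ 2 / 6 + (x ^ 2) ^ 2 / 120) * cos x) by (field; lra).
      apply Rle_trans with (x * (1 - x ^ 2 / 6 + (x ^ 2) ^ 2 / 120) * B).
      - apply Rmult_le_compat_r; [lra|]. rewrite <- pow_mult. simpl Nat.mul. lra.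
      - apply Rmult_le_compat_l; [nra|]. unfold B. rewrite <- !pow_mult. simpl Nat.mul. lra. }
    apply Rle_trans with (1 := Ht1). rewrite EN. unfold F.
    replace (N / D * (1 + 11 / 4 * ((N / D - 1) / (N / D + 1)) + 77 / 32 * ((N / D - 1) / (N / D + 1)) ^ 2))
      with (N * (32 * (N + D) ^ 2 + 88 * ((N - D) * (N + D)) + 77 * (N - D) ^ 2) / (32 * D * (N + D) ^ 2))
      by (field; lra).
    apply (Rmult_le_reg_r (B * (32 * D * (N + D) ^ 2))).
    { repeat apply Rmult_lt_0_compat; try lra; nra. }
    match goal with |- ?u / B * ?v <= _ => replace (u / B * v) with (u * (32 * D * (N + D) ^ 2)) by (field; lra) end.
    match goal with |- _ <= N * ?k / ?w * _ => replace (N * k / w * (B * w)) with (B * N * k) by (field; lra) end.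
    eapply Rle_trans; [|apply C]. right; ring. }
  assert (HF : F (pade (x ^ 2)) <= F r).
  { set (a := pade (x ^ 2)) in *. unfold F.
    assert (H0 : 0 <= (a - 1) / (a + 1)).
    { apply Rmult_le_pos; [lra|]. left; apply Rinv_0_lt_compat; lra. }
    assert (H1 : (a - 1) / (a + 1) <= (r - 1) / (r + 1)).
    { replace ((a - 1) / (a + 1)) with (1 - 2 * / (a + 1)) by (field; lra).
      replace ((r - 1) / (r + 1)) with (1 - 2 * / (r + 1)) by (field; lra).
      assert (/ (r + 1) <= / (a + 1)) by (apply Rinv_le_contravar; lra). lra. }
    apply Rmult_le_compat; [lra|nra|lra|nra]. }
  set (l := (r - 1) / (r + 1)) in *.
  assert (Hl0 : 0 <= l).
  { apply Rmult_le_pos; [lra|]. left; apply Rinv_0_lt_compat; lra. }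
  assert (HL : l <= ln r / 2).
  { pose proof (ln_ge_pade r ltac:(lra)) as H. unfold l.
    replace (2 * (r - 1) / (r + 1)) with (2 * ((r - 1) / (r + 1))) in H by (field; lra). lra. }
  assert (HR : 1 + p * l + (p * l) ^ 2 / 2 <= Rpower r (p / 2)).
  { unfold Rpower. eapply Rle_trans; [apply exp_ge_quadratic; nra|].
    replace (p / 2 * ln r) with (p * (ln r / 2)) by field.
    destruct (Req_dec (p * l) (p * (ln r / 2))) as [->|]; [lra|].
    left; apply exp_increasing. nra. }
  assert (Htr : t / r <= 1 + 11 / 4 * l + 77 / 32 * l ^ 2).
  { apply (Rmult_le_reg_r r); [lra|].
    replace (t / r * r) with t by (field; lra).
    apply Rle_trans with (F r); [lra|]. unfold F. fold l. right; ring. }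
  apply Rle_trans with (p * (1 + 11 / 4 * l + 77 / 32 * l ^ 2) + 1).
  { replace (p * t / r) with (p * (t / r)) by (field; lra). nra. }
  apply Rle_trans with ((p + 1) * (1 + p * l + (p * l) ^ 2 / 2)); [|apply Rmult_le_compat_l; lra].
  assert (0 <= l ^ 2) by nra.
  assert (11 / 4 * l <= (p + 1) * l) by nra.
  assert (77 / 32 * l ^ 2 <= (p + 1) * p / 2 * l ^ 2) by (apply Rmult_le_compat_r; nra).
  nra.
Qed.

(** * The two distribution functions *)

Lemma Rpower_div (x y p : R) : 0 < x -> 0 < y -> Rpower (x / y) p = Rpower x p / Rpower y p.
Proof.
  intros Hx Hy. assert (0 < x / y) by now apply Rdiv_lt_0_compat.
  apply (Rmult_eq_reg_r (Rpower y p)); [|apply Rgt_not_eq, Rpower_gt0].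
  rewrite Rpower_mult_distr by easy. replace (x / y * y) with x by (field; lra).
  field. apply Rgt_not_eq, Rpower_gt0.
Qed.

Lemma Rpower_succ (x p : R) : 0 < x -> Rpower x (p + 1) = x * Rpower x p.
Proof. intros Hx. rewrite Rpower_plus, Rpower_1 by easy. ring. Qed.

Lemma Rpower_pred (x p : R) : 0 < x -> Rpower x (p - 1) = Rpower x p / x.
Proof.
  intros Hx. replace p with (p - 1 + 1) at 2 by ring. rewrite Rpower_succ by easy. field; lra.
Qed.

Lemma Rpower_neg_decr (x y p : R) : 0 <= p -> 0 < x <= y -> Rpower y (- p) <= Rpower x (- p).
Proof.
  intros Hp H. rewrite !Rpower_Ropp. apply Rinv_le_contravar; [apply Rpower_gt0|].
  apply Rle_Rpower_l; lra.
Qed.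

(* For [mu = t^(-p-1) dt] and [0 < x < pi/2], [p mu {exp (-t^2/2) < cos x}] is
   [hcos x ^ (-p/2)] and [p mu {|cos t| < cos x}] is [x^(-p) - Tinf p x], so that
   [theta p x - Tinf p x] is [p] times the difference of the distribution functions. *)
Definition theta (p x : R) : R := Rpower x (- p) - Rpower (hcos x) (- (p / 2)).

Lemma hcos_gt0 (x : R) : 0 < x < PI / 2 -> 0 < hcos x.
Proof. intros Hx. pose proof (hcos_ge_sqr x ltac:(lra)). nra. Qed.

Lemma is_derive_theta (p x : R) : 0 < x < PI / 2 ->
  is_derive (theta p) x
    (- p * Rpower x (- p - 1) + p * Rpower (hcos x) (- (p / 2) - 1) * (sin x / cos x)).
Proof.
  intros Hx. pose proof (hcos_gt0 x Hx) as Hh.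
  replace (- p * Rpower x (- p - 1) + p * Rpower (hcos x) (- (p / 2) - 1) * (sin x / cos x))
    with (minus (- p * Rpower x (- p - 1))
     (scal (2 * (sin x / cos x)) (- (p / 2) * Rpower (hcos x) (- (p / 2) - 1)))).
  2:{ unfold minus, plus, opp, scal; simpl; unfold mult; simpl. field.
      apply Rgt_not_eq, cos_gt0; lra. }
  apply (is_derive_minus (fun x => Rpower x (- p)) (fun x => Rpower (hcos x) (- (p / 2)))).
  - now apply is_derive_Rpower.
  - apply (is_derive_comp (fun y => Rpower y (- (p / 2))) hcos).
    + now apply is_derive_Rpower.
    + apply is_derive_hcos; lra.
Qed.

(** Monotonicity of theta p x / x, cross-multiplied; the numerator of its derivative is the gap in
    [slope_inequality] times a positive factor. *)
Lemma theta_slope (p x y : R) : 7 / 4 <= p -> 0 < x <= y -> y <= 6 / 5 ->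
  theta p y * x <= theta p x * y.
Proof.
  intros Hp Hxy Hy. pose proof PI_bounds as HP.
  assert (H : - (theta p x / x) <= - (theta p y / y)).
  { apply (derive_nonneg_le (fun t => - (theta p t / t)) (fun t =>
      - (((- p * Rpower t (- p - 1) + p * Rpower (hcos t) (- (p / 2) - 1) * (sin t / cos t)) * t
         - theta p t) / t ^ 2))); [lra| |].
    - intros t Ht.
      pose proof (is_derive_theta p t ltac:(lra)) as Hd.
      apply is_derive_opp with (f := fun t => theta p t / t).
      evar_last.
      + apply (is_derive_div (theta p) (fun t => t)); [exact Hd|apply is_derive_id|lra].
      + unfold one; simpl. pose proof (cos_gt0 t ltac:(lra)). field; lra.
    - intros t Ht. set (X := Rpower t (- p)). set (r := hcos t / t ^ 2).
      pose proof (hcos_gt0 t ltac:(lra)) as Hh.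
      pose proof (cos_gt0 t ltac:(lra)) as Hc.
      assert (Ht2 : 0 < t ^ 2) by nra.
      assert (Hr : 0 < r) by now apply Rdiv_lt_0_compat.
      pose proof (slope_inequality p t Hp ltac:(lra)) as S. fold r in S.
      set (w := Rpower r (p / 2)) in *.
      assert (Hw : 0 < w) by apply Rpower_gt0.
      assert (HX : 0 < X) by apply Rpower_gt0.
      assert (E1 : Rpower (hcos t) (- (p / 2)) = X / w).
      { replace (hcos t) with (r * t ^ 2) by (unfold r; field; lra).
        rewrite <- Rpower_mult_distr by easy. unfold w. rewrite Rpower_Ropp.
        rewrite <- (Rpower_2 t) by lra. rewrite Rpower_mult.
        replace (2 * - (p / 2)) with (- p) by field. fold X. field.
        apply Rgt_not_eq, Rpower_gt0. }
      rewrite (Rpower_pred (hcos t)) by easy. rewrite (Rpower_pred t) by lra.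
      unfold theta. rewrite E1. fold X.
      replace (hcos t) with (r * t ^ 2) by (unfold r; field; lra).
      match goal with |- 0 <= ?e => replace e with
        (X / (w * t ^ 2) * ((p + 1) * w - (p * (sin t / (t * cos t)) / r + 1))) by (field; lra) end.
      apply Rmult_le_pos; [|lra]. left; apply Rdiv_lt_0_compat; [easy|]. now apply Rmult_lt_0_compat. }
  replace (theta p y * x) with (theta p y / y * (x * y)) by (field; lra).
  replace (theta p x * y) with (theta p x / x * (x * y)) by (field; lra).
  apply Rmult_le_compat_r; [nra|lra].
Qed.

(** For c = k pi this is p times the mass that t^(-p-1) dt gives to (c - h, c + h), the k-th
    interval on which |cos t| > cos h. *)
Definition sigma (p c h : R) : R := Rpower (c - h) (- p) - Rpower (c + h) (- p).

Lemma sigma_ge0 (p c h : R) : 0 <= p -> 0 <= h < c -> 0 <= sigma p c h.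
Proof. intros Hp H. unfold sigma. pose proof (Rpower_neg_decr (c - h) (c + h) p Hp ltac:(lra)). lra. Qed.

Lemma sigma_0 (p c : R) : sigma p c 0 = 0.
Proof. unfold sigma. rewrite Rminus_0_r, Rplus_0_r. ring. Qed.

Lemma is_derive_sigma (p c h : R) : 0 <= h < c ->
  is_derive (sigma p c) h (p * Rpower (c - h) (- p - 1) + p * Rpower (c + h) (- p - 1)).
Proof.
  intros H.
  replace (p * Rpower (c - h) (- p - 1) + p * Rpower (c + h) (- p - 1))
    with (minus (scal (- 1) (- p * Rpower (c - h) (- p - 1)))
       (scal 1 (- p * Rpower (c + h) (- p - 1)))).
  2:{ unfold minus, plus, opp, scal; simpl; unfold mult; simpl. ring. }
  apply (is_derive_minus (fun h => Rpower (c - h) (- p)) (fun h => Rpower (c + h) (- p))).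
  - apply (is_derive_comp (fun y => Rpower y (- p)) (fun h => c - h)).
    + apply is_derive_Rpower; lra.
    + auto_derive; [easy|ring].
  - apply (is_derive_comp (fun y => Rpower y (- p)) (fun h => c + h)).
    + apply is_derive_Rpower; lra.
    + auto_derive; [easy|ring].
Qed.

(** [sigma p c] vanishes at 0 and has an increasing derivative, so its slopes from the origin
    increase. *)
Lemma sigma_slope (p c x y : R) : 0 <= p -> 0 <= x <= y -> y < c ->
  sigma p c x * y <= sigma p c y * x.
Proof.
  intros Hp Hxy Hy.
  set (ds := fun h => p * Rpower (c - h) (- p - 1) + p * Rpower (c + h) (- p - 1)).
  assert (Hmono : forall u v, 0 <= u <= v -> v < c -> ds u <= ds v).
  { intros u v Huv Hv. apply (derive_nonneg_le ds (fun h =>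
       p * (p + 1) * (Rpower (c - h) (- p - 1 - 1) - Rpower (c + h) (- p - 1 - 1)))); [lra| |].
    - intros h Hh. unfold ds.
      replace (p * (p + 1) * (Rpower (c - h) (- p - 1 - 1) - Rpower (c + h) (- p - 1 - 1)))
        with (plus (scal p (scal (-1) ((- p - 1) * Rpower (c - h) (- p - 1 - 1))))
             (scal p (scal 1 ((- p - 1) * Rpower (c + h) (- p - 1 - 1))))).
      2:{ unfold minus, plus, opp, scal; simpl; unfold mult; simpl. ring. }
      apply (is_derive_plus (fun h => p * Rpower (c - h) (- p - 1)) (fun h => p * Rpower (c + h) (- p - 1))).
      + apply (is_derive_scal (fun h => Rpower (c - h) (- p - 1)) h p).
        apply (is_derive_comp (fun y => Rpower y (- p - 1)) (fun h => c - h)).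
        * apply is_derive_Rpower; lra.
        * auto_derive; [easy|ring].
      + apply (is_derive_scal (fun h => Rpower (c + h) (- p - 1)) h p).
        apply (is_derive_comp (fun y => Rpower y (- p - 1)) (fun h => c + h)).
        * apply is_derive_Rpower; lra.
        * auto_derive; [easy|ring].
    - intros h Hh. apply Rmult_le_pos; [nra|].
      replace (- p - 1 - 1) with (- (p + 2)) by ring.
      pose proof (Rpower_neg_decr (c - h) (c + h) (p + 2) ltac:(lra) ltac:(lra)). lra. }
  assert (Hmvt : forall u v, 0 <= u <= v -> v < c -> exists w, u <= w <= v /\
     sigma p c v - sigma p c u = ds w * (v - u)).
  { intros u v Huv Hv. destruct (MVT_gen (sigma p c) u v ds) as [w Hw].
    - intros t Ht. rewrite Rmin_left, Rmax_right in Ht by lra. apply is_derive_sigma; lra.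
    - intros t Ht. rewrite Rmin_left, Rmax_right in Ht by lra.
      apply continuity_pt_filterlim, (ex_derive_continuous (sigma p c)).
      eexists; apply is_derive_sigma; lra.
    - rewrite Rmin_left, Rmax_right in Hw by lra. now exists w. }
  destruct (Hmvt 0 x ltac:(lra) ltac:(lra)) as [w1 [H1 E1]].
  destruct (Hmvt x y ltac:(lra) ltac:(lra)) as [w2 [H2 E2]].
  pose proof (Hmono w1 w2 ltac:(lra) ltac:(lra)) as H12.
  rewrite sigma_0, !Rminus_0_r in E1.
  replace (sigma p c y) with (ds w1 * x + ds w2 * (y - x)) by lra. rewrite E1.
  assert (0 <= (ds w2 - ds w1) * ((y - x) * x)) by (apply Rmult_le_pos; nra). nra.
Qed.

Definition Tsum (p : R) (n : nat) (x : R) : R := sumN n (fun k => sigma p (INR k * PI) x).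

Lemma sumN_ext (n : nat) (f g : nat -> R) :
  (forall k, (1 <= k <= n)%nat -> f k = g k) -> sumN n f = sumN n g.
Proof.
  induction n as [|n IH]; intros H; simpl; [easy|].
  rewrite IH by (intros; apply H; lia). now rewrite H by lia.
Qed.

Lemma sumN_le (n : nat) (f g : nat -> R) :
  (forall k, (1 <= k <= n)%nat -> f k <= g k) -> sumN n f <= sumN n g.
Proof.
  induction n as [|n IH]; intros H; simpl; [lra|].
  apply Rplus_le_compat; [apply IH; intros; apply H|apply H]; lia.
Qed.

Lemma sumN_scal (n : nat) (c : R) (f : nat -> R) : sumN n (fun k => f k * c) = sumN n f * c.
Proof. induction n as [|n IH]; simpl; [ring|]. rewrite IH. ring. Qed.

Lemma INR_PI_ge (k : nat) : (1 <= k)%nat -> PI <= INR k * PI.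
Proof.
  intros Hk. pose proof PI_RGT_0. assert (1 <= INR k) by (apply (le_INR 1); easy). nra.
Qed.

Lemma Tsum_slope (p : R) (n : nat) (x y : R) : 0 <= p -> 0 <= x <= y -> y < PI / 2 ->
  Tsum p n x * y <= Tsum p n y * x.
Proof.
  intros Hp Hxy Hy. unfold Tsum. rewrite <- !sumN_scal. apply sumN_le. intros k Hk.
  pose proof (INR_PI_ge k ltac:(lia)). apply sigma_slope; lra.
Qed.

Lemma Tsum_incr (p : R) (n : nat) (x : R) : 0 <= p -> 0 <= x <= PI / 2 -> Tsum p n x <= Tsum p (S n) x.
Proof.
  intros Hp Hx. unfold Tsum. change (sumN (S n) ?f) with (sumN n f + f (S n)).
  pose proof (INR_PI_ge (S n) ltac:(lia)). pose proof PI_RGT_0.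
  pose proof (sigma_ge0 p (INR (S n) * PI) x Hp ltac:(lra)). lra.
Qed.

(** Since 2 x <= pi, consecutive intervals around the multiples of pi are disjoint, and the
    decrements of a decreasing power are dominated by a telescoping sum. *)
Lemma Tsum_remainder (p : R) (n m : nat) (x : R) : 0 <= p -> 0 <= x <= PI / 2 ->
  Tsum p (n + m) x - Tsum p n x <=
  Rpower (INR (S n) * PI - x) (- p) - Rpower (INR (S (n + m)) * PI - x) (- p).
Proof.
  intros Hp Hx. pose proof PI_RGT_0. induction m as [|m IH]; [rewrite Nat.add_0_r; lra|].
  rewrite Nat.add_succ_r. unfold Tsum in *. change (sumN (S ?n) ?f) with (sumN n f + f (S n)).
  unfold sigma at 2.
  assert (Rpower (INR (S (S (n + m))) * PI - x) (- p) <= Rpower (INR (S (n + m)) * PI + x) (- p)).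
  { pose proof (INR_PI_ge (S (n + m)) ltac:(lia)).
    apply Rpower_neg_decr; [easy|]. rewrite (S_INR (S (n + m))). lra. }
  lra.
Qed.

Definition Tinf (p x : R) : R := real (Lim_seq (fun n => Tsum p n x)).

Lemma Tsum_bound (p : R) (n : nat) (x : R) : 0 <= p -> 0 <= x <= PI / 2 ->
  Tsum p n x <= Rpower (PI - x) (- p).
Proof.
  intros Hp Hx. pose proof (Tsum_remainder p 0 n x Hp Hx) as H.
  unfold Tsum at 2 in H. simpl sumN in H. change (INR 1) with 1 in H. rewrite Rmult_1_l in H.
  pose proof (Rpower_gt0 (INR (S (0 + n)) * PI - x) (- p)). simpl Nat.add in *. lra.
Qed.

Lemma is_lim_Tsum (p x : R) : 0 <= p -> 0 <= x <= PI / 2 ->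
  is_lim_seq (fun n => Tsum p n x) (Tinf p x).
Proof.
  intros Hp Hx. apply Lim_seq_correct'.
  apply ex_finite_lim_seq_incr with (Rpower (PI - x) (- p)).
  - intros n. now apply Tsum_incr.
  - intros n. now apply Tsum_bound.
Qed.

Lemma Tinf_remainder (p : R) (n : nat) (x : R) : 0 <= p -> 0 <= x <= PI / 2 ->
  Tsum p n x <= Tinf p x <= Tsum p n x + Rpower (INR (S n) * PI - x) (- p).
Proof.
  intros Hp Hx. pose proof (is_lim_Tsum p x Hp Hx) as L.
  apply (is_lim_seq_incr_n _ n) in L. split.
  - refine (is_lim_seq_le _ _ (Tsum p n x) (Tinf p x) _ (is_lim_seq_const _) L).
    intros m. induction m as [|m IH]; [simpl; lra|].
    eapply Rle_trans; [apply IH|]. now apply Tsum_incr.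
  - refine (is_lim_seq_le _ _ (Tinf p x) (Tsum p n x + Rpower (INR (S n) * PI - x) (- p)) _ L (is_lim_seq_const _)).
    intros m. pose proof (Tsum_remainder p n m x Hp Hx) as H. rewrite (Nat.add_comm m n).
    pose proof (Rpower_gt0 (INR (S (n + m)) * PI - x) (- p)). lra.
Qed.

Lemma Tinf_slope (p x y : R) : 0 <= p -> 0 <= x <= y -> y < PI / 2 ->
  Tinf p x * y <= Tinf p y * x.
Proof.
  intros Hp Hxy Hy.
  refine (is_lim_seq_le (fun n => Tsum p n x * y) (fun n => Tsum p n y * x) (Tinf p x * y) (Tinf p y * x) _ _ _).
  - intros n. now apply Tsum_slope.
  - apply (is_lim_seq_scal_r _ y (Tinf p x)). apply is_lim_Tsum; lra.
  - apply (is_lim_seq_scal_r _ x (Tinf p y)). apply is_lim_Tsum; lra.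
Qed.

Lemma is_lim_INR_PI_neg_power (p y : R) : 0 < p -> Rabs y <= PI ->
  is_lim_seq (fun n => Rpower (INR (S (S n)) * PI + y) (- p)) 0.
Proof.
  intros Hp Hy. apply Rabs_le_between in Hy. pose proof PI_bounds as HP.
  assert (Hb : forall n, Rpower (INR (S (S n)) * PI + y) (- p) <= Rpower (INR (S n)) (- p)).
  { intros n. apply Rpower_neg_decr; [lra|]. rewrite (S_INR (S n)).
    pose proof (lt_0_INR (S n) ltac:(lia)). nra. }
  apply is_lim_seq_le_le with (fun _ => 0) (fun n => Rpower (INR (S n)) (- p)).
  - intros n. split; [left; apply Rpower_gt0|apply Hb].
  - apply is_lim_seq_const.
  - apply is_lim_seq_spec. intros eps. 
    assert (He : 0 < Rpower eps (- / p)) by apply Rpower_gt0.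
    destruct (nfloor_ex (Rpower eps (- / p)) ltac:(lra)) as [N [_ HN]].
    exists N. intros n Hn. rewrite Rminus_0_r, Rabs_pos_eq by (left; apply Rpower_gt0).
    replace (pos eps) with (Rpower (Rpower eps (- / p)) (- p)).
    2:{ rewrite Rpower_mult. replace (- / p * - p) with 1 by (field; lra).
        apply Rpower_1, cond_pos. }
    rewrite !(Rpower_Ropp _ p). apply Rinv_lt_contravar.
    { apply Rmult_lt_0_compat; apply Rpower_gt0. }
    apply Rlt_Rpower_l; [easy|]. split; [easy|]. eapply Rlt_le_trans; [apply HN|].
    rewrite S_INR. apply Rplus_le_compat_r, le_INR. easy.
Qed.

(* The gaps [[k pi + x, (k+1) pi - x]] are centred in [[k pi, (k+1) pi]], so [sigma_slope]
   compares the two decrements; the sum over [k] then telescopes. *)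
Lemma Tsum_lower (p : R) (n : nat) (x : R) : 0 <= p -> 0 <= x <= PI / 2 ->
  Rpower (PI - x) (- p) - (1 - 2 * x / PI) * (Rpower PI (- p) - Rpower (INR (S n) * PI) (- p))
    - Rpower (INR (S n) * PI + x) (- p) <= Tsum p (S n) x.
Proof.
  intros Hp Hx. pose proof PI_RGT_0 as HP. induction n as [|n IH].
  - unfold Tsum, sigma. simpl. rewrite !Rmult_1_l. lra.
  - unfold Tsum in *. change (sumN (S (S n)) ?f) with (sumN (S n) f + f (S (S n))).
    set (c := INR (S n) * PI) in *.
    assert (Hc : PI <= c) by (apply INR_PI_ge; lia).
    assert (E : INR (S (S n)) * PI = c + PI) by (unfold c; rewrite (S_INR (S n)); ring).
    rewrite E. cbv beta. unfold sigma at 2. rewrite E.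
    pose proof (sigma_slope p (c + PI / 2) (PI / 2 - x) (PI / 2) Hp ltac:(lra) ltac:(lra)) as H.
    unfold sigma in H.
    replace (c + PI / 2 - (PI / 2 - x)) with (c + x) in H by field.
    replace (c + PI / 2 + (PI / 2 - x)) with (c + PI - x) in H by field.
    replace (c + PI / 2 - PI / 2) with c in H by field.
    replace (c + PI / 2 + PI / 2) with (c + PI) in H by field.
    assert (H2 : Rpower (c + x) (- p) - Rpower (c + PI - x) (- p) <=
      (1 - 2 * x / PI) * (Rpower c (- p) - Rpower (c + PI) (- p))).
    { apply (Rmult_le_reg_r (PI / 2)); [lra|].
      eapply Rle_trans; [apply H|]. right. field. lra. }
    lra.
Qed.

Lemma Tinf_lower (p x : R) : 0 < p -> 0 <= x <= PI / 2 ->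
  Rpower (PI - x) (- p) - (1 - 2 * x / PI) * Rpower PI (- p) <= Tinf p x.
Proof.
  intros Hp Hx. pose proof PI_RGT_0 as HP.
  pose proof (is_lim_Tsum p x ltac:(lra) Hx) as L.
  apply (is_lim_seq_incr_n _ 2) in L.
  refine (is_lim_seq_le (fun n => (Rpower (PI - x) (- p) - (1 - 2 * x / PI) * Rpower PI (- p))
     - Rpower (INR (S (S n)) * PI + x) (- p)) _
     (Rpower (PI - x) (- p) - (1 - 2 * x / PI) * Rpower PI (- p)) (Tinf p x) _ _ L).
  - intros n. pose proof (Tsum_lower p (S n) x ltac:(lra) Hx) as H.
    replace (n + 2)%nat with (S (S n)) by lia.
    pose proof (Rpower_gt0 (INR (S (S n)) * PI) (- p)).
    assert (0 <= (1 - 2 * x / PI) * Rpower (INR (S (S n)) * PI) (- p)); [|lra].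
    apply Rmult_le_pos; [|lra].
    assert (2 * x / PI <= 1); [|lra]. apply Rmult_le_reg_r with PI; [lra|].
    replace (2 * x / PI * PI) with (2 * x) by (field; lra). lra.
  - replace (Finite (Rpower (PI - x) (- p) - (1 - 2 * x / PI) * Rpower PI (- p)))
      with (Finite (Rpower (PI - x) (- p) - (1 - 2 * x / PI) * Rpower PI (- p) - 0)) by (f_equal; ring).
    apply is_lim_seq_minus'; [apply is_lim_seq_const|].
    apply is_lim_INR_PI_neg_power; [easy|]. rewrite Rabs_pos_eq; lra.
Qed.

(** * Their single crossing *)

Lemma Rpower_antitone_exponent (u a b : R) : 0 < u <= 1 -> a <= b -> Rpower u b <= Rpower u a.
Proof.
  intros Hu Hab. unfold Rpower.
  assert (Hl : ln u <= 0) by (pose proof (ln_le_sub1 u ltac:(lra)); lra).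
  destruct (Req_dec (b * ln u) (a * ln u)) as [->|H]; [lra|].
  left; apply exp_increasing. nra.
Qed.

Lemma half_power_le (p : R) : 7 / 4 <= p -> Rpower (/ 2) p <= 8 / 25.
Proof.
  intros Hp. apply Rle_trans with (Rpower (/ 2) (7 / 4)).
  - apply Rpower_antitone_exponent; lra.
  - unfold Rpower. rewrite ln_Rinv by lra.
    (* The exponent 7/4 is a mean of 1 and 2 with weights 1/4 and 3/4, giving the bound 1/8 + 3/16 =
       5/16. *)
    pose proof (exp_convex (1 / 4) (- ln 2) (- ln 2 + - ln 2) ltac:(lra)) as H.
    rewrite (exp_plus (- ln 2) (- ln 2)), exp_Ropp, exp_ln in H by lra.
    replace (7 / 4 * - ln 2) with (1 / 4 * - ln 2 + (1 - 1 / 4) * (- ln 2 + - ln 2)) by field.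
    lra.
Qed.

(** The singular part - d ln d of - d ln (sin d) is at most 1/e, and the correction is of order
    d^3. *)
Lemma hcos_endpoint (d : R) : 0 < d <= 3715 / 10000 ->
  hcos (PI / 2 - d) * d <= 2 * (37 / 100 + 172 / 1000 * d ^ 3).
Proof.
  intros Hd. pose proof PI_bounds as HP. unfold hcos.
  rewrite cos_shift.
  assert (Hv : 0 <= d ^ 2 <= 14 / 100) by nra.
  assert (Hs : d * (1 - d ^ 2 / 6) <= sin d).
  { pose proof (sin_lower d ltac:(lra)).
    assert (0 <= d ^ 5 / 120 - d ^ 7 / 5040); [|nra].
    replace (d ^ 5 / 120 - d ^ 7 / 5040) with (d ^ 5 * ((1 - d ^ 2 / 42) / 120)) by field.
    apply Rmult_le_pos; [apply pow_le|]; lra. }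
  assert (Hp : 0 < d * (1 - d ^ 2 / 6)) by (apply Rmult_lt_0_compat; lra).
  assert (H1 : ln d + ln (1 - d ^ 2 / 6) <= ln (sin d)).
  { rewrite <- ln_mult by lra. destruct Hs as [Hs|<-]; [left; now apply ln_increasing|lra]. }
  assert (H2 : - ln (1 - d ^ 2 / 6) <= 172 / 1000 * d ^ 2).
  { rewrite <- ln_Rinv by lra.
    eapply Rle_trans; [apply ln_le_sub1, Rinv_0_lt_compat; lra|].
    apply (Rmult_le_reg_r (1 - d ^ 2 / 6)); [lra|].
    rewrite Rmult_minus_distr_r, Rinv_l by lra. nra. }
  assert (H3 : - ln d * d <= 37 / 100).
  { pose proof (ln_le_sub1 (/ (d * exp 1))) as H.
    pose proof (exp_pos 1). pose proof exp_1_gt as He.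
    assert (Hde : 0 < d * exp 1) by (apply Rmult_lt_0_compat; lra).
    specialize (H (Rinv_0_lt_compat _ Hde)).
    rewrite ln_Rinv, ln_mult, ln_exp in H by lra.
    assert (H' : - ln d <= / (d * exp 1)) by lra.
    apply (Rmult_le_compat_r d) in H'; [|lra].
    replace (/ (d * exp 1) * d) with (/ exp 1) in H' by (field; lra).
    eapply Rle_trans; [apply H'|]. replace (37 / 100) with (/ (1 / (37 / 100))) by field.
    apply Rinv_le_contravar; lra. }
  nra.
Qed.

(** After division by x^(-p) the claim involves powers of x^2 / hcos x and x / (pi - x). Both bases
    are at most 1, so p <= 2 allows the powers to be bounded below by the first and the second
    power; apart from [hcos] a rational inequality in d = pi/2 - x remains. *)
Lemma theta_le_Tinf_endpoint (p x : R) : 7 / 4 <= p <= 2 -> 6 / 5 <= x < PI / 2 ->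
  theta p x <= Tinf p x.
Proof.
  intros Hp Hx. pose proof PI_bounds as HP.
  eapply Rle_trans; [|apply Tinf_lower; lra].
  unfold theta. set (X := Rpower x (- p)).
  assert (HX : 0 < X) by apply Rpower_gt0.
  pose proof (hcos_gt0 x ltac:(lra)) as Hh.
  pose proof (hcos_ge_sqr x ltac:(lra)) as Hh2.
  assert (Hx2 : 0 < x ^ 2) by nra.
  assert (E1 : Rpower (hcos x) (- (p / 2)) = X * Rpower (x ^ 2 / hcos x) (p / 2)).
  { rewrite Rpower_div by easy. rewrite <- (Rpower_2 x) by lra. rewrite Rpower_mult.
    replace (2 * (p / 2)) with p by field. unfold X. rewrite !Rpower_Ropp.
    field. split; apply Rgt_not_eq, Rpower_gt0. }
  assert (E2 : forall c, 0 < c -> Rpower c (- p) = X * Rpower (x / c) p).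
  { intros c Hc. rewrite Rpower_div by lra. unfold X. rewrite !Rpower_Ropp.
    field. split; apply Rgt_not_eq, Rpower_gt0. }
  rewrite E1, (E2 (PI - x)), (E2 PI) by lra.
  assert (F1 : x ^ 2 / hcos x <= Rpower (x ^ 2 / hcos x) (p / 2)).
  { assert (0 < x ^ 2 / hcos x <= 1).
    { split; [now apply Rdiv_lt_0_compat|].
      apply (Rmult_le_reg_r (hcos x)); [easy|].
      replace (x ^ 2 / hcos x * hcos x) with (x ^ 2) by (field; lra). lra. }
    rewrite <- (Rpower_1 (x ^ 2 / hcos x)) at 1 by lra.
    apply Rpower_antitone_exponent; lra. }
  assert (F2 : (x / (PI - x)) ^ 2 <= Rpower (x / (PI - x)) p).
  { assert (0 < x / (PI - x) <= 1).
    { split; [apply Rdiv_lt_0_compat; lra|].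
      apply (Rmult_le_reg_r (PI - x)); [lra|].
      replace (x / (PI - x) * (PI - x)) with x by (field; lra). lra. }
    rewrite <- (Rpower_2 (x / (PI - x))) by lra.
    apply Rpower_antitone_exponent; lra. }
  assert (F3 : Rpower (x / PI) p <= 8 / 25).
  { apply Rle_trans with (Rpower (/ 2) p); [|apply half_power_le; lra].
    apply Rle_Rpower_l; [lra|]. split; [apply Rdiv_lt_0_compat; lra|].
    apply (Rmult_le_reg_r PI); [lra|]. replace (x / PI * PI) with x by (field; lra). lra. }
  set (d := PI / 2 - x) in *. set (q := PI / 2) in *.
  assert (Hd : 0 < d <= 3715 / 10000) by (unfold d, q in *; lra).
  assert (Hq : 157 / 100 <= q <= 15715 / 10000) by (unfold q in *; lra).
  pose proof (hcos_endpoint d Hd) as K. fold q in K.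
  replace (q - d) with x in K by (unfold d; ring).
  pose proof (endpoint_certificate d ltac:(lra)) as C.
  set (k := 2 * (37 / 100 + 172 / 1000 * d ^ 3)) in *.
  assert (Hk : 0 <= k) by (unfold k; pose proof (pow_le d 3 ltac:(lra)); lra).
  assert (G : k * (4 * q + 204 / 1000 * (q + d) ^ 2) <= (q ^ 2 - d ^ 2) ^ 2).
  { apply Rle_trans with (((157 / 100) ^ 2 - d ^ 2) ^ 2).
    - eapply Rle_trans; [|apply C]. apply Rmult_le_compat_l; [easy|].
      assert ((q + d) ^ 2 <= (15715 / 10000 + d) ^ 2) by (apply pow_incr; lra). lra.
    - apply pow_incr. assert (d ^ 2 <= 1) by nra.
      assert ((157 / 100) ^ 2 <= q ^ 2) by (apply pow_incr; lra). lra. }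
  assert (G2 : d * (4 * q / (q + d) ^ 2 + 204 / 1000) <= x ^ 2 / hcos x).
  { apply (Rmult_le_reg_r (hcos x * (q + d) ^ 2)).
    { apply Rmult_lt_0_compat; [easy|nra]. }
    replace (x ^ 2 / hcos x * (hcos x * (q + d) ^ 2)) with ((q ^ 2 - d ^ 2) ^ 2)
      by (replace x with (q - d) at 1 by (unfold d; ring); field; lra).
    replace (d * (4 * q / (q + d) ^ 2 + 204 / 1000) * (hcos x * (q + d) ^ 2))
      with (hcos x * d * (4 * q + 204 / 1000 * (q + d) ^ 2)) by (field; lra).
    eapply Rle_trans; [|apply G]. apply Rmult_le_compat_r; [nra|easy]. }
  assert (G3 : 1 - (x / (PI - x)) ^ 2 = d * (4 * q / (q + d) ^ 2)).
  { replace (PI - x) with (q + d) by (unfold d, q; field).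
    replace x with (q - d) by (unfold d; ring). field. lra. }
  assert (G4 : (1 - 2 * x / PI) * Rpower (x / PI) p <= d * (204 / 1000)).
  { apply Rle_trans with (d / q * (8 / 25)).
    - replace (1 - 2 * x / PI) with (d / q) by (unfold d, q; field; lra).
      apply Rmult_le_compat_l; [|easy]. left; apply Rdiv_lt_0_compat; lra.
    - replace (d / q * (8 / 25)) with (d * (8 / 25 * / q)) by (field; lra).
      apply Rmult_le_compat_l; [lra|].
      assert (/ q <= / (157 / 100)) by (apply Rinv_le_contravar; lra). lra. }
  assert (0 <= X * (Rpower (x ^ 2 / hcos x) (p / 2) + Rpower (x / (PI - x)) p
     - (1 - 2 * x / PI) * Rpower (x / PI) p - 1)); [|lra].
  apply Rmult_le_pos; lra.
Qed.

(** A decreasing ratio theta / x can cross the increasing ratio Tinf / x only once on (0, 6/5], and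
    beyond 6/5 the sign is known. The crossing level is the cosine of the last point where Tinf <=
    theta. *)
Theorem single_crossing (p : R) : 7 / 4 <= p <= 2 ->
  exists y0, 0 <= y0 <= 1 /\ forall x, 0 < x < PI / 2 ->
    (y0 < cos x -> Tinf p x <= theta p x) /\ (cos x < y0 -> theta p x <= Tinf p x).
Proof.
  intros Hp. pose proof PI_bounds as HP.
  (* The point 0 is adjoined so that the set is nonempty even if theta stays below [Tinf]. *)
  set (E := fun x => x = 0 \/ (0 < x <= 6 / 5 /\ Tinf p x <= theta p x)).
  assert (HE : forall x, E x -> 0 <= x <= 6 / 5) by (intros x [->|[H _]]; lra).
  destruct (completeness E) as [x0 [Hub Hlub]].
  - exists (6 / 5). intros x Hx. apply (HE x Hx).
  - exists 0. now left.
  - assert (Hx0 : 0 <= x0 <= 6 / 5).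
    { split; [apply Hub; now left|apply Hlub; intros x Hx; apply (HE x Hx)]. }
    exists (cos x0). split.
    { split; [left; apply cos_gt0; lra|]. apply COS_bound. }
    intros x Hx. split; intros Hc.
    + assert (Hlt : x < x0) by (apply cos_decreasing_0; lra).
      destruct (Classical_Prop.classic (exists e, E e /\ x < e)) as [[e [He Hxe]]|Hn].
      * destruct He as [->|[He1 He2]]; [lra|].
        pose proof (theta_slope p x e ltac:(lra) ltac:(lra) ltac:(lra)) as H1.
        pose proof (Tinf_slope p x e ltac:(lra) ltac:(lra) ltac:(lra)) as H2.
        apply (Rmult_le_reg_r e); [lra|]. nra.
      * exfalso. assert (x0 <= x); [|lra]. apply Hlub. intros e He.
        destruct (Rle_or_lt e x) as [|Hl]; [easy|]. exfalso. apply Hn. now exists e.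
    + assert (Hlt : x0 < x) by (apply cos_decreasing_0; lra).
      destruct (Rle_or_lt x (6 / 5)) as [Hs|Hs]; [|apply theta_le_Tinf_endpoint; lra].
      destruct (Rle_or_lt (theta p x) (Tinf p x)) as [|Hl]; [easy|exfalso].
      assert (x <= x0); [|lra]. apply Hub. right. lra.
Qed.

(** * The functional [g |-> int_0^oo g(t) t^(-p-1) dt] *)

Definition ker (p t : R) : R := Rpower t (- p - 1).

Definition adm (g : R -> R) : Prop := forall t, 0 < t -> continuous g t /\ 0 <= g t.

Definition window (p : R) (g : R -> R) (a b : R) : R := RInt (fun t => g t * ker p t) a b.

(** For nonnegative integrands the improper integral is the supremum over compact windows, so no
    choice of truncation enters its definition. *)
Definition is_phi (p : R) (g : R -> R) (v : R) : Prop :=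
  is_lub (fun r => exists a b, 0 < a <= b /\ r = window p g a b) v.

Lemma ker_gt0 (p t : R) : 0 < ker p t.
Proof. apply Rpower_gt0. Qed.

Lemma continuous_ker (p t : R) : 0 < t -> continuous (ker p) t.
Proof. apply continuous_Rpower. Qed.

Lemma ex_window (p : R) (g : R -> R) (a b : R) : adm g -> 0 < a <= b ->
  ex_RInt (fun t => g t * ker p t) a b.
Proof.
  intros Hg Hab. apply (ex_RInt_continuous (fun t => g t * ker p t)).
  intros t Ht. rewrite Rmin_left, Rmax_right in Ht by lra.
  apply (continuous_mult g (ker p)); [apply Hg; lra|apply continuous_ker; lra].
Qed.

Lemma window_ge0 (p : R) (g : R -> R) (a b : R) : adm g -> 0 < a <= b -> 0 <= window p g a b.
Proof.
  intros Hg Hab. apply RInt_ge_0; [lra|now apply ex_window|].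
  intros t Ht. apply Rmult_le_pos; [apply Hg; lra|left; apply ker_gt0].
Qed.

Lemma window_chasles (p : R) (g : R -> R) (a b c : R) : adm g -> 0 < a <= b -> b <= c ->
  window p g a c = window p g a b + window p g b c.
Proof.
  intros Hg Hab Hbc. symmetry. unfold window.
  apply (RInt_Chasles (fun t => g t * ker p t)); apply ex_window; try easy; lra.
Qed.

Lemma window_mono (p : R) (g : R -> R) (a b a' b' : R) : adm g ->
  0 < a' <= a -> a <= b <= b' -> window p g a b <= window p g a' b'.
Proof.
  intros Hg Ha Hb.
  rewrite (window_chasles p g a' a b'), (window_chasles p g a b b') by (try easy; lra).
  pose proof (window_ge0 p g a' a Hg ltac:(lra)). pose proof (window_ge0 p g b b' Hg ltac:(lra)). lra.
Qed.

Lemma window_le (p : R) (f g : R -> R) (a b : R) : adm f -> adm g -> 0 < a <= b ->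
  (forall t, a < t < b -> f t <= g t) -> window p f a b <= window p g a b.
Proof.
  intros Hf Hg Hab H. apply RInt_le; [lra|now apply ex_window|now apply ex_window|].
  intros t Ht. apply Rmult_le_compat_r; [left; apply ker_gt0|now apply H].
Qed.

Lemma phi_window (p : R) (g : R -> R) (v a b : R) :
  is_phi p g v -> 0 < a <= b -> window p g a b <= v.
Proof. intros [H _] Hab. apply H. now exists a, b. Qed.

Lemma phi_lim (p : R) (g : R -> R) (v : R) (a b : nat -> R) : adm g -> is_phi p g v ->
  (forall n, 0 < a n <= b n) -> is_lim_seq a 0 -> is_lim_seq b p_infty ->
  is_lim_seq (fun n => window p g (a n) (b n)) v.
Proof.
  intros Hg Hv Hab Ha Hb. apply is_lim_seq_spec. intros eps. destruct Hv as [Hub Hl].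
  destruct (Classical_Prop.classic (exists c d, 0 < c <= d /\ v - eps < window p g c d)) as [[c [d [Hcd H]]]|Hn].
  - apply is_lim_seq_spec in Ha. apply is_lim_seq_spec in Hb.
    destruct (Ha (mkposreal c (proj1 Hcd))) as [N1 H1]. destruct (Hb d) as [N2 H2].
    exists (Nat.max N1 N2). intros n Hn.
    specialize (H1 n ltac:(lia)). specialize (H2 n ltac:(lia)). simpl in H1.
    rewrite Rminus_0_r, Rabs_pos_eq in H1 by (pose proof (Hab n); lra).
    pose proof (window_mono p g c d (a n) (b n) Hg ltac:(pose proof (Hab n); lra) ltac:(lra)).
    assert (window p g (a n) (b n) <= v) by (apply Hub; now exists (a n), (b n)).
    apply Rabs_lt_between'. pose proof (cond_pos eps). lra.
  - exfalso. assert (v <= v - eps); [|pose proof (cond_pos eps); lra].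
    apply Hl. intros r [c [d [Hcd ->]]]. destruct (Rle_or_lt (window p g c d) (v - eps)); [easy|].
    exfalso. apply Hn. now exists c, d.
Qed.

Lemma lim_left_ends : is_lim_seq (fun n => / INR (S n)) 0.
Proof.
  apply (is_lim_seq_incr_1 (fun n => / INR n)).
  replace (Finite 0) with (Rbar_inv p_infty) by easy.
  apply is_lim_seq_inv; [apply is_lim_seq_INR|easy].
Qed.

Lemma lim_right_ends : is_lim_seq (fun n => INR (S n)) p_infty.
Proof. apply (is_lim_seq_incr_1 INR), is_lim_seq_INR. Qed.

Lemma ends_ordered (n : nat) : 0 < / INR (S n) <= INR (S n).
Proof.
  assert (H : 1 <= INR (S n)) by (apply (le_INR 1); lia).
  split; [apply Rinv_0_lt_compat; lra|].
  apply Rle_trans with (/ 1); [apply Rinv_le_contravar; lra|lra].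
Qed.

Lemma phi_lim_std (p : R) (g : R -> R) (v : R) : adm g -> is_phi p g v ->
  is_lim_seq (fun n => window p g (/ INR (S n)) (INR (S n))) v.
Proof.
  intros Hg Hv. apply phi_lim; try easy.
  - apply ends_ordered.
  - apply lim_left_ends.
  - apply lim_right_ends.
Qed.

(** Windows are monotone, so one exhausting sequence determines the supremum; linearity then passes
    to the limit from identities on windows. *)
Lemma phi_of_lim_std (p : R) (g : R -> R) (v : R) : adm g ->
  is_lim_seq (fun n => window p g (/ INR (S n)) (INR (S n))) v -> is_phi p g v.
Proof.
  intros Hg Hv. split.
  - intros r [a [b [Hab ->]]].
    refine (is_lim_seq_le_loc (fun _ => window p g a b) _ (window p g a b) v _ (is_lim_seq_const _) Hv).
    pose proof lim_left_ends as L1. pose proof lim_right_ends as L2.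
    apply is_lim_seq_spec in L1. apply is_lim_seq_spec in L2.
    destruct (L1 (mkposreal a (proj1 Hab))) as [N1 H1]. destruct (L2 b) as [N2 H2].
    exists (Nat.max N1 N2). intros n Hn. specialize (H1 n ltac:(lia)). specialize (H2 n ltac:(lia)).
    cbn [pos] in H1. rewrite Rminus_0_r, Rabs_pos_eq in H1 by (left; apply ends_ordered).
    apply window_mono; try easy; [|lra]. split; [apply ends_ordered|lra].
  - intros B HB. refine (is_lim_seq_le _ (fun _ => B) v B _ Hv (is_lim_seq_const _)).
    intros n. apply HB. exists (/ INR (S n)), (INR (S n)). split; [apply ends_ordered|easy].
Qed.

Lemma phi_unique (p : R) (g : R -> R) (u v : R) : is_phi p g u -> is_phi p g v -> u = v.
Proof. intros [H1 H2] [H3 H4]. apply Rle_antisym; [now apply H2|now apply H4]. Qed.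

Lemma phi_le (p : R) (f g : R -> R) (u v : R) : adm f -> adm g ->
  (forall t, 0 < t -> f t <= g t) -> is_phi p f u -> is_phi p g v -> u <= v.
Proof.
  intros Hf Hg H [_ Hu] Hv. apply Hu. intros r [a [b [Hab ->]]].
  eapply Rle_trans; [|apply (phi_window p g v a b Hv Hab)].
  apply window_le; try easy. intros; apply H; lra.
Qed.

Lemma window_ext (p : R) (f g : R -> R) (a b : R) : 0 < a <= b ->
  (forall t, 0 < t -> f t = g t) -> window p f a b = window p g a b.
Proof.
  intros Hab H. apply RInt_ext. intros t Ht. rewrite Rmin_left in Ht by lra.
  rewrite H; [easy|lra].
Qed.

Lemma phi_ext (p : R) (f g : R -> R) (v : R) :
  (forall t, 0 < t -> f t = g t) -> is_phi p f v -> is_phi p g v.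
Proof.
  intros H [H1 H2]. split.
  - intros r [a [b [Hab ->]]]. apply H1. exists a, b. split; [easy|].
    symmetry; now apply window_ext.
  - intros B HB. apply H2. intros r [a [b [Hab ->]]]. apply HB. exists a, b. split; [easy|].
    now apply window_ext.
Qed.

Lemma adm_plus (f g : R -> R) : adm f -> adm g -> adm (fun t => f t + g t).
Proof.
  intros Hf Hg t Ht. destruct (Hf t Ht), (Hg t Ht). split; [|lra].
  now apply (continuous_plus f g).
Qed.

Lemma adm_scal (c : R) (g : R -> R) : 0 <= c -> adm g -> adm (fun t => c * g t).
Proof.
  intros Hc Hg t Ht. destruct (Hg t Ht). split; [|nra].
  now apply (continuous_scal_r c g).
Qed.

Lemma adm_dilate (l : R) (g : R -> R) : 0 < l -> adm g -> adm (fun t => g (l * t)).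
Proof.
  intros Hl Hg t Ht. destruct (Hg (l * t)) as [H1 H2]; [nra|]. split; [|easy].
  apply (continuous_comp (fun t => l * t) g); [|easy].
  apply (ex_derive_continuous (fun t => l * t)). now auto_derive.
Qed.

Lemma phi_plus (p : R) (f g : R -> R) (u v : R) : adm f -> adm g ->
  is_phi p f u -> is_phi p g v -> is_phi p (fun t => f t + g t) (u + v).
Proof.
  intros Hf Hg Hu Hv. apply phi_of_lim_std; [now apply adm_plus|].
  apply is_lim_seq_ext with
    (fun n => window p f (/ INR (S n)) (INR (S n)) + window p g (/ INR (S n)) (INR (S n))).
  - intros n. pose proof (ends_ordered n). symmetry. unfold window.
    rewrite <- (RInt_plus (fun t => f t * ker p t) (fun t => g t * ker p t)) by now apply ex_window.
    apply RInt_ext. intros t _. unfold plus; simpl. ring.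
  - apply is_lim_seq_plus'; now apply phi_lim_std.
Qed.

Lemma phi_scal (p c : R) (g : R -> R) (v : R) : 0 <= c -> adm g ->
  is_phi p g v -> is_phi p (fun t => c * g t) (c * v).
Proof.
  intros Hc Hg Hv. apply phi_of_lim_std; [now apply adm_scal|].
  apply is_lim_seq_ext with (fun n => c * window p g (/ INR (S n)) (INR (S n))).
  - intros n. pose proof (ends_ordered n). symmetry. unfold window.
    rewrite <- (RInt_scal (fun t => g t * ker p t)) by now apply ex_window.
    apply RInt_ext. intros t _. unfold scal; simpl; unfold mult; simpl. ring.
  - apply (is_lim_seq_scal_l _ c v). now apply phi_lim_std.
Qed.

Lemma window_dilate (p l : R) (g : R -> R) (a b : R) : 0 < l -> adm g -> 0 < a <= b ->
  window p (fun t => g (l * t)) a b = Rpower l p * window p g (l * a) (l * b).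
Proof.
  intros Hl Hg Hab. unfold window. apply is_RInt_unique.
  assert (H : is_RInt (fun t => g t * ker p t) (l * a + 0) (l * b + 0)
     (RInt (fun t => g t * ker p t) (l * a) (l * b))).
  { rewrite !Rplus_0_r. apply (RInt_correct (fun t => g t * ker p t)), ex_window; [easy|nra]. }
  pose proof (is_RInt_scal _ _ _ (Rpower l p) _ (is_RInt_comp_lin _ _ _ _ _ _ H)) as H2.
  eapply is_RInt_ext; [|apply H2].
  intros t Ht. rewrite Rmin_left in Ht by lra. unfold scal; simpl; unfold mult; simpl.
  rewrite Rplus_0_r. unfold ker. rewrite <- (Rpower_mult_distr l t) by lra.
  replace (Rpower l (- p - 1)) with (/ Rpower l p / l).
  - field. split; try apply Rgt_not_eq, Rpower_gt0; lra.
  - rewrite Rpower_pred, Rpower_Ropp by easy. easy.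
Qed.

Lemma phi_dilate (p l : R) (g : R -> R) (v : R) : 0 < l -> adm g ->
  is_phi p g v -> is_phi p (fun t => g (l * t)) (Rpower l p * v).
Proof.
  intros Hl Hg Hv. pose proof (Rpower_gt0 l p) as Hlp. split.
  - intros r [a [b [Hab ->]]]. rewrite window_dilate by easy.
    apply Rmult_le_compat_l; [lra|]. apply (phi_window p g v); [easy|nra].
  - intros B HB. apply (Rmult_le_reg_l (/ Rpower l p)); [now apply Rinv_0_lt_compat|].
    rewrite <- Rmult_assoc, Rinv_l, Rmult_1_l by lra.
    apply Hv. intros r [a [b [Hab ->]]].
    apply (Rmult_le_reg_l (Rpower l p)); [easy|]. rewrite <- Rmult_assoc, Rinv_r, Rmult_1_l by lra.
    apply HB. assert (0 < / l) by now apply Rinv_0_lt_compat.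
    exists (/ l * a), (/ l * b). split; [nra|].
    rewrite window_dilate by (try easy; nra). rewrite <- !Rmult_assoc, Rinv_r, !Rmult_1_l by lra. easy.
Qed.

Lemma is_RInt_Rpower (q a b : R) : q + 1 <> 0 -> 0 < a <= b ->
  is_RInt (fun t => Rpower t q) a b ((Rpower b (q + 1) - Rpower a (q + 1)) / (q + 1)).
Proof.
  intros Hq Hab.
  replace ((Rpower b (q + 1) - Rpower a (q + 1)) / (q + 1))
    with (minus (/ (q + 1) * Rpower b (q + 1)) (/ (q + 1) * Rpower a (q + 1)))
    by (unfold minus, plus, opp; simpl; field; easy).
  apply (is_RInt_derive (fun t => / (q + 1) * Rpower t (q + 1))).
  - intros t Ht. rewrite Rmin_left, Rmax_right in Ht by lra.
    replace (Rpower t q) with (scal (/ (q + 1)) ((q + 1) * Rpower t (q + 1 - 1))).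
    + apply (is_derive_scal (fun t => Rpower t (q + 1)) t (/ (q + 1))).
      apply is_derive_Rpower; lra.
    + unfold scal; simpl; unfold mult; simpl. replace (q + 1 - 1) with q by ring. field; easy.
  - intros t Ht. rewrite Rmin_left, Rmax_right in Ht by lra. apply continuous_Rpower; lra.
Qed.

(** The quadratic bound leaves t^(1-p) near 0 and the constant bound leaves t^(-p-1) near infinity;
    both are integrable for 0 < p < 2. *)
Lemma phi_exists (p C : R) (g : R -> R) : 0 < p < 2 -> adm g ->
  (forall t, 0 < t -> g t <= C * t ^ 2) -> (forall t, 0 < t -> g t <= C) -> exists v, is_phi p g v.
Proof.
  intros Hp Hg H1 H2.
  assert (HC : 0 <= C) by (pose proof (H2 1 ltac:(lra)); pose proof (proj2 (Hg 1 ltac:(lra))); lra).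
  destruct (completeness (fun r => exists a b, 0 < a <= b /\ r = window p g a b)) as [v Hv].
  - exists (C * / (2 - p) + C * / p). intros r [a [b [Hab ->]]].
    pose proof (Rmin_l a 1). pose proof (Rmin_r a 1). pose proof (Rmax_l b 1). pose proof (Rmax_r b 1).
    assert (0 < Rmin a 1) by (apply Rmin_glb_lt; lra).
    set (a' := Rmin a 1) in *. set (b' := Rmax b 1) in *.
    apply Rle_trans with (1 := window_mono p g a b a' b' Hg ltac:(lra) ltac:(lra)).
    rewrite (window_chasles p g a' 1 b') by (try easy; lra).
    assert (I1 : is_RInt (fun t => C * Rpower t (1 - p)) a' 1
       (C * ((Rpower 1 (1 - p + 1) - Rpower a' (1 - p + 1)) / (1 - p + 1))))
      by exact (is_RInt_scal _ _ _ C _ (is_RInt_Rpower (1 - p) a' 1 ltac:(lra) ltac:(lra))).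
    assert (I2 : is_RInt (fun t => C * Rpower t (- p - 1)) 1 b'
       (C * ((Rpower b' (- p - 1 + 1) - Rpower 1 (- p - 1 + 1)) / (- p - 1 + 1))))
      by exact (is_RInt_scal _ _ _ C _ (is_RInt_Rpower (- p - 1) 1 b' ltac:(lra) ltac:(lra))).
    apply Rplus_le_compat.
    + apply Rle_trans with (RInt (fun t => C * Rpower t (1 - p)) a' 1).
      * apply RInt_le; [lra|apply ex_window; [easy|lra]|eexists; apply I1|].
        intros t Ht. unfold ker.
        replace (1 - p) with (2 + (- p - 1)) by ring. rewrite Rpower_plus, Rpower_2 by lra.
        rewrite <- Rmult_assoc. apply Rmult_le_compat_r; [left; apply Rpower_gt0|]. apply H1; lra.
      * rewrite (is_RInt_unique _ _ _ _ I1).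
        apply Rmult_le_compat_l; [easy|]. rewrite Rpower_1_l.
        pose proof (Rpower_gt0 a' (1 - p + 1)). replace (1 - p + 1) with (2 - p) in * by ring.
        unfold Rdiv. rewrite <- (Rmult_1_l (/ (2 - p))) at 2.
        apply Rmult_le_compat_r; [left; apply Rinv_0_lt_compat|]; lra.
    + apply Rle_trans with (RInt (fun t => C * Rpower t (- p - 1)) 1 b').
      * apply RInt_le; [lra|apply ex_window; [easy|lra]|eexists; apply I2|].
        intros t Ht. unfold ker.
        apply Rmult_le_compat_r; [left; apply Rpower_gt0|]. apply H2; lra.
      * rewrite (is_RInt_unique _ _ _ _ I2).
        apply Rmult_le_compat_l; [easy|]. rewrite Rpower_1_l.
        pose proof (Rpower_gt0 b' (- p - 1 + 1)). replace (- p - 1 + 1) with (- p) in * by ring.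
        replace ((Rpower b' (- p) - 1) / - p) with ((1 - Rpower b' (- p)) * / p) by (field; lra).
        rewrite <- (Rmult_1_l (/ p)) at 2.
        apply Rmult_le_compat_r; [left; apply Rinv_0_lt_compat|]; lra.
  - exists (window p g 1 1), 1, 1. split; [lra|easy].
  - now exists v.
Qed.

Lemma phi_pos (p : R) (g : R -> R) (v : R) : adm g -> is_phi p g v ->
  (forall t, 1 < t < 2 -> 0 < g t) -> 0 < v.
Proof.
  intros Hg Hv H. eapply Rlt_le_trans; [|apply (phi_window p g v 1 2 Hv); lra].
  apply RInt_gt_0; [lra| |].
  - intros t Ht. apply Rmult_lt_0_compat; [now apply H|apply ker_gt0].
  - intros t Ht. apply (continuous_mult g (ker p)); [apply Hg; lra|apply continuous_ker; lra].
Qed.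

(** * Folding the half-line onto [(0, pi/2)] *)

(** Subtraction from 1 makes the integrals against t^(-p-1) dt converge at 0: this function and
    [gaussdef s] are both of order s t^2 / 2 there. *)
Definition cosdef (s t : R) : R := 1 - rpow (Rabs (cos t)) s.
Definition gaussdef (s t : R) : R := 1 - exp (- (s * t ^ 2 / 2)).

Lemma rpow_le1 (x s : R) : 0 <= s -> 0 <= x <= 1 -> rpow x s <= 1.
Proof. intros Hs Hx. rewrite <- (rpow_1_l s). apply rpow_le; lra. Qed.

Lemma Rabs_cos_le1 (t : R) : 0 <= Rabs (cos t) <= 1.
Proof. split; [apply Rabs_pos|]. apply Rabs_le, COS_bound. Qed.

Lemma cosdef_bounds (s t : R) : 0 <= s -> 0 <= cosdef s t <= 1.
Proof.
  intros Hs. unfold cosdef. pose proof (rpow_le1 _ s Hs (Rabs_cos_le1 t)).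
  pose proof (rpow_ge0 (Rabs (cos t)) s). lra.
Qed.

Lemma adm_cosdef (s : R) : 0 < s -> adm (cosdef s).
Proof.
  intros Hs t Ht. split; [|apply cosdef_bounds; lra].
  apply (continuous_minus (fun _ => 1) (fun t => rpow (Rabs (cos t)) s)); [apply continuous_const|].
  apply (continuous_comp cos (fun y => rpow (Rabs y) s)); [apply continuous_cos|].
  now apply continuous_rpow_abs.
Qed.

Lemma adm_gaussdef (s : R) : 0 <= s -> adm (gaussdef s).
Proof.
  intros Hs t Ht. split.
  - apply (ex_derive_continuous (gaussdef s)). unfold gaussdef. now auto_derive.
  - unfold gaussdef. assert (exp (- (s * t ^ 2 / 2)) <= 1); [|lra].
    rewrite <- exp_0. assert (0 <= s * t ^ 2) by (apply Rmult_le_pos; nra).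
    destruct (Req_dec (- (s * t ^ 2 / 2)) 0) as [->|]; [lra|]. left; apply exp_increasing; lra.
Qed.

Lemma Rabs_cos_period (k : nat) (x : R) : Rabs (cos (INR k * PI + x)) = Rabs (cos x).
Proof.
  induction k as [|k IH]; [now rewrite Rmult_0_l, Rplus_0_l|].
  rewrite S_INR. replace ((INR k + 1) * PI + x) with (INR k * PI + x + PI) by ring.
  now rewrite neg_cos, Rabs_Ropp.
Qed.

Definition ucos (s x : R) : R := 1 - Rpower (cos x) s.
(** The derivative of [ucos s] without its factor [s]. *)
Definition vcos (s x : R) : R := Rpower (cos x) (s - 1) * sin x.

Lemma ucos_bounds (s x : R) : 0 <= s -> 0 <= x < PI / 2 -> 0 <= ucos s x <= 1.
Proof.
  intros Hs Hx. unfold ucos. pose proof (cos_gt0 x Hx). pose proof (COS_bound x).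
  pose proof (Rpower_gt0 (cos x) s). rewrite <- rpow_pos in * by easy.
  pose proof (rpow_le1 (cos x) s Hs ltac:(lra)). lra.
Qed.

Lemma cosdef_ucos (s x : R) : 0 <= x < PI / 2 -> cosdef s x = ucos s x.
Proof.
  intros Hx. pose proof (cos_gt0 x Hx). unfold cosdef, ucos.
  rewrite Rabs_pos_eq, rpow_pos by lra. easy.
Qed.

Lemma is_derive_Rpower_cos (s x : R) : 0 <= x < PI / 2 ->
  is_derive (fun x => Rpower (cos x) s) x (- (s * vcos s x)).
Proof.
  intros Hx. pose proof (cos_gt0 x Hx) as Hc. unfold vcos.
  replace (- (s * (Rpower (cos x) (s - 1) * sin x)))
    with (scal (- sin x) (s * Rpower (cos x) (s - 1)))
    by (unfold scal; simpl; unfold mult; simpl; ring).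
  apply (is_derive_comp (fun y => Rpower y s) cos).
  - now apply is_derive_Rpower.
  - auto_derive; [easy|ring].
Qed.

Lemma continuous_Rpower_cos (s x : R) : 0 <= x < PI / 2 ->
  continuous (fun x => Rpower (cos x) s) x.
Proof.
  intros Hx. apply (ex_derive_continuous (fun x => Rpower (cos x) s)).
  eexists; now apply is_derive_Rpower_cos.
Qed.

Lemma continuous_ucos (s x : R) : 0 <= x < PI / 2 -> continuous (ucos s) x.
Proof.
  intros Hx. apply (continuous_minus (fun _ => 1) (fun x => Rpower (cos x) s));
    [apply continuous_const|now apply continuous_Rpower_cos].
Qed.

Lemma continuous_vcos (s x : R) : 0 <= x < PI / 2 -> continuous (vcos s) x.
Proof.
  intros Hx. apply (continuous_mult (fun x => Rpower (cos x) (s - 1)) sin);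
    [now apply continuous_Rpower_cos|apply continuous_sin].
Qed.

(** The density of t^(-p-1) dt in the variable x, where exp (- t^2 / 2) = cos x. *)
Definition gker (p x : R) : R := Rpower (hcos x) (- (p / 2) - 1) * (sin x / cos x).

Lemma continuous_hcos (x : R) : 0 <= x < PI / 2 -> continuous hcos x.
Proof.
  intros Hx. apply (ex_derive_continuous hcos). eexists; now apply is_derive_hcos.
Qed.

Lemma continuous_tan (x : R) : 0 <= x < PI / 2 -> continuous (fun x => sin x / cos x) x.
Proof.
  intros Hx. pose proof (cos_gt0 x Hx). apply (ex_derive_continuous (fun x => sin x / cos x)).
  auto_derive. lra.
Qed.

Lemma continuous_gker (p x : R) : 0 < x < PI / 2 -> continuous (gker p) x.
Proof.
  intros Hx. apply (continuous_mult (fun x => Rpower (hcos x) (- (p / 2) - 1)) (fun x => sin x / cos x)).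
  - apply (continuous_comp hcos (fun y => Rpower y (- (p / 2) - 1))).
    + apply continuous_hcos; lra.
    + apply continuous_Rpower. now apply hcos_gt0.
  - apply continuous_tan; lra.
Qed.

(* Substitution [t = psi x] with [exp (- psi x ^ 2 / 2) = cos x]. *)
Definition psi (x : R) : R := Rpower (hcos x) (/ 2).

Lemma psi_sqr (x : R) : 0 < x < PI / 2 -> psi x ^ 2 = hcos x.
Proof.
  intros Hx. unfold psi. rewrite <- Rpower_2 by apply Rpower_gt0. rewrite Rpower_mult.
  replace (/ 2 * 2) with 1 by field. apply Rpower_1. now apply hcos_gt0.
Qed.

Lemma is_RInt_gauss_window (p s a b : R) : 0 <= s -> 0 < a <= b -> b < PI / 2 ->
  is_RInt (fun x => ucos s x * gker p x) a b (window p (gaussdef s) (psi a) (psi b)).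
Proof.
  intros Hs Ha Hb. unfold window.
  eapply is_RInt_ext; [|apply (is_RInt_comp (fun t => gaussdef s t * ker p t) psi
     (fun x => Rpower (hcos x) (- / 2) * (sin x / cos x)))].
  - intros x Hx. rewrite Rmin_left, Rmax_right in Hx by lra.
    pose proof (cos_gt0 x ltac:(lra)) as Hc. pose proof (hcos_gt0 x ltac:(lra)) as Hh.
    unfold scal; simpl; unfold mult; simpl. unfold gaussdef, ucos, gker, ker.
    rewrite psi_sqr by lra. unfold psi. rewrite Rpower_mult.
    replace (- (s * hcos x / 2)) with (s * ln (cos x)) by (unfold hcos; field).
    fold (Rpower (cos x) s).
    replace (- (p / 2) - 1) with (- / 2 + / 2 * (- p - 1)) by field. rewrite Rpower_plus. ring.
  - intros x Hx. rewrite Rmin_left, Rmax_right in Hx by lra.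
    apply (continuous_mult (gaussdef s) (ker p)).
    + apply adm_gaussdef; [easy|]. apply Rpower_gt0.
    + apply continuous_ker, Rpower_gt0.
  - intros x Hx. rewrite Rmin_left, Rmax_right in Hx by lra.
    pose proof (hcos_gt0 x ltac:(lra)) as Hh. split.
    + unfold psi.
      replace (Rpower (hcos x) (- / 2) * (sin x / cos x))
        with (scal (2 * (sin x / cos x)) (/ 2 * Rpower (hcos x) (/ 2 - 1))).
      * apply (is_derive_comp (fun y => Rpower y (/ 2)) hcos).
        -- now apply is_derive_Rpower.
        -- apply is_derive_hcos; lra.
      * unfold scal; simpl; unfold mult; simpl. replace (/ 2 - 1) with (- / 2) by field.
        field. apply Rgt_not_eq, cos_gt0; lra.
    + apply (continuous_mult (fun x => Rpower (hcos x) (- / 2)) (fun x => sin x / cos x)).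
      * apply (continuous_comp hcos (fun y => Rpower y (- / 2))).
        -- apply continuous_hcos; lra.
        -- now apply continuous_Rpower.
      * apply continuous_tan; lra.
Qed.

(** The density t^(-p-1) summed over x and k pi + x, k pi - x for 1 <= k <= n, the points where
    |cos| takes the value cos x. *)
Definition wn (p : R) (n : nat) (x : R) : R :=
  ker p x + sumN n (fun k => ker p (INR k * PI + x) + ker p (INR k * PI - x)).

Lemma continuous_sumN (n : nat) (f : nat -> R -> R) (x : R) :
  (forall k, (1 <= k <= n)%nat -> continuous (f k) x) -> continuous (fun x => sumN n (fun k => f k x)) x.
Proof.
  induction n as [|n IH]; intros H; simpl; [apply continuous_const|].
  apply (continuous_plus (fun x => sumN n (fun k => f k x)) (f (S n))); [apply IH; intros; apply H|apply H]; lia.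
Qed.

Lemma continuous_ker_shift (p c x : R) : 0 < c + x -> continuous (fun x => ker p (c + x)) x.
Proof.
  intros H. apply (continuous_comp (fun x => c + x) (ker p)).
  - apply (ex_derive_continuous (fun x => c + x)). now auto_derive.
  - now apply continuous_ker.
Qed.

Lemma continuous_ker_reflect (p c x : R) : 0 < c - x -> continuous (fun x => ker p (c - x)) x.
Proof.
  intros H. apply (continuous_comp (fun x => c - x) (ker p)).
  - apply (ex_derive_continuous (fun x => c - x)). now auto_derive.
  - now apply continuous_ker.
Qed.

Lemma continuous_wn (p : R) (n : nat) (x : R) : 0 < x < PI / 2 -> continuous (wn p n) x.
Proof.
  intros Hx. apply (continuous_plus (ker p)
    (fun x => sumN n (fun k => ker p (INR k * PI + x) + ker p (INR k * PI - x)))).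
  - apply continuous_ker; lra.
  - apply (continuous_sumN n (fun k x => ker p (INR k * PI + x) + ker p (INR k * PI - x))).
    intros k Hk. pose proof (INR_PI_ge k ltac:(lia)).
    apply (continuous_plus (fun x => ker p (INR k * PI + x)) (fun x => ker p (INR k * PI - x))).
    + apply continuous_ker_shift; lra.
    + apply continuous_ker_reflect; lra.
Qed.

Lemma is_derive_sumN (n : nat) (f : nat -> R -> R) (df : nat -> R) (x : R) :
  (forall k, (1 <= k <= n)%nat -> is_derive (f k) x (df k)) ->
  is_derive (fun x => sumN n (fun k => f k x)) x (sumN n df).
Proof.
  induction n as [|n IH]; intros H; simpl; [apply @is_derive_const|].
  apply (is_derive_plus (fun x => sumN n (fun k => f k x)) (f (S n)));
    [apply IH; intros; apply H|apply H]; lia.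
Qed.

(** Truncation to n arches of p times the difference of the distribution functions, an
    antiderivative of - p (wn - gker). *)
Definition dn (p : R) (n : nat) (x : R) : R := theta p x - Tsum p n x.

Lemma is_derive_dn (p : R) (n : nat) (x : R) : 0 < x < PI / 2 ->
  is_derive (dn p n) x (- p * (wn p n x - gker p x)).
Proof.
  intros Hx.
  replace (- p * (wn p n x - gker p x)) with
    (minus (- p * Rpower x (- p - 1) + p * Rpower (hcos x) (- (p / 2) - 1) * (sin x / cos x))
     (sumN n (fun k => p * Rpower (INR k * PI - x) (- p - 1) + p * Rpower (INR k * PI + x) (- p - 1)))).
  - apply (is_derive_minus (theta p) (Tsum p n)); [now apply is_derive_theta|].
    apply (is_derive_sumN n (fun k => sigma p (INR k * PI))).
    intros k Hk. pose proof (INR_PI_ge k ltac:(lia)). apply is_derive_sigma; lra.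
  - rewrite (sumN_ext n _ (fun k => (ker p (INR k * PI + x) + ker p (INR k * PI - x)) * p))
      by (intros; unfold ker; ring).
    rewrite sumN_scal. unfold wn, gker, ker, minus, plus, opp; simpl. ring.
Qed.

Lemma continuous_dn (p : R) (n : nat) (x : R) : 0 < x < PI / 2 -> continuous (dn p n) x.
Proof.
  intros Hx. apply (ex_derive_continuous (dn p n)). eexists; now apply is_derive_dn.
Qed.

Lemma ex_RInt_ab (f : R -> R) (a b : R) : 0 < a <= b -> b < PI / 2 ->
  (forall x, 0 < x < PI / 2 -> continuous f x) -> ex_RInt f a b.
Proof.
  intros Ha Hb H. apply (ex_RInt_continuous f). intros x Hx.
  rewrite Rmin_left, Rmax_right in Hx by lra. apply H; lra.
Qed.

(** Passes from the difference of densities to the difference of distribution functions, whose sign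
    the single crossing controls. *)
Lemma by_parts (p s a b : R) (n : nat) : 0 < p -> 0 < a <= b -> b < PI / 2 ->
  RInt (fun x => ucos s x * wn p n x) a b - RInt (fun x => ucos s x * gker p x) a b
  = (ucos s a * dn p n a - ucos s b * dn p n b) / p
    + s / p * RInt (fun x => vcos s x * dn p n x) a b.
Proof.
  intros Hp Ha Hb.
  assert (E1 : ex_RInt (fun x => ucos s x * wn p n x) a b).
  { apply ex_RInt_ab; try easy. intros x Hx.
    apply (continuous_mult (ucos s) (wn p n)); [apply continuous_ucos; lra|now apply continuous_wn]. }
  assert (E2 : ex_RInt (fun x => ucos s x * gker p x) a b).
  { apply ex_RInt_ab; try easy. intros x Hx.
    apply (continuous_mult (ucos s) (gker p)); [apply continuous_ucos; lra|now apply continuous_gker]. }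
  assert (E3 : ex_RInt (fun x => vcos s x * dn p n x) a b).
  { apply ex_RInt_ab; try easy. intros x Hx.
    apply (continuous_mult (vcos s) (dn p n)); [apply continuous_vcos; lra|now apply continuous_dn]. }
  assert (Hd : is_RInt (fun x => (ucos s x * wn p n x - ucos s x * gker p x) - s / p * (vcos s x * dn p n x))
     a b (- (ucos s b * dn p n b) / p - - (ucos s a * dn p n a) / p)).
  { apply (is_RInt_derive (fun x => - (ucos s x * dn p n x) / p)).
    - intros x Hx. rewrite Rmin_left, Rmax_right in Hx by lra.
      assert (Hu : is_derive (ucos s) x (s * vcos s x)).
      { replace (s * vcos s x) with (minus 0 (- (s * vcos s x))) by (unfold minus, plus, opp; simpl; ring).
        apply (is_derive_minus (fun _ => 1) (fun x => Rpower (cos x) s)); [apply @is_derive_const|].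
        apply is_derive_Rpower_cos; lra. }
      pose proof (is_derive_dn p n x ltac:(lra)) as Hdn.
      apply is_derive_ext with (fun x => scal (- / p) (ucos s x * dn p n x)).
      { intros t. unfold scal; simpl; unfold mult; simpl. field; lra. }
      evar_last.
      + apply (is_derive_scal (fun x => ucos s x * dn p n x) x (- / p)).
        apply (is_derive_mult (ucos s) (dn p n) x _ _ Hu Hdn). intros; apply Rmult_comm.
      + unfold scal, plus, mult; simpl; unfold mult; simpl. field; lra.
    - intros x Hx. rewrite Rmin_left, Rmax_right in Hx by lra.
      apply (continuous_minus (fun x => ucos s x * wn p n x - ucos s x * gker p x)
        (fun x => s / p * (vcos s x * dn p n x))).
      + apply (continuous_minus (fun x => ucos s x * wn p n x) (fun x => ucos s x * gker p x)).
        * apply (continuous_mult (ucos s) (wn p n)); [apply continuous_ucos; lra|apply continuous_wn; lra].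
        * apply (continuous_mult (ucos s) (gker p)); [apply continuous_ucos; lra|apply continuous_gker; lra].
      + apply (continuous_scal_r (s / p) (fun x => vcos s x * dn p n x)).
        apply (continuous_mult (vcos s) (dn p n)); [apply continuous_vcos; lra|apply continuous_dn; lra]. }
  apply (is_RInt_unique (V := R_CompleteNormedModule)) in Hd.
  assert (R : RInt (fun x => (ucos s x * wn p n x - ucos s x * gker p x) - s / p * (vcos s x * dn p n x)) a b
    = RInt (fun x => ucos s x * wn p n x) a b - RInt (fun x => ucos s x * gker p x) a b
      - s / p * RInt (fun x => vcos s x * dn p n x) a b).
  { apply is_RInt_unique.
    apply (is_RInt_minus (fun x => ucos s x * wn p n x - ucos s x * gker p x)
       (fun x => s / p * (vcos s x * dn p n x))).
    - apply (is_RInt_minus (fun x => ucos s x * wn p n x) (fun x => ucos s x * gker p x));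
        now apply (RInt_correct (V := R_CompleteNormedModule)).
    - apply (is_RInt_scal (fun x => vcos s x * dn p n x) a b (s / p)).
      now apply (RInt_correct (V := R_CompleteNormedModule)). }
  rewrite R in Hd. unfold Rdiv in *. lra.
Qed.

(** The part of (0, n pi + pi/2) that folds onto [a, b]; choosing [a, b] inside (0, pi/2) avoids the
    singularities of [ker] at 0 and of [hcos] at pi/2. *)
Definition folded_window (p s a b : R) (n : nat) : R :=
  window p (cosdef s) a b + sumN n (fun k =>
    window p (cosdef s) (INR k * PI - b) (INR k * PI - a)
    + window p (cosdef s) (INR k * PI + a) (INR k * PI + b)).

Lemma is_RInt_sumN (n : nat) (f : nat -> R -> R) (I : nat -> R) (a b : R) :
  (forall k, (1 <= k <= n)%nat -> is_RInt (f k) a b (I k)) ->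
  is_RInt (fun x => sumN n (fun k => f k x)) a b (sumN n I).
Proof.
  induction n as [|n IH]; intros H; simpl.
  - evar_last; [apply @is_RInt_const|]. unfold scal; simpl; unfold mult; simpl. ring.
  - apply (is_RInt_plus (fun x => sumN n (fun k => f k x)) (f (S n)));
      [apply IH; intros; apply H|apply H]; lia.
Qed.

Lemma is_RInt_window (p : R) (g : R -> R) (a b : R) : adm g -> 0 < a <= b ->
  is_RInt (fun t => g t * ker p t) a b (window p g a b).
Proof.
  intros Hg Hab. apply (RInt_correct (V := R_CompleteNormedModule)). now apply ex_window.
Qed.

Lemma RInt_wn (p s a b : R) (n : nat) : 0 < s -> 0 < a <= b -> b < PI / 2 ->
  RInt (fun x => ucos s x * wn p n x) a b = folded_window p s a b n.
Proof.
  intros Hs Ha Hb. pose proof (adm_cosdef s Hs) as Hadm. apply is_RInt_unique.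
  apply is_RInt_ext with (fun x => cosdef s x * ker p x + sumN n (fun k =>
     ucos s x * ker p (INR k * PI - x) + ucos s x * ker p (INR k * PI + x))).
  - intros x Hx. rewrite Rmin_left, Rmax_right in Hx by lra. unfold wn.
    rewrite (sumN_ext n _ (fun k => (ker p (INR k * PI + x) + ker p (INR k * PI - x)) * ucos s x))
      by (intros; ring).
    rewrite sumN_scal, cosdef_ucos by lra. unfold plus; simpl; ring.
  - apply (is_RInt_plus (fun x => cosdef s x * ker p x)); [now apply is_RInt_window|].
    apply (is_RInt_sumN n (fun k x => ucos s x * ker p (INR k * PI - x) + ucos s x * ker p (INR k * PI + x))).
    intros k Hk. pose proof (INR_PI_ge k ltac:(lia)) as Hp.
    apply (is_RInt_plus (fun x => ucos s x * ker p (INR k * PI - x)) (fun x => ucos s x * ker p (INR k * PI + x))).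
    + pose proof (is_RInt_window p (cosdef s) (INR k * PI - b) (INR k * PI - a) Hadm ltac:(lra)) as H.
      apply is_RInt_swap in H.
      replace (INR k * PI - a) with (-1 * a + INR k * PI) in H by ring.
      replace (INR k * PI - b) with (-1 * b + INR k * PI) in H by ring.
      apply is_RInt_comp_lin in H. apply (is_RInt_scal _ _ _ (-1)) in H.
      replace (INR k * PI - a) with (-1 * a + INR k * PI) by ring.
      replace (INR k * PI - b) with (-1 * b + INR k * PI) by ring.
      evar_last; [eapply is_RInt_ext; [|apply H]|].
      * intros x Hx. rewrite Rmin_left, Rmax_right in Hx by lra.
        unfold scal; simpl; unfold mult; simpl.
        replace (-1 * x + INR k * PI) with (INR k * PI + - x) by ring.
        replace (INR k * PI - x) with (INR k * PI + - x) by ring.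
        unfold cosdef. rewrite Rabs_cos_period, cos_neg. fold (cosdef s x).
        rewrite cosdef_ucos by lra. ring.
      * unfold scal, opp; simpl; unfold mult; simpl. ring.
    + pose proof (is_RInt_window p (cosdef s) (INR k * PI + a) (INR k * PI + b) Hadm ltac:(lra)) as H.
      replace (INR k * PI + a) with (1 * a + INR k * PI) in H by ring.
      replace (INR k * PI + b) with (1 * b + INR k * PI) in H by ring.
      apply is_RInt_comp_lin in H.
      replace (INR k * PI + a) with (1 * a + INR k * PI) by ring.
      replace (INR k * PI + b) with (1 * b + INR k * PI) by ring.
      eapply is_RInt_ext; [|apply H].
      intros x Hx. rewrite Rmin_left, Rmax_right in Hx by lra.
      unfold scal; simpl; unfold mult; simpl.
      replace (1 * x + INR k * PI) with (INR k * PI + x) by ring.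
      unfold cosdef. rewrite Rabs_cos_period. fold (cosdef s x).
      rewrite cosdef_ucos by lra. ring.
Qed.

Lemma window_small (p : R) (g : R -> R) (c d : R) : 0 <= p -> adm g -> (forall t, 0 < t -> g t <= 1) ->
  1 <= c <= d -> window p g c d <= d - c.
Proof.
  intros Hp Hg H1 Hcd.
  apply Rle_trans with (RInt (fun _ => 1) c d).
  - apply RInt_le; [lra|apply ex_window; [easy|lra]|apply ex_RInt_const|].
    intros t Ht. rewrite <- (Rmult_1_l 1). apply Rmult_le_compat.
    + apply Hg; lra.
    + left; apply ker_gt0.
    + apply H1; lra.
    + unfold ker. replace (- p - 1) with (- (p + 1)) by ring.
      rewrite <- (Rpower_1_l (- (p + 1))) at 2. apply Rpower_neg_decr; lra.
  - rewrite RInt_const. unfold scal; simpl; unfold mult; simpl. lra.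
Qed.

(** The first arch loses a length of at most e and each later one at most 4 e. The lost pieces lie
    beyond 1, where the integrand is at most 1. *)
Lemma folded_window_bounds (p s a b e : R) (n : nat) : 0 <= p -> 0 < s -> 0 < a <= e -> e <= / 4 ->
  PI / 2 - e <= b < PI / 2 ->
  folded_window p s a b n <= window p (cosdef s) a (INR n * PI + PI / 2)
    <= folded_window p s a b n + (4 * INR n + 1) * e.
Proof.
  intros Hp Hs Ha He Hb. pose proof PI_bounds as HP.
  pose proof (adm_cosdef s Hs) as Hadm. set (g := cosdef s) in *.
  assert (Hg1 : forall t, 0 < t -> g t <= 1) by (intros; apply cosdef_bounds; lra).
  unfold folded_window. fold g. induction n as [|n IH].
  - simpl. rewrite Rmult_0_l, Rplus_0_l, Rplus_0_r.
    rewrite (window_chasles p g a b (PI / 2)) by (try easy; lra).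
    pose proof (window_ge0 p g b (PI / 2) Hadm ltac:(lra)).
    pose proof (window_small p g b (PI / 2) Hp Hadm Hg1 ltac:(lra)). lra.
  - set (k := INR (S n) * PI) in *. change (sumN (S n) ?f) with (sumN n f + f (S n)).
    cbv beta. fold k. pose proof (INR_PI_ge (S n) ltac:(lia)) as Hk. fold k in Hk.
    pose proof (pos_INR n) as Hn0.
    rewrite (window_chasles p g a (INR n * PI + PI / 2) (k + PI / 2)) by (try easy; unfold k; rewrite ?S_INR; nra).
    replace (INR n * PI + PI / 2) with (k - PI / 2) in * by (unfold k; rewrite S_INR; field).
    rewrite (window_chasles p g (k - PI / 2) (k - b) (k + PI / 2)) by (try easy; lra).
    rewrite (window_chasles p g (k - b) (k - a) (k + PI / 2)) by (try easy; lra).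
    rewrite (window_chasles p g (k - a) (k + a) (k + PI / 2)) by (try easy; lra).
    rewrite (window_chasles p g (k + a) (k + b) (k + PI / 2)) by (try easy; lra).
    pose proof (window_ge0 p g (k - PI / 2) (k - b) Hadm ltac:(lra)).
    pose proof (window_ge0 p g (k - a) (k + a) Hadm ltac:(lra)).
    pose proof (window_ge0 p g (k + b) (k + PI / 2) Hadm ltac:(lra)).
    pose proof (window_small p g (k - PI / 2) (k - b) Hp Hadm Hg1 ltac:(lra)).
    pose proof (window_small p g (k - a) (k + a) Hp Hadm Hg1 ltac:(lra)).
    pose proof (window_small p g (k + b) (k + PI / 2) Hp Hadm Hg1 ltac:(lra)).
    rewrite S_INR. lra.
Qed.

Lemma Rpower_pow_bounds (y u q : R) : 0 <= q -> 0 < u <= 1 -> 0 < Rpower u q <= 1.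
Proof.
  intros Hq Hu. split; [apply Rpower_gt0|]. rewrite <- rpow_pos by lra. apply rpow_le1; lra.
Qed.

(** The factors cos^(s-2) - y0^(s-2) and theta - Tinf have the same sign, so their product is
    nonnegative. The subtracted power bounds the tail lost by working with [Tsum] instead of
    [Tinf]. *)
Lemma vcos_crossing (p s y0 x : R) (n : nat) : 7 / 4 <= p -> 2 < s -> 0 <= y0 <= 1 -> 0 < x < PI / 2 ->
  (y0 < cos x -> Tinf p x <= theta p x) -> (cos x < y0 -> theta p x <= Tinf p x) ->
  rpow y0 (s - 2) * (vcos 2 x * dn p n x) - Rpower (INR (S n) * PI - PI / 2) (- p)
    <= vcos s x * dn p n x.
Proof.
  intros Hp Hs Hy Hx H1 H2. pose proof (cos_gt0 x ltac:(lra)) as Hc.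
  pose proof (sin_gt_0 x ltac:(lra) ltac:(lra)) as Hsn.
  pose proof (COS_bound x). pose proof (SIN_bound x).
  pose proof (Tinf_remainder p n x ltac:(lra) ltac:(lra)) as HT.
  set (y := rpow y0 (s - 2)). set (c := Rpower (cos x) (s - 2)).
  assert (Hvs : vcos s x = c * vcos 2 x).
  { unfold vcos, c. rewrite <- Rmult_assoc, <- Rpower_plus. do 2 f_equal. ring. }
  assert (Hv : 0 <= vcos 2 x <= 1).
  { unfold vcos. replace (2 - 1) with 1 by ring. rewrite Rpower_1 by easy. nra. }
  assert (Hc1 : 0 <= c <= 1).
  { destruct (Rpower_pow_bounds 0 (cos x) (s - 2)) as [K1 K2]; unfold c; lra. }
  assert (Hy1 : 0 <= y <= 1) by (split; [apply rpow_ge0|apply rpow_le1; lra]).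
  assert (Hcy : 0 <= (c - y) * (theta p x - Tinf p x)).
  { unfold c, y. rewrite <- (rpow_pos (cos x)) by easy.
    destruct (Rtotal_order y0 (cos x)) as [Hl|[->|Hl]].
    - pose proof (rpow_le y0 (cos x) (s - 2) ltac:(lra) ltac:(lra)). specialize (H1 Hl).
      apply Rmult_le_pos; lra.
    - lra.
    - pose proof (rpow_le (cos x) y0 (s - 2) ltac:(lra) ltac:(lra)). specialize (H2 Hl).
      replace ((rpow (cos x) (s - 2) - rpow y0 (s - 2)) * (theta p x - Tinf p x))
        with ((rpow y0 (s - 2) - rpow (cos x) (s - 2)) * (Tinf p x - theta p x)) by ring.
      apply Rmult_le_pos; lra. }
  assert (Hr : Rpower (INR (S n) * PI - x) (- p) <= Rpower (INR (S n) * PI - PI / 2) (- p)).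
  { pose proof (INR_PI_ge (S n) ltac:(lia)). apply Rpower_neg_decr; lra. }
  set (eta := Rpower (INR (S n) * PI - PI / 2) (- p)) in *.
  rewrite Hvs. unfold dn. set (D := Tinf p x - Tsum p n x).
  assert (HD : 0 <= D <= eta) by (unfold D; lra).
  assert (K : - eta <= (c - y) * (theta p x - Tsum p n x)).
  { replace ((c - y) * (theta p x - Tsum p n x)) with ((c - y) * (theta p x - Tinf p x) + (c - y) * D)
      by (unfold D; ring).
    assert (- eta <= (c - y) * D) by nra. lra. }
  assert (Hm : - eta <= vcos 2 x * ((c - y) * (theta p x - Tsum p n x))); [|lra].
  destruct (Rle_or_lt 0 ((c - y) * (theta p x - Tsum p n x))).
  - apply Rle_trans with 0; [lra|]. now apply Rmult_le_pos.
  - nra.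
Qed.

(* Decreases fast enough for the [4 n + 1] pieces lost in [folded_window_bounds]. *)
Definition gap (m : nat) : R := / INR (S (S m)) ^ 2.

Lemma gap_bounds (m : nat) : 0 < gap m <= / 4.
Proof.
  assert (H : 2 <= INR (S (S m))) by (apply (le_INR 2); lia).
  unfold gap. split; [apply Rinv_0_lt_compat, pow_lt; lra|]. apply Rinv_le_contravar; nra.
Qed.

Lemma lim_inv_INR2 : is_lim_seq (fun m => / INR (S (S m))) 0.
Proof. apply (is_lim_seq_incr_1 (fun m => / INR (S m))), lim_left_ends. Qed.

Lemma lim_gap : is_lim_seq gap 0.
Proof.
  apply is_lim_seq_ext with (fun m => / INR (S (S m)) * / INR (S (S m))).
  - intros m. unfold gap. field. apply not_0_INR. lia.
  - replace (Finite 0) with (Finite (0 * 0)) by (f_equal; ring).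
    apply is_lim_seq_mult'; apply lim_inv_INR2.
Qed.

Lemma lim_gap_mult : is_lim_seq (fun m => (4 * INR (S m) + 1) * gap m) 0.
Proof.
  apply is_lim_seq_le_le with (fun _ => 0) (fun m => 5 * / INR (S (S m))).
  - intros m. pose proof (gap_bounds m). pose proof (pos_INR (S m)). split; [nra|].
    unfold gap. set (q := INR (S (S m))).
    assert (Hq : 4 * INR (S m) + 1 <= 5 * q) by (unfold q; rewrite (S_INR (S m)); lra).
    assert (0 < q) by (unfold q; apply lt_0_INR; lia).
    apply Rle_trans with (5 * q * / q ^ 2).
    + apply Rmult_le_compat_r; [left; apply Rinv_0_lt_compat, pow_lt; lra|easy].
    + right; field; lra.
  - apply is_lim_seq_const.
  - replace (Finite 0) with (Finite (5 * 0)) by (f_equal; ring).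
    apply (is_lim_seq_scal_l _ 5 0), lim_inv_INR2.
Qed.

Lemma lim_Rpower_zero (u : nat -> R) (q : R) : 0 < q -> (forall n, 0 < u n) -> is_lim_seq u 0 ->
  is_lim_seq (fun n => Rpower (u n) q) 0.
Proof.
  intros Hq Hu H. apply is_lim_seq_ext with (fun n => rpow (Rabs (u n)) q).
  - intros n. rewrite Rabs_pos_eq by (left; apply Hu). now apply rpow_pos.
  - replace 0 with (rpow (Rabs 0) q) by (now rewrite Rabs_R0, rpow_0).
    apply (is_lim_seq_continuous (fun y => rpow (Rabs y) q)); [|easy].
    apply continuity_pt_filterlim. now apply continuous_rpow_abs.
Qed.

Lemma lim_Rpower_pos (u : nat -> R) (q l : R) : 0 < l -> is_lim_seq u l ->
  is_lim_seq (fun n => Rpower (u n) q) (Rpower l q).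
Proof.
  intros Hl H. apply (is_lim_seq_continuous (fun y => Rpower y q)); [|easy].
  apply continuity_pt_filterlim. now apply continuous_Rpower.
Qed.

Lemma lim_Rpower_infty (u : nat -> R) (q : R) : 0 < q -> (forall n, 0 < u n) -> is_lim_seq u p_infty ->
  is_lim_seq (fun n => Rpower (u n) q) p_infty.
Proof.
  intros Hq Hu H. apply is_lim_seq_spec. intros M. apply is_lim_seq_spec in H.
  destruct (H (Rpower (Rmax M 1) (/ q))) as [N HN]. exists N. intros n Hn.
  pose proof (Rmax_l M 1). pose proof (Rmax_r M 1).
  apply Rle_lt_trans with (Rmax M 1); [easy|].
  rewrite <- (Rpower_1 (Rmax M 1)) by lra. replace 1 with (/ q * q) at 2 by (field; lra).
  rewrite <- Rpower_mult. apply Rlt_Rpower_l; [easy|]. split; [apply Rpower_gt0|now apply HN].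
Qed.

Definition left_end (m : nat) : R := gap m.
Definition right_end (m : nat) : R := PI / 2 - gap m.

Lemma lim_right_end : is_lim_seq right_end (PI / 2).
Proof.
  unfold right_end. replace (Finite (PI / 2)) with (Finite (PI / 2 - 0)) by (f_equal; ring).
  apply is_lim_seq_minus'; [apply is_lim_seq_const|apply lim_gap].
Qed.

Lemma end_bounds (m : nat) : 0 < left_end m <= right_end m /\ right_end m < PI / 2.
Proof.
  pose proof (gap_bounds m). pose proof PI_bounds. unfold left_end, right_end. lra.
Qed.

Lemma lim_hcos_right : is_lim_seq (fun m => hcos (right_end m)) p_infty.
Proof.
  assert (H : is_lim_seq (fun m => 4 * ln (INR (S (S m)))) p_infty).
  { replace p_infty with (Rbar_mult 4 p_infty).
    2:{ simpl. destruct (Rle_dec 0 4) as [r|]; [|lra]. destruct (Rle_lt_or_eq_dec 0 4 r); [easy|lra]. }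
    apply is_lim_seq_scal_l.
    apply (filterlim_comp _ _ _ (fun m => INR (S (S m))) ln Hierarchy.eventually (Rbar_locally p_infty)).
    - apply (is_lim_seq_incr_1 (fun m => INR (S m))), lim_right_ends.
    - apply is_lim_ln_p. }
  refine (is_lim_seq_le_p_loc _ _ _ H). exists 0%nat. intros m _.
  unfold hcos, right_end. rewrite cos_shift. pose proof (gap_bounds m). pose proof PI_bounds.
  pose proof (sin_gt_0 (gap m) ltac:(lra) ltac:(lra)).
  assert (ln (sin (gap m)) <= ln (gap m)).
  { left. apply ln_increasing; [easy|]. apply sin_lt_x; lra. }
  assert (ln (gap m) = - 2 * ln (INR (S (S m)))); [|lra].
  unfold gap. assert (0 < INR (S (S m))) by (apply lt_0_INR; lia).
  rewrite ln_Rinv by (apply pow_lt; easy). rewrite <- Rpower_2 by easy. unfold Rpower. rewrite ln_exp. ring.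
Qed.

Lemma lim_hcos_left : is_lim_seq (fun m => hcos (left_end m)) 0.
Proof.
  rewrite <- hcos_0. apply is_lim_seq_continuous; [|apply lim_gap].
  apply continuity_pt_filterlim, continuous_hcos. pose proof PI_RGT_0. lra.
Qed.

Lemma lim_psi_window (p s v : R) : 0 <= s -> is_phi p (gaussdef s) v ->
  is_lim_seq (fun m => window p (gaussdef s) (psi (left_end m)) (psi (right_end m))) v.
Proof.
  intros Hs Hv. apply phi_lim; [now apply adm_gaussdef|easy| | |].
  - intros m. split; [apply Rpower_gt0|]. destruct (end_bounds m) as [H1 H2].
    apply Rle_Rpower_l; [lra|]. split; [apply hcos_gt0; lra|].
    apply (derive_nonneg_le hcos (fun x => 2 * (sin x / cos x))); [lra| |].
    + intros x Hx. apply is_derive_hcos; lra.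
    + intros x Hx. pose proof (tan_ge x ltac:(lra)). lra.
  - apply (lim_Rpower_zero (fun m => hcos (left_end m))); [lra| |apply lim_hcos_left].
    intros m. apply hcos_gt0. pose proof (end_bounds m). lra.
  - apply (lim_Rpower_infty (fun m => hcos (right_end m))); [lra| |apply lim_hcos_right].
    intros m. apply hcos_gt0. pose proof (end_bounds m). lra.
Qed.

(** * Comparison of the Gaussian with powers of the cosine *)

Lemma one_minus_cos_le (x : R) : 1 - cos x <= x ^ 2 / 2.
Proof.
  replace x with (2 * (x / 2)) at 1 by field. rewrite cos_2a_sin.
  assert (sin (x / 2) * sin (x / 2) <= (x / 2) ^ 2); [|lra].
  replace ((x / 2) ^ 2) with (Rsqr (x / 2)) by (unfold Rsqr; ring). change (Rsqr (sin (x / 2)) <= Rsqr (x / 2)).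
  apply Rsqr_le_abs_1.
  assert (H : forall y, 0 <= y -> Rabs (sin y) <= y).
  { intros y Hy. apply Rabs_le. split.
    - destruct (Rle_or_lt 1 y); [pose proof (SIN_bound y); lra|].
      pose proof PI_bounds. pose proof (sin_ge_0 y Hy ltac:(lra)). lra.
    - destruct Hy as [Hy| <-]; [left; now apply sin_lt_x|rewrite sin_0; lra]. }
  destruct (Rle_or_lt 0 (x / 2)) as [Hx|Hx].
  - rewrite (Rabs_pos_eq (x / 2)) by easy. now apply H.
  - rewrite <- (Ropp_involutive (x / 2)) at 1. rewrite sin_neg, Rabs_Ropp.
    rewrite (Rabs_left (x / 2)) by easy. apply H; lra.
Qed.

Lemma cosdef_le_sqr (s t : R) : 1 <= s -> cosdef s t <= s / 2 * t ^ 2.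
Proof.
  intros Hs. unfold cosdef.
  pose proof (bernoulli_convex (Rabs (cos t)) s Hs (Rabs_pos _)) as H.
  pose proof (one_minus_cos_le t). pose proof (Rle_abs (cos t)). nra.
Qed.

Lemma gaussdef_le_sqr (s t : R) : gaussdef s t <= s / 2 * t ^ 2.
Proof. unfold gaussdef. pose proof (exp_ge_1x (- (s * t ^ 2 / 2))). lra. Qed.

Lemma gaussdef_le1 (s t : R) : gaussdef s t <= 1.
Proof. unfold gaussdef. pose proof (exp_pos (- (s * t ^ 2 / 2))). lra. Qed.

Lemma theta_bounds (p x : R) : 0 <= p -> 0 < x < PI / 2 -> 0 <= theta p x <= Rpower x (- p).
Proof.
  intros Hp Hx. unfold theta. pose proof (Rpower_gt0 (hcos x) (- (p / 2))).
  assert (Rpower (hcos x) (- (p / 2)) <= Rpower x (- p)); [|lra].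
  replace (Rpower x (- p)) with (Rpower (x ^ 2) (- (p / 2))).
  - apply Rpower_neg_decr; [lra|]. split; [nra|]. apply hcos_ge_sqr; lra.
  - rewrite <- Rpower_2, Rpower_mult by lra. f_equal. field.
Qed.

Lemma Tsum_ge0 (p x : R) (n : nat) : 0 <= p -> 0 <= x <= PI / 2 -> 0 <= Tsum p n x.
Proof.
  intros Hp Hx. induction n as [|n IH]; [unfold Tsum; simpl; lra|].
  eapply Rle_trans; [apply IH|]. now apply Tsum_incr.
Qed.

(** Near 0 the factor [ucos] is O(a^2) and [dn] is O(a^(-p)), so p < 2 makes the product vanish. *)
Lemma lim_boundary_left (p s : R) : 0 < p < 2 -> 1 <= s ->
  is_lim_seq (fun m => ucos s (left_end m) * dn p (S m) (left_end m)) 0.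
Proof.
  intros Hp Hs. apply is_lim_seq_abs_0.
  apply is_lim_seq_le_le with (fun _ => 0)
    (fun m => s / 2 * (Rpower (gap m) (2 - p) + gap m * gap m)).
  - intros m. split; [apply Rabs_pos|]. unfold left_end. set (a := gap m).
    pose proof (gap_bounds m) as Ha. fold a in Ha. pose proof PI_bounds as HP.
    pose proof (ucos_bounds s a ltac:(lra) ltac:(lra)) as Hu.
    pose proof (cosdef_le_sqr s a Hs) as Hu2. rewrite cosdef_ucos in Hu2 by lra.
    pose proof (theta_bounds p a ltac:(lra) ltac:(lra)) as Ht.
    pose proof (Tsum_ge0 p a (S m) ltac:(lra) ltac:(lra)) as HT0.
    pose proof (Tsum_bound p (S m) a ltac:(lra) ltac:(lra)) as HT1.
    assert (HT2 : Rpower (PI - a) (- p) <= 1).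
    { rewrite <- (Rpower_1_l (- p)). apply Rpower_neg_decr; lra. }
    assert (Hd : Rabs (dn p (S m) a) <= Rpower a (- p) + 1) by (unfold dn; apply Rabs_le; lra).
    rewrite Rabs_mult, (Rabs_pos_eq (ucos s a)) by lra.
    replace (2 - p) with (2 + - p) by ring. rewrite Rpower_plus, Rpower_2 by lra.
    replace (s / 2 * (a ^ 2 * Rpower a (- p) + a * a)) with (s / 2 * a ^ 2 * (Rpower a (- p) + 1)) by ring.
    apply Rmult_le_compat; [lra|apply Rabs_pos|easy|easy].
  - apply is_lim_seq_const.
  - replace (Finite 0) with (Rbar_mult (s / 2) (0 + 0 * 0)) by (simpl; f_equal; ring).
    apply is_lim_seq_scal_l. apply is_lim_seq_plus'.
    + apply lim_Rpower_zero; [lra|intros; apply gap_bounds|apply lim_gap].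
    + apply is_lim_seq_mult'; apply lim_gap.
Qed.

(** At pi/2 the point x meets its mirror image pi - x: both x^(-p) and [Tsum] tend to (pi/2)^(-p),
    while the Gaussian term vanishes because [hcos] tends to infinity. *)
Lemma lim_boundary_right (p s : R) : 0 < p -> 0 <= s ->
  is_lim_seq (fun m => ucos s (right_end m) * dn p (S m) (right_end m)) 0.
Proof.
  intros Hp Hs. pose proof PI_bounds as HP.
  assert (L1 : is_lim_seq (fun m => Rpower (right_end m) (- p)) (Rpower (PI / 2) (- p)))
    by (apply lim_Rpower_pos; [lra|apply lim_right_end]).
  assert (L2 : is_lim_seq (fun m => Rpower (PI - right_end m) (- p)) (Rpower (PI / 2) (- p))).
  { apply lim_Rpower_pos; [lra|]. replace (PI / 2) with (PI - PI / 2) by field.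
    apply is_lim_seq_minus'; [apply is_lim_seq_const|apply lim_right_end]. }
  assert (L3 : is_lim_seq (fun m => (1 - 2 * right_end m / PI) * Rpower PI (- p)) 0).
  { replace 0 with ((1 - 2 / PI * (PI / 2)) * Rpower PI (- p)) by (field; lra).
    apply is_lim_seq_mult'; [|apply is_lim_seq_const].
    apply is_lim_seq_minus'; [apply is_lim_seq_const|].
    apply is_lim_seq_ext with (fun m => 2 / PI * right_end m); [intros; field; lra|].
    apply (is_lim_seq_scal_l _ (2 / PI) (PI / 2)), lim_right_end. }
  assert (L4 : is_lim_seq (fun m => Rpower (INR (S m) * PI) (- p)) 0).
  { apply is_lim_seq_incr_1.
    apply is_lim_seq_ext with (fun m => Rpower (INR (S (S m)) * PI + 0) (- p)).
    - intros m. now rewrite Rplus_0_r.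
    - apply is_lim_INR_PI_neg_power; [easy|]. rewrite Rabs_R0; lra. }
  assert (L5 : is_lim_seq (fun m => Rpower (hcos (right_end m)) (- (p / 2))) 0).
  { eapply is_lim_seq_ext; [intros m; symmetry; apply Rpower_Ropp|].
    change (Finite 0) with (Rbar_inv p_infty). apply is_lim_seq_inv; [|easy].
    apply lim_Rpower_infty; [lra| |apply lim_hcos_right].
    intros m. apply hcos_gt0. pose proof (end_bounds m); lra. }
  apply is_lim_seq_abs_0.
  apply is_lim_seq_le_le with (fun _ => 0) (fun m =>
    Rabs (Rpower (right_end m) (- p) - Rpower (PI - right_end m) (- p))
    + ((1 - 2 * right_end m / PI) * Rpower PI (- p) + Rpower (INR (S m) * PI) (- p)
       + Rpower (hcos (right_end m)) (- (p / 2)))).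
  - intros m. split; [apply Rabs_pos|]. pose proof (end_bounds m) as Hb. set (b := right_end m) in *.
    pose proof (ucos_bounds s b Hs ltac:(lra)) as Hu.
    rewrite Rabs_mult, (Rabs_pos_eq (ucos s b)) by lra.
    apply Rle_trans with (1 * Rabs (dn p (S m) b)); [apply Rmult_le_compat_r; [apply Rabs_pos|lra]|].
    rewrite Rmult_1_l.
    pose proof (Tsum_bound p (S m) b ltac:(lra) ltac:(lra)) as HT1.
    pose proof (Tsum_lower p m b ltac:(lra) ltac:(lra)) as HT2.
    pose proof (Rpower_gt0 (INR (S m) * PI) (- p)) as Hr1.
    pose proof (Rpower_gt0 (hcos b) (- (p / 2))) as Hr2.
    pose proof (INR_PI_ge (S m) ltac:(lia)) as Hk.
    pose proof (Rpower_neg_decr (INR (S m) * PI) (INR (S m) * PI + b) p ltac:(lra) ltac:(lra)) as Hr3.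
    assert (Hc : 0 <= 1 - 2 * b / PI).
    { assert (2 * b / PI <= 1); [|lra]. apply Rmult_le_reg_r with PI; [lra|].
      replace (2 * b / PI * PI) with (2 * b) by (field; lra). lra. }
    assert (Hc1 : 0 <= (1 - 2 * b / PI) * Rpower (INR (S m) * PI) (- p)) by (apply Rmult_le_pos; lra).
    assert (Hc2 : 0 <= (1 - 2 * b / PI) * Rpower PI (- p))
      by (apply Rmult_le_pos; [lra|left; apply Rpower_gt0]).
    pose proof (Rle_abs (Rpower b (- p) - Rpower (PI - b) (- p))) as Ha1.
    pose proof (Rle_abs (- (Rpower b (- p) - Rpower (PI - b) (- p)))) as Ha2. rewrite Rabs_Ropp in Ha2.
    unfold dn, theta. apply Rabs_le. lra.
  - apply is_lim_seq_const.
  - replace (Finite 0) with (Finite (Rabs (Rpower (PI / 2) (- p) - Rpower (PI / 2) (- p)) + (0 + 0 + 0)))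
      by (f_equal; rewrite Rminus_diag, Rabs_R0; ring).
    apply is_lim_seq_plus'.
    + apply (is_lim_seq_abs _ (Finite _)). now apply is_lim_seq_minus'.
    + apply is_lim_seq_plus'; [now apply is_lim_seq_plus'|easy].
Qed.

(** The pointwise bound integrated; b - a < 2 accounts for the factor 2 of the error. *)
Lemma RInt_vcos_crossing (p s y0 a b : R) (n : nat) : 7 / 4 <= p -> 2 < s -> 0 <= y0 <= 1 ->
  0 < a <= b -> b < PI / 2 ->
  (forall x, 0 < x < PI / 2 ->
    (y0 < cos x -> Tinf p x <= theta p x) /\ (cos x < y0 -> theta p x <= Tinf p x)) ->
  rpow y0 (s - 2) * RInt (fun x => vcos 2 x * dn p n x) a b
    - 2 * Rpower (INR (S n) * PI - PI / 2) (- p) <= RInt (fun x => vcos s x * dn p n x) a b.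
Proof.
  intros Hp Hs Hy Ha Hb H. pose proof PI_bounds.
  assert (E : forall s, is_RInt (fun x => vcos s x * dn p n x) a b (RInt (fun x => vcos s x * dn p n x) a b)).
  { intros q. apply (RInt_correct (V := R_CompleteNormedModule)).
    apply (ex_RInt_ab (fun x => vcos q x * dn p n x)); try easy. intros x Hx.
    apply (continuous_mult (vcos q) (dn p n)); [apply continuous_vcos; lra|now apply continuous_dn]. }
  set (eta := Rpower (INR (S n) * PI - PI / 2) (- p)).
  assert (He : 0 < eta) by apply Rpower_gt0.
  set (y := rpow y0 (s - 2)).
  assert (E2 : is_RInt (fun x => y * (vcos 2 x * dn p n x) - eta) a b
    (y * RInt (fun x => vcos 2 x * dn p n x) a b - (b - a) * eta)).
  { apply (is_RInt_minus (fun x => y * (vcos 2 x * dn p n x)) (fun _ => eta)).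
    - apply (is_RInt_scal (fun x => vcos 2 x * dn p n x) a b y). apply E.
    - apply (is_RInt_const a b eta). }
  apply Rle_trans with (y * RInt (fun x => vcos 2 x * dn p n x) a b - (b - a) * eta); [nra|].
  apply (is_RInt_le _ _ a b _ _ ltac:(lra) E2 (E s)).
  intros x Hx. apply vcos_crossing; try easy; try lra; apply H; lra.
Qed.

(* With [y0] the crossing level, [cos^(s-2) - y0^(s-2)] has the sign of the difference of the
   distribution functions, which carries the inequality from the exponent 2 to [s]. *)
Theorem gauss_cos_comparison (p s Cs Js C2 J2 : R) : 7 / 4 <= p < 2 -> 2 <= s ->
  is_phi p (cosdef s) Cs -> is_phi p (gaussdef s) Js ->
  is_phi p (cosdef 2) C2 -> is_phi p (gaussdef 2) J2 -> J2 <= C2 -> Js <= Cs.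
Proof.
  intros Hp Hs HCs HJs HC2 HJ2 H2. pose proof PI_bounds as HP.
  destruct Hs as [Hs|<-].
  2:{ now rewrite (phi_unique _ _ _ _ HCs HC2), (phi_unique _ _ _ _ HJs HJ2). }
  destruct (single_crossing p ltac:(lra)) as [y0 [Hy Hcross]].
  set (y := rpow y0 (s - 2)). assert (Hy1 : 0 <= y) by apply rpow_ge0.
  set (bd := fun s m => (ucos s (left_end m) * dn p (S m) (left_end m)
     - ucos s (right_end m) * dn p (S m) (right_end m)) / p).
  set (B := fun s m => window p (gaussdef s) (psi (left_end m)) (psi (right_end m))).
  set (W := fun m => window p (cosdef 2) (left_end m) (INR (S m) * PI + PI / 2)).
  set (eta := fun m => Rpower (INR (S (S m)) * PI - PI / 2) (- p)).
  (* In the limit the boundary, gap and tail terms vanish, and this becomes Js + (s/2) y (C2 - J2)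
     <= Cs. *)
  assert (Hlb : forall m, B s m + bd s m + s / p * (y * (p / 2 * (W m - (4 * INR (S m) + 1) * gap m
      - B 2 m - bd 2 m)) - 2 * eta m) <= Cs).
  { intros m. destruct (end_bounds m) as [He1 He2]. pose proof (gap_bounds m) as Hg.
    set (a := left_end m) in *. set (b := right_end m) in *.
    assert (EB : forall q, 0 <= q -> RInt (fun x => ucos q x * gker p x) a b = B q m).
    { intros q Hq. apply is_RInt_unique. now apply is_RInt_gauss_window. }
    pose proof (by_parts p s a b (S m) ltac:(lra) He1 He2) as Ps.
    pose proof (by_parts p 2 a b (S m) ltac:(lra) He1 He2) as P2.
    rewrite EB, RInt_wn in Ps by (try easy; lra). rewrite EB, RInt_wn in P2 by (try easy; lra).
    destruct (folded_window_bounds p s a b (gap m) (S m)) as [Fs _];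
      [lra|lra|unfold a, left_end; lra|lra|unfold b, right_end; lra|].
    destruct (folded_window_bounds p 2 a b (gap m) (S m)) as [_ F2];
      [lra|lra|unfold a, left_end; lra|lra|unfold b, right_end; lra|].
    change (window p (cosdef 2) a (INR (S m) * PI + PI / 2)) with (W m) in F2.
    assert (Fs' : folded_window p s a b (S m) <= Cs).
    { eapply Rle_trans; [apply Fs|]. apply phi_window; [easy|].
      pose proof (INR_PI_ge (S m) ltac:(lia)). lra. }
    pose proof (RInt_vcos_crossing p s y0 a b (S m) ltac:(lra) Hs Hy He1 He2 Hcross) as X.
    fold y in X. fold (eta m) in X.
    set (Is := RInt (fun x => vcos s x * dn p (S m) x) a b : R) in *.
    set (I2 := RInt (fun x => vcos 2 x * dn p (S m) x) a b : R) in *.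
    assert (Ebd : forall q, bd q m = (ucos q a * dn p (S m) a - ucos q b * dn p (S m) b) / p) by easy.
    rewrite <- Ebd in Ps, P2.
    assert (K2 : p / 2 * (W m - (4 * INR (S m) + 1) * gap m - B 2 m - bd 2 m) <= I2).
    { replace I2 with (p / 2 * (2 / p * I2)) by (field; lra).
      apply Rmult_le_compat_l; lra. }
    apply Rle_trans with (B s m + bd s m + s / p * Is); [|lra].
    apply Rplus_le_compat_l, Rmult_le_compat_l; [left; apply Rdiv_lt_0_compat; lra|].
    eapply Rle_trans; [|apply X]. apply Rplus_le_compat_r. now apply Rmult_le_compat_l. }
  assert (Lbd : forall q, 1 <= q -> is_lim_seq (bd q) 0).
  { intros q Hq. replace 0 with ((0 - 0) / p) by (field; lra). unfold bd, Rdiv.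
    apply (is_lim_seq_scal_r _ (/ p) (0 - 0)), is_lim_seq_minus'.
    - apply lim_boundary_left; lra.
    - apply lim_boundary_right; lra. }
  assert (LW : is_lim_seq W C2).
  { apply phi_lim; [apply adm_cosdef; lra|easy| |apply lim_gap|].
    - intros m. pose proof (end_bounds m). unfold right_end in *.
      pose proof (INR_PI_ge (S m) ltac:(lia)). pose proof (gap_bounds m). lra.
    - apply is_lim_seq_le_p_loc with (fun m => INR (S m)); [|apply lim_right_ends].
      exists 0%nat. intros m _. pose proof (pos_INR (S m)). nra. }
  assert (Leta : is_lim_seq eta 0).
  { apply is_lim_INR_PI_neg_power; [lra|]. rewrite Rabs_Ropp, Rabs_pos_eq; lra. }
  assert (L : is_lim_seq (fun m => B s m + bd s m + s / p * (y * (p / 2 * (W m - (4 * INR (S m) + 1) * gap m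
      - B 2 m - bd 2 m)) - 2 * eta m)) (Js + 0 + s / p * (y * (p / 2 * (C2 - 0 - J2 - 0)) - 2 * 0))).
  { apply is_lim_seq_plus'; [apply is_lim_seq_plus'; [apply lim_psi_window; [lra|easy]|apply Lbd; lra]|].
    apply (is_lim_seq_scal_l _ (s / p) (y * (p / 2 * (C2 - 0 - J2 - 0)) - 2 * 0)).
    apply is_lim_seq_minus'; [|apply (is_lim_seq_scal_l _ 2 0), Leta].
    apply (is_lim_seq_scal_l _ y (p / 2 * (C2 - 0 - J2 - 0))).
    apply (is_lim_seq_scal_l _ (p / 2) (C2 - 0 - J2 - 0)).
    apply is_lim_seq_minus'; [|apply Lbd; lra].
    apply is_lim_seq_minus'; [|apply lim_psi_window; [lra|easy]].
    apply is_lim_seq_minus'; [easy|apply lim_gap_mult]. }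
  pose proof (is_lim_seq_le _ (fun _ => Cs) _ Cs Hlb L (is_lim_seq_const _)) as F. simpl in F.
  assert (0 <= s / p * (y * (p / 2 * (C2 - J2)))); [|lra].
  apply Rmult_le_pos; [left; apply Rdiv_lt_0_compat; lra|].
  apply Rmult_le_pos; [easy|]. apply Rmult_le_pos; lra.
Qed.

(** * Averages over signs *)

(* [av l g x] is the expectation of [g (x + sum_i l_i eps_i)] for independent signs [eps_i]. *)
Fixpoint av (l : list R) (g : R -> R) (x : R) : R :=
  match l with
  | nil => g x
  | a :: l' => (av l' g (x + a) + av l' g (x - a)) / 2
  end.

Lemma av_ext (l : list R) (f g : R -> R) (x : R) : (forall y, f y = g y) -> av l f x = av l g x.
Proof.
  intros H. revert x. induction l as [|a l IH]; intros x; simpl; [apply H|]. now rewrite !IH.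
Qed.

Lemma av_le (l : list R) (f g : R -> R) (x : R) : (forall y, f y <= g y) -> av l f x <= av l g x.
Proof.
  intros H. revert x. induction l as [|a l IH]; intros x; simpl; [apply H|].
  pose proof (IH (x + a)). pose proof (IH (x - a)). lra.
Qed.

Lemma av_plus (l : list R) (f g : R -> R) (x : R) :
  av l (fun y => f y + g y) x = av l f x + av l g x.
Proof.
  revert x. induction l as [|a l IH]; intros x; simpl; [easy|]. rewrite !IH. field.
Qed.

Lemma av_scal (l : list R) (c : R) (g : R -> R) (x : R) :
  av l (fun y => c * g y) x = c * av l g x.
Proof.
  revert x. induction l as [|a l IH]; intros x; simpl; [easy|]. rewrite !IH. field.
Qed.

Lemma av_const (l : list R) (c x : R) : av l (fun _ => c) x = c.
Proof. revert x. induction l as [|a l IH]; intros x; simpl; [easy|]. rewrite !IH. field. Qed.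

Lemma av_ge0 (l : list R) (g : R -> R) (x : R) : (forall y, 0 <= g y) -> 0 <= av l g x.
Proof. intros H. rewrite <- (av_const l 0 x). now apply av_le. Qed.

Lemma av_perm (l l' : list R) (g : R -> R) (x : R) : Permutation l l' -> av l g x = av l' g x.
Proof.
  intros H. revert x. induction H as [|a l l' H IH|a b l|l l' l'' H1 IH1 H2 IH2]; intros x; simpl.
  - easy.
  - now rewrite !IH.
  - replace (x + b + a) with (x + a + b) by ring. replace (x + b - a) with (x - a + b) by ring.
    replace (x - b + a) with (x + a - b) by ring. replace (x - b - a) with (x - a - b) by ring. field.
  - now rewrite IH1.
Qed.

Lemma av_even (l : list R) (g : R -> R) (x : R) :
  (forall y, g (- y) = g y) -> av l g (- x) = av l g x.
Proof.
  intros H. revert x. induction l as [|a l IH]; intros x; simpl; [apply H|].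
  replace (- x + a) with (- (x - a)) by ring. replace (- x - a) with (- (x + a)) by ring.
  rewrite !IH. field.
Qed.

(** For independent signs e and f, the sum e a + f b is e times a + b or e times a - b according to
    the sign e f, which is independent of e. *)
Lemma av_merge (a b : R) (l : list R) (g : R -> R) (x : R) :
  av (a :: b :: l) g x = (av ((a + b) :: l) g x + av ((a - b) :: l) g x) / 2.
Proof.
  simpl. replace (x + (a + b)) with (x + a + b) by ring. replace (x - (a + b)) with (x - a - b) by ring.
  replace (x + (a - b)) with (x + a - b) by ring. replace (x - (a - b)) with (x - a + b) by ring. field.
Qed.

Lemma av_scale (c : R) (l : list R) (g : R -> R) (x : R) :
  av (map (Rmult c) l) g (c * x) = av l (fun y => g (c * y)) x.
Proof.
  revert x. induction l as [|a l IH]; intros x; simpl; [easy|].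
  rewrite <- !IH. do 2 f_equal; f_equal; ring.
Qed.

Definition sumsq (l : list R) : R := fold_right (fun a s => a ^ 2 + s) 0 l.

Lemma sumsq_ge0 (l : list R) : 0 <= sumsq l.
Proof. induction l as [|a l IH]; simpl; [lra|]. nra. Qed.

Lemma sumsq_perm (l l' : list R) : Permutation l l' -> sumsq l = sumsq l'.
Proof.
  induction 1 as [|a l l' H IH|a b l|l l' l'' H1 IH1 H2 IH2]; simpl; simpl in *; lra.
Qed.

Lemma sumsq_scale (c : R) (l : list R) : sumsq (map (Rmult c) l) = c ^ 2 * sumsq l.
Proof. induction l as [|a l IH]; simpl in *; [ring|]. rewrite IH. ring. Qed.

Lemma av_sqr (l : list R) (x : R) : av l (fun y => y ^ 2) x = x ^ 2 + sumsq l.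
Proof.
  revert x. induction l as [|a l IH]; intros x; [simpl; ring|].
  change (av (a :: l) (fun y => y ^ 2) x)
    with ((av l (fun y => y ^ 2) (x + a) + av l (fun y => y ^ 2) (x - a)) / 2).
  rewrite !IH. simpl. field.
Qed.

Definition prodcos (l : list R) (t : R) : R := fold_right (fun a s => cos (a * t) * s) 1 l.

Lemma av_cos (l : list R) (t x : R) : av l (fun y => cos (y * t)) x = cos (x * t) * prodcos l t.
Proof.
  revert x. induction l as [|a l IH]; intros x; simpl; [ring|].
  rewrite !IH. rewrite Rmult_plus_distr_r, Rmult_minus_distr_r, cos_plus, cos_minus. field.
Qed.

Definition mom (p : R) (l : list R) (x : R) : R := av l (fun y => rpow (Rabs y) p) x.

Lemma mom_ge0 (p : R) (l : list R) (x : R) : 0 <= mom p l x.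
Proof. apply av_ge0. intros; apply rpow_ge0. Qed.

Lemma mom_2 (l : list R) (x : R) : mom 2 l x = x ^ 2 + sumsq l.
Proof.
  rewrite <- av_sqr. apply av_ext. intros y. rewrite rpow_2 by apply Rabs_pos. apply pow2_abs.
Qed.

Lemma mom_scale (p c : R) (l : list R) (x : R) : 
  mom p (map (Rmult c) l) (c * x) = rpow (Rabs c) p * mom p l x.
Proof.
  unfold mom. rewrite av_scale, <- av_scal. apply av_ext. intros y.
  rewrite Rabs_mult, rpow_mult by apply Rabs_pos. easy.
Qed.

(* Lyapunov's inequality, by Young applied to the normalised integrands. *)
Lemma mom_interpolate (p q a : R) (l : list R) (x : R) : 0 <= a <= 1 ->
  0 < mom p l x -> 0 < mom q l x ->
  mom (a * p + (1 - a) * q) l x <= Rpower (mom p l x) a * Rpower (mom q l x) (1 - a).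
Proof.
  intros Ha Hp Hq. set (P := mom p l x) in *. set (Q := mom q l x) in *.
  assert (H : mom (a * p + (1 - a) * q) l x <=
    av l (fun y => Rpower P a * Rpower Q (1 - a) * (a / P * rpow (Rabs y) p + (1 - a) / Q * rpow (Rabs y) q)) x).
  { apply av_le. intros y. destruct (Req_dec (Rabs y) 0) as [->|Hy].
    - rewrite !rpow_0. right; ring.
    - assert (Hy' : 0 < Rabs y) by (pose proof (Rabs_pos y); lra).
      rewrite !rpow_pos by easy. set (r := ln (Rabs y)).
      pose proof (exp_convex a (p * r - ln P) (q * r - ln Q) Ha) as E.
      unfold Rminus in E. rewrite (exp_plus (p * r)), (exp_plus (q * r)), !exp_Ropp, !exp_ln in E by easy.
      unfold Rpower. fold r.
      apply (Rmult_le_compat_l (exp (a * ln P) * exp ((1 - a) * ln Q))) in E;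
        [|apply Rmult_le_pos; left; apply exp_pos].
      replace (exp (a * ln P) * exp ((1 - a) * ln Q) *
        exp (a * (p * r + - ln P) + (1 + - a) * (q * r + - ln Q)))
        with (exp ((a * p + (1 - a) * q) * r)) in E
        by (rewrite <- !exp_plus; f_equal; ring).
      eapply Rle_trans; [apply E|]. right. unfold Rdiv, Rminus. ring. }
  eapply Rle_trans; [apply H|]. rewrite av_scal, av_plus, !av_scal.
  change (av l (fun y => rpow (Rabs y) p) x) with P. change (av l (fun y => rpow (Rabs y) q) x) with Q.
  right. field. split; lra.
Qed.

Lemma mom_gt0 (p : R) (l : list R) (x : R) : 0 < x ^ 2 + sumsq l -> 0 < mom p l x.
Proof.
  revert x. unfold mom. induction l as [|a l IH]; intros x H.
  - simpl in *. apply rpow_gt0, Rabs_pos_lt. intros ->. lra.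
  - simpl sumsq in H. simpl av.
    pose proof (mom_ge0 p l (x + a)) as H1. pose proof (mom_ge0 p l (x - a)) as H2. unfold mom in *.
    destruct (Rlt_le_dec 0 ((x + a) ^ 2 + sumsq l)) as [Hp|Hp].
    + pose proof (IH _ Hp). lra.
    (* In this case x = - a and [sumsq l] = 0, so x - a = 2 x could vanish only if x and a both
       did. *)
    + assert (0 < (x - a) ^ 2 + sumsq l) as Hm.
      { pose proof (sumsq_ge0 l). nra. }
      pose proof (IH _ Hm). lra.
Qed.

(** * Moments as integrals of 1 - prod cos (a_k t) *)

Definition onemcos (t : R) : R := 1 - cos t.

Lemma adm_onemcos : adm onemcos.
Proof.
  intros t _. split.
  - apply (continuous_minus (fun _ => 1) cos); [apply continuous_const|apply continuous_cos].
  - unfold onemcos. pose proof (COS_bound t). lra.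
Qed.

Lemma onemcos_exists (p : R) : 0 < p < 2 -> exists c, 0 < c /\ is_phi p onemcos c.
Proof.
  intros Hp. destruct (phi_exists p 2 onemcos Hp adm_onemcos) as [c Hc].
  - intros t _. unfold onemcos. pose proof (one_minus_cos_le t). nra.
  - intros t _. unfold onemcos. pose proof (COS_bound t). lra.
  - exists c. split; [|easy]. apply (phi_pos p onemcos c adm_onemcos Hc).
    intros t Ht. unfold onemcos. pose proof PI_bounds.
    assert (cos t < cos 0) as H1 by (apply cos_decreasing_1; lra). rewrite cos_0 in H1. lra.
Qed.

Lemma adm_zero : adm (fun _ => 0).
Proof. intros t _. split; [apply continuous_const|lra]. Qed.

Lemma phi_zero (p : R) : is_phi p (fun _ => 0) 0.
Proof.
  apply phi_of_lim_std; [apply adm_zero|].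
  apply is_lim_seq_ext with (fun _ => 0); [|apply is_lim_seq_const].
  intros n. symmetry. apply is_RInt_unique.
  eapply is_RInt_ext; [|evar_last; [apply (@is_RInt_const R_NormedModule _ _ 0)|]].
  - intros; simpl; ring.
  - unfold scal; simpl; unfold mult; simpl; ring.
Qed.

Lemma adm_ext (f g : R -> R) : (forall t, f t = g t) -> adm f -> adm g.
Proof.
  intros H Hf t Ht. destruct (Hf t Ht) as [H1 H2]. rewrite <- H. split; [|easy].
  now apply continuous_ext with f.
Qed.

Lemma onemcos_even (y t : R) : onemcos (y * t) = onemcos (Rabs y * t).
Proof.
  unfold onemcos. destruct (Rle_or_lt 0 y) as [H|H].
  - now rewrite Rabs_pos_eq.
  - rewrite Rabs_left by easy. now rewrite <- cos_neg, Ropp_mult_distr_l.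
Qed.

(** Dilation by |y|, cos being even; y = 0 is treated apart because dilations need a positive
    factor. *)
Lemma phi_onemcos_dilate (p c y : R) : is_phi p onemcos c ->
  adm (fun t => onemcos (y * t)) /\ is_phi p (fun t => onemcos (y * t)) (c * rpow (Rabs y) p).
Proof.
  intros Hc. destruct (Req_dec y 0) as [->|Hy].
  - rewrite Rabs_R0, rpow_0, Rmult_0_r. split.
    + apply adm_ext with (fun _ => 0); [|apply adm_zero].
      intros t. unfold onemcos. rewrite Rmult_0_l, cos_0. ring.
    + apply phi_ext with (fun _ => 0); [|apply phi_zero].
      intros t _. unfold onemcos. rewrite Rmult_0_l, cos_0. ring.
  - assert (Ha : 0 < Rabs y) by now apply Rabs_pos_lt.
    rewrite rpow_pos, Rmult_comm by easy. split.
    + apply adm_ext with (fun t => onemcos (Rabs y * t)); [intros; symmetry; apply onemcos_even|].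
      now apply (adm_dilate _ onemcos), adm_onemcos.
    + apply phi_ext with (fun t => onemcos (Rabs y * t)); [intros; symmetry; apply onemcos_even|].
      apply (phi_dilate p (Rabs y) onemcos c Ha adm_onemcos Hc).
Qed.

Lemma phi_moment_av (p c : R) (l : list R) (x : R) : is_phi p onemcos c ->
  adm (fun t => av l (fun y => onemcos (y * t)) x) /\
  is_phi p (fun t => av l (fun y => onemcos (y * t)) x) (c * mom p l x).
Proof.
  intros Hc. unfold mom. revert x. induction l as [|a l IH]; intros x; simpl.
  - now apply phi_onemcos_dilate.
  - destruct (IH (x + a)) as [A1 P1]. destruct (IH (x - a)) as [A2 P2].
    pose proof (adm_plus _ _ A1 A2) as A. pose proof (phi_plus _ _ _ _ _ A1 A2 P1 P2) as P.
    split.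
    + eapply adm_ext; [|apply (adm_scal (/ 2) _ ltac:(lra) A)]. intros t. simpl. field.
    + eapply phi_ext; [|evar_last; [apply (phi_scal p (/ 2) _ _ ltac:(lra) A P)|]].
      * intros t _. simpl. field.
      * field.
Qed.

Lemma phi_moment (p c : R) (l : list R) : is_phi p onemcos c ->
  adm (fun t => 1 - prodcos l t) /\ is_phi p (fun t => 1 - prodcos l t) (c * mom p l 0).
Proof.
  intros Hc. destruct (phi_moment_av p c l 0 Hc) as [A P].
  assert (E : forall t, av l (fun y => onemcos (y * t)) 0 = 1 - prodcos l t).
  { intros t. unfold onemcos, Rminus.
    rewrite (av_ext l _ (fun y => 1 + - 1 * cos (y * t))) by (intros; ring).
    rewrite av_plus, av_scal, av_const, av_cos, Rmult_0_l, cos_0. ring. }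
  split; [now apply adm_ext with (1 := E)|]. now apply phi_ext with (1 := fun t _ => E t).
Qed.

(** * Central limit estimate for the moments of the simple random walk *)

Lemma pow_diff_le (x y : R) (n : nat) : Rabs x <= 1 -> Rabs y <= 1 ->
  Rabs (x ^ n - y ^ n) <= INR n * Rabs (x - y).
Proof.
  intros Hx Hy. induction n as [|n IH]; [simpl; rewrite Rminus_diag, Rabs_R0; lra|].
  rewrite S_INR. replace (x ^ S n - y ^ S n) with (x * (x ^ n - y ^ n) + (x - y) * y ^ n) by (simpl; ring).
  eapply Rle_trans; [apply Rabs_triang|]. rewrite !Rabs_mult.
  assert (Rabs (y ^ n) <= 1).
  { rewrite <- RPow_abs. rewrite <- (pow1 n). apply pow_incr. split; [apply Rabs_pos|easy]. }
  pose proof (Rabs_pos (x - y)). pose proof (Rabs_pos (x ^ n - y ^ n)). pose proof (Rabs_pos x).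
  pose proof (Rabs_pos (y ^ n)). nra.
Qed.

Lemma cos_le_quartic (u : R) : cos u <= 1 - u ^ 2 / 2 + u ^ 4 / 24.
Proof.
  assert (H : forall v, 0 <= v -> cos v <= 1 - v ^ 2 / 2 + v ^ 4 / 24).
  { intros v Hv.
    assert (Hs : forall w, 0 <= w -> w - w ^ 3 / 6 <= sin w).
    { intros w Hw.
      pose proof (derive_nonneg_le (fun y => sin y - (y - y ^ 3 / 6)) (fun y => cos y - (1 - y ^ 2 / 2)) 0 w Hw) as D.
      cbv beta in D. rewrite sin_0 in D. assert (0 - (0 - 0 ^ 3 / 6) <= sin w - (w - w ^ 3 / 6)); [apply D|lra].
      - intros y _. auto_derive; [easy|field].
      - intros y _. pose proof (one_minus_cos_le y). lra. }
    pose proof (derive_nonneg_le (fun y => (1 - y ^ 2 / 2 + y ^ 4 / 24) - cos y) (fun y => sin y - (y - y ^ 3 / 6)) 0 v Hv) as D.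
    cbv beta in D. rewrite cos_0 in D.
    assert ((1 - 0 ^ 2 / 2 + 0 ^ 4 / 24) - 1 <= (1 - v ^ 2 / 2 + v ^ 4 / 24) - cos v); [apply D|lra].
    - intros y _. auto_derive; [easy|field].
    - intros y Hy. pose proof (Hs y ltac:(lra)). lra. }
  destruct (Rle_or_lt 0 u) as [Hu|Hu]; [now apply H|].
  rewrite <- (cos_neg u). pose proof (H (- u) ltac:(lra)) as H1.
  replace ((- u) ^ 2) with (u ^ 2) in H1 by ring. replace ((- u) ^ 4) with (u ^ 4) in H1 by ring. easy.
Qed.

Lemma exp_neg_le_quadratic (v : R) : 0 <= v -> exp (- v) <= 1 - v + v ^ 2 / 2.
Proof.
  intros Hv.
  pose proof (derive_nonneg_le (fun y => (1 - y + y ^ 2 / 2) - exp (- y)) (fun y => exp (- y) - (1 + - y)) 0 v Hv) as D.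
  cbv beta in D. rewrite Ropp_0, exp_0 in D.
  assert ((1 - 0 + 0 ^ 2 / 2) - 1 <= (1 - v + v ^ 2 / 2) - exp (- v)); [apply D|lra].
  - intros y _. auto_derive; [easy|field].
  - intros y _. pose proof (exp_ge_1x (- y)). lra.
Qed.

(** Both functions lie between 1 - u^2/2 and 1 - u^2/2 + u^4/8. *)
Lemma cos_gauss_diff (u : R) : Rabs (cos u - exp (- (u ^ 2 / 2))) <= u ^ 4 / 8.
Proof.
  pose proof (one_minus_cos_le u). pose proof (cos_le_quartic u).
  assert (H2 : 0 <= u ^ 2) by nra.
  pose proof (exp_neg_le_quadratic (u ^ 2 / 2) ltac:(lra)) as He.
  pose proof (exp_ge_1x (- (u ^ 2 / 2))).
  replace ((u ^ 2 / 2) ^ 2 / 2) with (u ^ 4 / 8) in He by field.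
  assert (0 <= u ^ 4) by (replace (u ^ 4) with (u ^ 2 * u ^ 2) by ring; nra).
  apply Rabs_le. lra.
Qed.

(* A smooth majorant of [min (u^4 / 8) 2]. *)
Definition kappa (u : R) : R := 4 * u ^ 4 / (u ^ 4 + 16).

Lemma pow4_ge0 (u : R) : 0 <= u ^ 4.
Proof. replace (u ^ 4) with ((u ^ 2) ^ 2) by ring. apply pow2_ge_0. Qed.

Lemma adm_kappa : adm kappa.
Proof.
  intros t _. pose proof (pow4_ge0 t). split.
  - apply (ex_derive_continuous kappa). unfold kappa. auto_derive. simpl in *. lra.
  - unfold kappa. apply Rmult_le_pos; [lra|]. left; apply Rinv_0_lt_compat; lra.
Qed.

Lemma kappa_exists (p : R) : 0 < p < 2 -> exists k, is_phi p kappa k.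
Proof.
  intros Hp. apply (phi_exists p 4 kappa Hp adm_kappa).
  - intros t _. unfold kappa. pose proof (pow4_ge0 t).
    apply (Rmult_le_reg_r (t ^ 4 + 16)); [lra|].
    replace (4 * t ^ 4 / (t ^ 4 + 16) * (t ^ 4 + 16)) with (4 * t ^ 4) by (field; lra).
    replace (4 * t ^ 2 * (t ^ 4 + 16)) with (4 * t ^ 4 + 4 * t ^ 2 * ((t ^ 2 - / 2) ^ 2 + (16 - / 4))) by field.
    pose proof (pow2_ge_0 (t ^ 2 - / 2)). pose proof (pow2_ge_0 t).
    assert (0 <= 4 * t ^ 2 * ((t ^ 2 - / 2) ^ 2 + (16 - / 4))) by (apply Rmult_le_pos; lra). lra.
  - intros t _. unfold kappa. pose proof (pow4_ge0 t).
    apply (Rmult_le_reg_r (t ^ 4 + 16)); [lra|].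
    replace (4 * t ^ 4 / (t ^ 4 + 16) * (t ^ 4 + 16)) with (4 * t ^ 4) by (field; lra). lra.
Qed.

(** 4 X / (X + 16) is the harmonic mean of X/8 and 2, hence at least their minimum. *)
Lemma kappa_ge (X d : R) : 0 <= X -> d <= X / 8 -> d <= 2 -> d <= 4 * X / (X + 16).
Proof.
  intros HX H1 H2. apply (Rmult_le_reg_r (X + 16)); [lra|].
  replace (4 * X / (X + 16) * (X + 16)) with (4 * X) by (field; lra).
  destruct (Rle_or_lt X 16); nra.
Qed.

(** With u = t / sqrt n, the n factors contribute at most n u^4 / 8 = (n^(-1/4) t)^4 / 8. The error
    is thus a dilate of [kappa], whose integral is smaller by the factor n^(-p/4). *)
Lemma cos_pow_gauss_diff (n : nat) (t : R) : (1 <= n)%nat ->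
  Rabs (cos (/ sqrt (INR n) * t) ^ n - exp (- (t ^ 2 / 2))) <= kappa (Rpower (INR n) (- / 4) * t).
Proof.
  intros Hn. assert (HN : 0 < INR n) by (apply lt_0_INR; lia).
  set (N := INR n) in *. pose proof (sqrt_lt_R0 N HN) as Hs.
  set (u := / sqrt N * t).
  assert (Hu2 : u ^ 2 = t ^ 2 / N).
  { unfold u. replace N with (sqrt N * sqrt N) at 2 by (apply sqrt_sqrt; lra). field. lra. }
  assert (Hu4 : u ^ 4 = t ^ 4 / N ^ 2).
  { replace (u ^ 4) with ((u ^ 2) ^ 2) by ring. rewrite Hu2. field. lra. }
  assert (He : exp (- (t ^ 2 / 2)) = exp (- (u ^ 2 / 2)) ^ n).
  { rewrite <- (Rpower_pow n (exp (- (u ^ 2 / 2)))) by apply exp_pos. unfold Rpower. rewrite ln_exp. fold N. f_equal.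
    rewrite Hu2. field. lra. }
  assert (Hk : (Rpower N (- / 4) * t) ^ 4 = t ^ 4 / N).
  { rewrite Rpow_mult_distr. rewrite <- (Rpower_pow 4 (Rpower N (- / 4))) by apply Rpower_gt0. rewrite Rpower_mult.
    replace (- / 4 * INR 4) with (Ropp 1) by (simpl; field). rewrite Rpower_Ropp, Rpower_1 by easy. field; lra. }
  unfold kappa. rewrite Hk. pose proof (pow4_ge0 t).
  assert (Hc1 : Rabs (cos u) <= 1) by apply Rabs_cos_le1.
  assert (He1 : Rabs (exp (- (u ^ 2 / 2))) <= 1).
  { rewrite Rabs_pos_eq by (left; apply exp_pos).
    rewrite <- exp_0. pose proof (pow2_ge_0 u).
    destruct (Req_dec (- (u ^ 2 / 2)) 0) as [->|]; [lra|]. left; apply exp_increasing; lra. }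
  apply kappa_ge.
  - apply Rmult_le_pos; [easy|]. left; now apply Rinv_0_lt_compat.
  - rewrite He. eapply Rle_trans; [apply pow_diff_le; easy|]. fold N.
    pose proof (cos_gauss_diff u) as Hd. rewrite Hu4 in Hd.
    apply (Rmult_le_compat_l N) in Hd; [|lra].
    replace (N * (t ^ 4 / N ^ 2 / 8)) with (t ^ 4 / N / 8) in Hd by (field; lra). easy.
  - rewrite He. eapply Rle_trans; [apply Rabs_triang|]. rewrite Rabs_Ropp, <- !RPow_abs.
    pose proof (pow_incr (Rabs (cos u)) 1 n ltac:(split; [apply Rabs_pos|easy])).
    pose proof (pow_incr (Rabs (exp (- (u ^ 2 / 2)))) 1 n ltac:(split; [apply Rabs_pos|easy])).
    rewrite pow1 in *. lra.
Qed.

Definition walk (p : R) (n : nat) : R := mom p (repeat 1 n) 0.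

Lemma sumsq_ones (n : nat) : sumsq (repeat 1 n) = INR n.
Proof. induction n as [|n IH]; [easy|]. rewrite S_INR. simpl in *. lra. Qed.

Lemma walk_gt0 (p : R) (n : nat) : (1 <= n)%nat -> 0 < walk p n.
Proof.
  intros Hn. apply mom_gt0. rewrite sumsq_ones. assert (0 < INR n) by (apply lt_0_INR; lia). lra.
Qed.

Lemma prodcos_ones (n : nat) (t : R) : prodcos (repeat 1 n) t = cos t ^ n.
Proof. induction n as [|n IH]; [easy|]. simpl in *. now rewrite IH, Rmult_1_l. Qed.

Definition nwalk (p : R) (n : nat) : R := walk p n / Rpower (INR n) (p / 2).

Lemma phi_nwalk (p c : R) (n : nat) : is_phi p onemcos c -> (1 <= n)%nat ->
  adm (fun t => 1 - cos (/ sqrt (INR n) * t) ^ n) /\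
  is_phi p (fun t => 1 - cos (/ sqrt (INR n) * t) ^ n) (c * nwalk p n).
Proof.
  intros Hc Hn. assert (HN : 0 < INR n) by (apply lt_0_INR; lia).
  pose proof (sqrt_lt_R0 _ HN) as Hs. assert (Hi : 0 < / sqrt (INR n)) by now apply Rinv_0_lt_compat.
  destruct (phi_moment p c (repeat 1 n) Hc) as [A P].
  assert (E : forall t, 1 - prodcos (repeat 1 n) (/ sqrt (INR n) * t) = 1 - cos (/ sqrt (INR n) * t) ^ n)
    by (intros; now rewrite prodcos_ones).
  split.
  - eapply adm_ext; [apply E|]. apply (adm_dilate _ _ Hi A).
  - eapply phi_ext; [intros t _; apply E|]. evar_last; [apply (phi_dilate p _ _ _ Hi A P)|].
    unfold nwalk, walk. rewrite <- Rpower_sqrt, <- Rpower_Ropp, Rpower_mult by easy.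
    replace (- / 2 * p) with (- (p / 2)) by field. rewrite Rpower_Ropp. field.
    apply Rgt_not_eq, Rpower_gt0.
Qed.

Lemma nwalk_limit (p c J : R) : 0 < p < 2 -> 0 < c -> is_phi p onemcos c -> is_phi p (gaussdef 1) J ->
  is_lim_seq (fun n => nwalk p (S n)) (J / c).
Proof.
  intros Hp Hc0 Hc HJ. destruct (kappa_exists p Hp) as [k Hk].
  set (lam := fun n => Rpower (INR (S n)) (- / 4)).
  set (err := fun n => Rpower (lam n) p * k).
  assert (Hb : forall n, J - err n <= c * nwalk p (S n) <= J + err n).
  { intros n. destruct (phi_nwalk p c (S n) Hc ltac:(lia)) as [A P].
    assert (Hl : 0 < lam n) by apply Rpower_gt0.
    pose proof (adm_dilate _ _ Hl adm_kappa) as Ak.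
    pose proof (phi_dilate p _ _ _ Hl adm_kappa Hk) as Pk. fold (err n) in Pk.
    pose proof (adm_gaussdef 1 ltac:(lra)) as Ag.
    assert (Hd : forall t, Rabs (cos (/ sqrt (INR (S n)) * t) ^ (S n) - exp (- (1 * t ^ 2 / 2))) <= kappa (lam n * t)).
    { intros t. rewrite Rmult_1_l. apply cos_pow_gauss_diff. lia. }
    split.
    - assert (J <= c * nwalk p (S n) + err n); [|lra].
      refine (phi_le p _ _ _ _ Ag (adm_plus _ _ A Ak) _ HJ (phi_plus _ _ _ _ _ A Ak P Pk)).
      intros t _. specialize (Hd t). apply Rabs_le_between in Hd. unfold gaussdef. lra.
    - refine (phi_le p _ _ _ _ A (adm_plus _ _ Ag Ak) _ P (phi_plus _ _ _ _ _ Ag Ak HJ Pk)).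
      intros t _. specialize (Hd t). apply Rabs_le_between in Hd. unfold gaussdef. lra. }
  assert (Le : is_lim_seq err 0).
  { unfold err. replace (Finite 0) with (Rbar_mult 0 k) by (simpl; f_equal; ring).
    apply is_lim_seq_scal_r. apply lim_Rpower_zero; [lra|intros; apply Rpower_gt0|].
    apply is_lim_seq_ext with (fun n => Rpower (/ INR (S n)) (/ 4)).
    - intros n. unfold lam, Rpower. rewrite ln_Rinv by (apply lt_0_INR; lia). f_equal. ring.
    - apply lim_Rpower_zero; [lra| |apply lim_left_ends]. intros n. apply ends_ordered. }
  apply is_lim_seq_le_le with (fun n => (J - err n) / c) (fun n => (J + err n) / c).
  - intros n. destruct (Hb n) as [H1 H2]. split.
    + apply (Rmult_le_reg_r c); [easy|]. replace ((J - err n) / c * c) with (J - err n) by (field; lra). lra.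
    + apply (Rmult_le_reg_r c); [easy|]. replace ((J + err n) / c * c) with (J + err n) by (field; lra). lra.
  - replace (J / c) with ((J - 0) / c) by (field; lra). unfold Rdiv.
    apply (is_lim_seq_scal_r _ (/ c) (J - 0)), is_lim_seq_minus'; [apply is_lim_seq_const|easy].
  - replace (J / c) with ((J + 0) / c) by (field; lra). unfold Rdiv.
    apply (is_lim_seq_scal_r _ (/ c) (J + 0)), is_lim_seq_plus'; [apply is_lim_seq_const|easy].
Qed.

Lemma gaussdef_exists (p s : R) : 0 < p < 2 -> 0 < s -> exists J, 0 < J /\ is_phi p (gaussdef s) J.
Proof.
  intros Hp Hs. destruct (phi_exists p (s + 1) (gaussdef s) Hp (adm_gaussdef s ltac:(lra))) as [J HJ].
  - intros t _. pose proof (gaussdef_le_sqr s t). nra.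
  - intros t _. pose proof (gaussdef_le1 s t). lra.
  - exists J. split; [|easy]. apply (phi_pos p _ J (adm_gaussdef s ltac:(lra)) HJ).
    intros t Ht. unfold gaussdef. assert (exp (- (s * t ^ 2 / 2)) < exp 0) as H.
    { apply exp_increasing. assert (0 < s * t ^ 2) by (apply Rmult_lt_0_compat; nra). lra. }
    rewrite exp_0 in H. lra.
Qed.

(** * Moments of the simple random walk *)

Lemma av_shift (l : list R) (g : R -> R) (h x : R) : av l (fun y => g (y + h)) x = av l g (x + h).
Proof.
  revert x. induction l as [|a l IH]; intros x; simpl; [easy|]. rewrite !IH.
  replace (x + a + h) with (x + h + a) by ring. now replace (x - a + h) with (x + h - a) by ring.
Qed.

(* Discrete integration by parts: [E (S_n f(S_n)) = n E ((f(S_(n-1) + 1) - f(S_(n-1) - 1)) / 2)]. *)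
Lemma av_ones_by_parts (n : nat) (f : R -> R) (x : R) :
  av (repeat 1 (S n)) (fun y => y * f y) x =
  x * av (repeat 1 (S n)) f x + INR (S n) * av (repeat 1 n) (fun y => (f (y + 1) - f (y - 1)) / 2) x.
Proof.
  revert x. induction n as [|n IH]; intros x; [simpl; field|].
  change (repeat 1 (S (S n))) with (1 :: repeat 1 (S n)).
  set (l := repeat 1 (S n)) in *. cbn [av]. rewrite !IH.
  assert (E : (av l f (x + 1) - av l f (x - 1)) / 2 = av l (fun y => (f (y + 1) - f (y - 1)) / 2) x).
  { replace (x - 1) with (x + -1) by ring. rewrite <- !av_shift.
    rewrite (av_ext l (fun y => (f (y + 1) - f (y - 1)) / 2)
      (fun y => / 2 * f (y + 1) + - / 2 * f (y + -1)))
      by (intros y; replace (y - 1) with (y + -1) by ring; field).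
    rewrite av_plus, !av_scal. field. }
  change l with (1 :: repeat 1 n) in E at 3. cbn [av] in E.
  rewrite (S_INR (S n)). set (B := fun y => (f (y + 1) - f (y - 1)) / 2) in *.
  assert (E2 : av l B x = (av (repeat 1 n) B (x + 1) + av (repeat 1 n) B (x - 1)) / 2) by easy.
  rewrite E2. lra.
Qed.

(** Chosen so that |y|^(p+2) = y [oddpow p y], the shape needed for the discrete integration by
    parts. *)
Definition oddpow (p y : R) : R := y * rpow (Rabs y) p.

Lemma oddpow_pos (p y : R) : 0 <= y -> oddpow p y = rpow y (p + 1).
Proof. intros H. unfold oddpow. rewrite Rabs_pos_eq, rpow_plus, rpow_1 by easy. ring. Qed.

Lemma oddpow_opp (p y : R) : oddpow p (- y) = - oddpow p y.
Proof. unfold oddpow. rewrite Rabs_Ropp. ring. Qed.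

(** A symmetric difference quotient of [oddpow p], close to the derivative (p + 1) |y|^p. *)
Definition delta (p y : R) : R := (oddpow p (y + 1) - oddpow p (y - 1)) / 2.

Lemma delta_abs (p y : R) : delta p y = delta p (Rabs y).
Proof.
  destruct (Rle_or_lt 0 y) as [H|H]; [now rewrite Rabs_pos_eq|].
  rewrite Rabs_left by easy. unfold delta.
  replace (- y + 1) with (- (y - 1)) by ring. replace (- y - 1) with (- (y + 1)) by ring.
  rewrite !oddpow_opp. field.
Qed.

Lemma delta_upper (p y : R) : 0 < p -> delta p y <= (p + 1) * rpow (Rabs y + 1) p.
Proof.
  intros Hp. rewrite delta_abs. pose proof (Rabs_pos y) as Hy. set (z := Rabs y) in *.
  unfold delta. rewrite (oddpow_pos p (z + 1)) by lra.
  destruct (Rle_or_lt 1 z) as [H|H].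
  - rewrite (oddpow_pos p (z - 1)) by lra.
    pose proof (rpow_tangent_convex (z + 1) (z - 1) (p + 1) ltac:(lra) ltac:(lra) ltac:(lra)) as T.
    replace (p + 1 - 1) with p in T by ring. lra.
  - replace (z - 1) with (- (1 - z)) by ring. rewrite oddpow_opp, oddpow_pos by lra.
    rewrite !rpow_plus, !rpow_1 by lra.
    pose proof (rpow_le (1 - z) (z + 1) p ltac:(lra) ltac:(lra)).
    pose proof (rpow_ge0 (z + 1) p). nra.
Qed.

Lemma delta_lower (p y : R) : 0 < p -> (p + 1) * rpow (Rmax (Rabs y - 1) 0) p <= delta p y.
Proof.
  intros Hp. rewrite delta_abs. pose proof (Rabs_pos y) as Hy. set (z := Rabs y) in *.
  unfold delta. rewrite (oddpow_pos p (z + 1)) by lra.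
  destruct (Rle_or_lt z 1) as [H|H].
  - rewrite Rmax_right, rpow_0 by lra.
    replace (z - 1) with (- (1 - z)) by ring. rewrite oddpow_opp, oddpow_pos by lra.
    pose proof (rpow_ge0 (z + 1) (p + 1)). pose proof (rpow_ge0 (1 - z) (p + 1)). lra.
  - rewrite Rmax_left, (oddpow_pos p (z - 1)) by lra.
    pose proof (rpow_tangent_convex (z - 1) (z + 1) (p + 1) ltac:(lra) ltac:(lra) ltac:(lra)) as T.
    replace (p + 1 - 1) with p in T by ring. lra.
Qed.

(** Splitting at k y = 1: a small [k] brings the factor of y^p close to 1, at the cost of a large
    additive constant. *)
Lemma rpow_add_one (p k y : R) : 0 < p -> 0 < k -> 0 <= y ->
  rpow (y + 1) p <= rpow (1 + k) p * rpow y p + rpow (1 + / k) p.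
Proof.
  intros Hp Hk Hy. assert (Hi : 0 < / k) by now apply Rinv_0_lt_compat.
  destruct (Rle_or_lt 1 (k * y)) as [H|H].
  - rewrite <- rpow_mult by lra. pose proof (rpow_ge0 (1 + / k) p).
    pose proof (rpow_le (y + 1) ((1 + k) * y) p ltac:(lra) ltac:(nra)). lra.
  - assert (y <= / k).
    { apply (Rmult_le_reg_l k); [easy|]. rewrite Rinv_r; lra. }
    pose proof (rpow_le (y + 1) (1 + / k) p ltac:(lra) ltac:(lra)).
    pose proof (Rmult_le_pos _ _ (rpow_ge0 (1 + k) p) (rpow_ge0 y p)). lra.
Qed.

Lemma walk_rec (p : R) (n : nat) : 0 < p ->
  walk (p + 2) (S n) = INR (S n) * av (repeat 1 n) (delta p) 0.
Proof.
  intros Hp. unfold walk, mom.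
  rewrite (av_ext _ _ (fun y => y * oddpow p y)).
  - rewrite av_ones_by_parts. unfold delta. ring.
  - intros y. unfold oddpow. rewrite rpow_plus, rpow_2 by apply Rabs_pos. rewrite pow2_abs. ring.
Qed.

Lemma walk_rec_bounds (p k : R) (n : nat) : 0 < p -> 0 < k ->
  INR (S n) * ((p + 1) * (walk p n - rpow (1 + / k) p) / rpow (1 + k) p) <= walk (p + 2) (S n)
  <= INR (S n) * ((p + 1) * (rpow (1 + k) p * walk p n + rpow (1 + / k) p)).
Proof.
  intros Hp Hk. rewrite walk_rec by easy. pose proof (pos_INR (S n)) as HN.
  pose proof (rpow_gt0 (1 + k) p ltac:(lra)) as Hc. unfold walk, mom.
  split; apply Rmult_le_compat_l; try easy.
  - apply Rle_trans with (av (repeat 1 n) (fun y => (p + 1) / rpow (1 + k) p *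
        (rpow (Rabs y) p + - rpow (1 + / k) p)) 0).
    + rewrite av_scal, av_plus, av_const. right. field. lra.
    + apply av_le. intros y. eapply Rle_trans; [|now apply delta_lower].
      set (z := Rmax (Rabs y - 1) 0).
      assert (Hz : 0 <= z) by apply Rmax_r.
      assert (Hy : Rabs y <= z + 1) by (pose proof (Rmax_l (Rabs y - 1) 0); unfold z; lra).
      pose proof (rpow_add_one p k z Hp Hk Hz) as H.
      pose proof (rpow_le (Rabs y) (z + 1) p ltac:(lra) ltac:(split; [apply Rabs_pos|easy])).
      apply (Rmult_le_reg_r (rpow (1 + k) p)); [easy|].
      match goal with |- ?l <= _ => replace l with ((p + 1) * (rpow (Rabs y) p + - rpow (1 + / k) p)) by (field; lra) end.
      rewrite Rmult_assoc. apply Rmult_le_compat_l; lra.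
  - apply Rle_trans with (av (repeat 1 n) (fun y => (p + 1) * (rpow (1 + k) p * rpow (Rabs y) p + rpow (1 + / k) p)) 0).
    + apply av_le. intros y. eapply Rle_trans; [now apply delta_upper|].
      apply Rmult_le_compat_l; [lra|]. apply rpow_add_one; try easy. apply Rabs_pos.
    + rewrite av_scal, av_plus, av_scal, av_const. lra.
Qed.

(** [M] is the absolute moment of order [p] of a standard Gaussian variable. *)
Definition nlim (p M : R) : Prop := is_lim_seq (fun n => nwalk p (S n)) M.

Lemma lim_inv_power (q : R) : 0 < q -> is_lim_seq (fun n => Rpower (INR (S (S n))) (- q)) 0.
Proof.
  intros Hq. apply is_lim_seq_ext with (fun n => Rpower (/ INR (S (S n))) q).
  - intros n. unfold Rpower. rewrite ln_Rinv by (apply lt_0_INR; lia). f_equal. ring.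
  - apply lim_Rpower_zero; [easy| |apply lim_inv_INR2].
    intros n. apply Rinv_0_lt_compat, lt_0_INR. lia.
Qed.

Lemma lim_ratio_power (q : R) :
  is_lim_seq (fun n => Rpower (INR (S n) / INR (S (S n))) q) 1.
Proof.
  rewrite <- (Rpower_1_l q). apply lim_Rpower_pos; [lra|].
  apply is_lim_seq_ext with (fun n => 1 - / INR (S (S n))).
  - intros n. assert (0 < INR (S (S n))) by (apply lt_0_INR; lia).
    rewrite (S_INR (S n)) in *. field. lra.
  - replace (Finite 1) with (Finite (1 - 0)) by (f_equal; ring).
    apply is_lim_seq_minus'; [apply is_lim_seq_const|apply lim_inv_INR2].
Qed.

(** The limiting form of the Gaussian recursion E|G|^(p+2) = (p + 1) E|G|^p. It also yields the
    orders above 2, where the integral formula for moments no longer converges. *)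
Lemma nlim_rec (p M : R) : 0 < p -> nlim p M -> nlim (p + 2) ((p + 1) * M).
Proof.
  intros Hp HM. unfold nlim. apply is_lim_seq_incr_1.
  set (N := fun m => INR (S (S m))).
  assert (HN : forall m, 0 < N m) by (intros; apply lt_0_INR; lia).
  (* This k tends to 0, yet (1 + 1/k)^p is of order N^(p/4), negligible against N^(p/2). *)
  set (k := fun m => Rpower (N m) (- / 4)).
  assert (Hk : forall m, 0 < k m) by (intros; apply Rpower_gt0).
  set (c := fun m => Rpower (1 + k m) p).
  set (rho := fun m => Rpower (INR (S m) / INR (S (S m))) (p / 2)).
  set (e := fun m => Rpower (Rpower (N m) (- / 2) + k m) p).
  assert (Lk : is_lim_seq k 0) by (apply lim_inv_power; lra).
  assert (Lc : is_lim_seq c 1).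
  { rewrite <- (Rpower_1_l p). apply lim_Rpower_pos; [lra|].
    replace (Finite 1) with (Finite (1 + 0)) by (f_equal; ring).
    apply is_lim_seq_plus'; [apply is_lim_seq_const|easy]. }
  assert (Lr : is_lim_seq rho 1) by apply lim_ratio_power.
  assert (Le : is_lim_seq e 0).
  { apply lim_Rpower_zero; [easy| |].
    - intros m. pose proof (Hk m). pose proof (Rpower_gt0 (N m) (- / 2)). lra.
    - replace (Finite 0) with (Finite (0 + 0)) by (f_equal; ring).
      apply is_lim_seq_plus'; [apply lim_inv_power; lra|easy]. }
  apply is_lim_seq_le_le with
    (fun m => (p + 1) * (rho m * nwalk p (S m) - e m) / c m)
    (fun m => (p + 1) * (c m * (rho m * nwalk p (S m)) + e m)).
  - intros m. pose proof (walk_rec_bounds p (k m) (S m) Hp (Hk m)) as H.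
    assert (Hi : 0 < / k m) by now apply Rinv_0_lt_compat.
    pose proof (Hk m) as Hkm. rewrite !(rpow_pos (1 + _)) in H by lra. fold (c m) in H.
    assert (Hc : 0 < c m) by apply Rpower_gt0.
    set (P := Rpower (N m) (p / 2)). assert (HP : 0 < P) by apply Rpower_gt0.
    assert (E1 : walk p (S m) = P * (rho m * nwalk p (S m))).
    { unfold rho, nwalk, P. assert (0 < INR (S m)) by (apply lt_0_INR; lia).
      rewrite Rpower_div by (try apply HN; easy). fold (N m). field.
      split; apply Rgt_not_eq, Rpower_gt0. }
    assert (E2 : Rpower (1 + / k m) p = P * e m).
    { unfold e, P. replace (p / 2) with (/ 2 * p) by field. rewrite <- Rpower_mult.
      rewrite Rpower_mult_distr.
      - f_equal. rewrite Rmult_plus_distr_l. unfold k. rewrite <- !Rpower_plus.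
        replace (/ 2 + - / 2) with 0 by ring. replace (/ 2 + - / 4) with (/ 4) by field.
        rewrite Rpower_O by apply HN. rewrite <- Rpower_Ropp. f_equal. f_equal. ring.
      - apply Rpower_gt0.
      - pose proof (Rpower_gt0 (N m) (- / 2)). lra. }
    rewrite E1, E2 in H. fold (N m) in H.
    unfold nwalk at 2 3. replace ((p + 2) / 2) with (p / 2 + 1) by field.
    fold (N m). rewrite Rpower_succ by apply HN. fold P.
    pose proof (HN m). assert (HNP : 0 < N m * P) by now apply Rmult_lt_0_compat.
    split.
    + apply (Rmult_le_reg_r (N m * P)); [easy|].
      replace (walk (p + 2) (S (S m)) / (N m * P) * (N m * P)) with (walk (p + 2) (S (S m))) by (field; lra).
      eapply Rle_trans; [|apply H]. right. field. lra.
    + apply (Rmult_le_reg_r (N m * P)); [easy|].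
      replace (walk (p + 2) (S (S m)) / (N m * P) * (N m * P)) with (walk (p + 2) (S (S m))) by (field; lra).
      eapply Rle_trans; [apply H|]. right. ring.
  - replace (Finite ((p + 1) * M)) with (Finite ((p + 1) * (1 * M - 0) / 1)) by (f_equal; field).
    apply is_lim_seq_div'; [|easy|lra].
    apply (is_lim_seq_scal_l _ (p + 1) (1 * M - 0)). apply is_lim_seq_minus'; [|easy].
    now apply is_lim_seq_mult'.
  - replace (Finite ((p + 1) * M)) with (Finite ((p + 1) * (1 * (1 * M) + 0))) by (f_equal; field).
    apply (is_lim_seq_scal_l _ (p + 1) (1 * (1 * M) + 0)). apply is_lim_seq_plus'; [|easy].
    apply is_lim_seq_mult'; [easy|]. now apply is_lim_seq_mult'.
Qed.

Lemma nlim_2 : nlim 2 1.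
Proof.
  apply is_lim_seq_ext with (fun _ => 1); [|apply is_lim_seq_const].
  intros n. unfold nwalk, walk. rewrite mom_2, sumsq_ones.
  assert (0 < INR (S n)) by (apply lt_0_INR; lia).
  replace (2 / 2) with 1 by field. rewrite Rpower_1 by easy. field. lra.
Qed.

Lemma nlim_exists (p : R) : 0 < p < 2 -> exists M, 0 < M /\ nlim p M.
Proof.
  intros Hp. destruct (onemcos_exists p Hp) as [c [Hc Pc]].
  destruct (gaussdef_exists p 1 Hp ltac:(lra)) as [J [HJ PJ]].
  exists (J / c). split; [now apply Rdiv_lt_0_compat|]. now apply nwalk_limit.
Qed.

Lemma nlim_unique (p M M' : R) : nlim p M -> nlim p M' -> M = M'.
Proof.
  intros H1 H2. apply is_lim_seq_unique in H1, H2. rewrite H1 in H2. now injection H2.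
Qed.

(** The ratio of the Gaussian moments of orders p + 2 k and p. *)
Fixpoint oddprod (p : R) (k : nat) : R :=
  match k with O => 1 | S j => oddprod p j * (p + 2 * INR j + 1) end.

Lemma oddprod_gt0 (p : R) (k : nat) : 0 <= p -> 0 < oddprod p k.
Proof.
  intros Hp. induction k as [|k IH]; simpl; [lra|]. pose proof (pos_INR k).
  apply Rmult_lt_0_compat; lra.
Qed.

Lemma nlim_iter (p M : R) (k : nat) : 0 < p -> nlim p M -> nlim (p + 2 * INR k) (oddprod p k * M).
Proof.
  intros Hp HM. induction k as [|k IH].
  - simpl. now rewrite Rmult_0_r, Rplus_0_r, Rmult_1_l.
  - pose proof (pos_INR k). apply nlim_rec in IH; [|lra].
    rewrite S_INR. cbn [oddprod].
    replace (p + 2 * (INR k + 1)) with (p + 2 * INR k + 2) by ring.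
    replace (oddprod p k * (p + 2 * INR k + 1) * M)
      with ((p + 2 * INR k + 1) * (oddprod p k * M)) by ring. easy.
Qed.

Lemma nlim_interpolate (p q a Mp Mq M : R) : 0 <= a <= 1 -> 0 < Mp -> 0 < Mq ->
  nlim p Mp -> nlim q Mq -> nlim (a * p + (1 - a) * q) M ->
  M <= Rpower Mp a * Rpower Mq (1 - a).
Proof.
  intros Ha Hp Hq Lp Lq L.
  refine (is_lim_seq_le _ (fun n => Rpower (nwalk p (S n)) a * Rpower (nwalk q (S n)) (1 - a)) M
    (Rpower Mp a * Rpower Mq (1 - a)) _ L _).
  - intros n. unfold nwalk. assert (HN : 0 < INR (S n)) by (apply lt_0_INR; lia).
    pose proof (walk_gt0 p (S n) ltac:(lia)) as H1. pose proof (walk_gt0 q (S n) ltac:(lia)) as H2.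
    rewrite !Rpower_div, !Rpower_mult by (try apply Rpower_gt0; easy).
    replace ((a * p + (1 - a) * q) / 2) with (p / 2 * a + q / 2 * (1 - a)) by field.
    rewrite Rpower_plus.
    set (A := Rpower (INR (S n)) (p / 2 * a)). set (B := Rpower (INR (S n)) (q / 2 * (1 - a))).
    assert (HA : 0 < A) by apply Rpower_gt0. assert (HB : 0 < B) by apply Rpower_gt0.
    apply (Rmult_le_reg_r (A * B)); [now apply Rmult_lt_0_compat|].
    match goal with |- ?u / _ * _ <= _ => replace (u / (A * B) * (A * B)) with u by (field; lra) end.
    eapply Rle_trans; [apply (mom_interpolate p q a _ _ Ha H1 H2)|]. right. unfold walk. field. lra.
  - apply is_lim_seq_mult'; now apply lim_Rpower_pos.
Qed.

(** The moments are log-convex in the order, and p + 2j + 2 lies between the even orders 2j + 2 and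
    2j + 4. As in the Bohr-Mollerup theorem, the two bounds pinch [M] as j grows. *)
Lemma nlim_squeeze (p M : R) (j : nat) : 0 < p < 2 -> 0 < M -> nlim p M -> (1 <= j)%nat ->
  oddprod 2 j * Rpower (2 * INR j + 1) (p / 2) <= oddprod p (S j) * M
  <= oddprod 2 j * Rpower (2 * INR j + 3) (p / 2).
Proof.
  intros Hp HM0 HM Hj. pose proof (pos_INR j) as Hj0.
  pose proof (nlim_iter p M (S j) ltac:(lra) HM) as L.
  pose proof (nlim_iter 2 1 j ltac:(lra) nlim_2) as L1.
  pose proof (nlim_iter 2 1 (S j) ltac:(lra) nlim_2) as L2.
  rewrite Rmult_1_r in L1, L2.
  set (X := oddprod p (S j) * M) in *.
  assert (HX : 0 < X) by (apply Rmult_lt_0_compat; [apply oddprod_gt0; lra|easy]).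
  pose proof (oddprod_gt0 2 j ltac:(lra)) as HO.
  assert (EO : oddprod 2 (S j) = oddprod 2 j * (2 * INR j + 3)) by (cbn [oddprod]; ring).
  rewrite EO in L2. rewrite (S_INR j) in L, L2. set (O := oddprod 2 j) in *.
  assert (HO2 : 0 < O * (2 * INR j + 3)) by (apply Rmult_lt_0_compat; lra).
  split.
  - destruct j as [|i]; [lia|].
    pose proof (nlim_iter 2 1 i ltac:(lra) nlim_2) as L0. rewrite Rmult_1_r in L0.
    set (O' := oddprod 2 i) in *. assert (HO' : 0 < O') by (apply oddprod_gt0; lra).
    assert (EO' : O = O' * (2 * INR (S i) + 1)) by (unfold O, O'; cbn [oddprod]; rewrite S_INR; ring).
    set (v := 2 * INR (S i) + 1) in *. assert (Hv : 0 < v) by (unfold v; lra).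
    (* The order 2j + 2 as a mean of 2j and p + 2j + 2, with weights p / (p + 2) and 2 / (p + 2). *)
    replace (2 + 2 * INR (S i))
      with (p / (p + 2) * (2 + 2 * INR i) + (1 - p / (p + 2)) * (p + 2 * (INR (S i) + 1))) in L1
      by (rewrite S_INR; field; lra).
    assert (Ha : 0 <= p / (p + 2) <= 1).
    { split; [apply Rmult_le_pos; [lra|left; apply Rinv_0_lt_compat; lra]|].
      apply (Rmult_le_reg_r (p + 2)); [lra|]. replace (p / (p + 2) * (p + 2)) with p by (field; lra). lra. }
    pose proof (nlim_interpolate _ _ _ _ _ _ Ha HO' HX L0 L L1) as I.
    replace (1 - p / (p + 2)) with (2 / (p + 2)) in I by (field; lra).
    assert (I2 : Rpower O ((p + 2) / 2) <= Rpower O' (p / 2) * X).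
    { eapply Rle_trans; [apply Rle_Rpower_l; [lra|split; [easy|apply I]]|].
      rewrite <- Rpower_mult_distr by apply Rpower_gt0. rewrite !Rpower_mult.
      replace (p / (p + 2) * ((p + 2) / 2)) with (p / 2) by (field; lra).
      replace (2 / (p + 2) * ((p + 2) / 2)) with 1 by (field; lra). rewrite Rpower_1 by easy. lra. }
    replace ((p + 2) / 2) with (p / 2 + 1) in I2 by field.
    rewrite Rpower_succ in I2 by easy. rewrite EO' in I2 at 2.
    rewrite <- Rpower_mult_distr in I2 by easy.
    apply (Rmult_le_reg_l (Rpower O' (p / 2))); [apply Rpower_gt0|]. lra.
  - replace (p + 2 * (INR j + 1)) with ((1 - p / 2) * (2 + 2 * INR j) + (1 - (1 - p / 2)) * (2 + 2 * (INR j + 1))) in L by field.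
    assert (Ha : 0 <= 1 - p / 2 <= 1) by lra.
    pose proof (nlim_interpolate _ _ _ _ _ _ Ha HO HO2 L1 L2 L) as I.
    eapply Rle_trans; [apply I|]. replace (1 - (1 - p / 2)) with (p / 2) by ring.
    rewrite <- (Rpower_mult_distr O) by lra. rewrite <- Rmult_assoc, <- Rpower_plus.
    replace (1 - p / 2 + p / 2) with 1 by ring. rewrite Rpower_1 by easy. lra.
Qed.

(** * Wallis' product and Euler's limit *)

Definition wallis (m : nat) : R := RInt (fun x => sin x ^ m) 0 (PI / 2).

Lemma continuous_sin_pow (m : nat) (x : R) : continuous (fun x => sin x ^ m) x.
Proof. apply (ex_derive_continuous (fun x => sin x ^ m)). now auto_derive. Qed.

Lemma is_RInt_wallis (m : nat) : is_RInt (fun x => sin x ^ m) 0 (PI / 2) (wallis m).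
Proof.
  apply (RInt_correct (V := R_CompleteNormedModule)).
  apply (ex_RInt_continuous (fun x => sin x ^ m)). intros; apply continuous_sin_pow.
Qed.

Lemma wallis_rec (m : nat) : (INR m + 2) * wallis (S (S m)) = (INR m + 1) * wallis m.
Proof.
  assert (H : is_RInt (fun x => (INR m + 2) * sin x ^ S (S m) - (INR m + 1) * sin x ^ m) 0 (PI / 2)
     (minus (- cos (PI / 2) * sin (PI / 2) ^ S m) (- cos 0 * sin 0 ^ S m))).
  { apply (is_RInt_derive (fun x => - cos x * sin x ^ S m)).
    - intros x _. auto_derive; [easy|].
      change (match m with 0%nat => 1 | S _ => INR m + 1 end) with (INR (S m)). rewrite S_INR.
      pose proof (sin2_cos2 x) as E. unfold Rsqr in E.
      replace (cos x * 1 * cos x) with (cos x * cos x) by ring. simpl.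
      match goal with |- ?l = ?r => assert (l - r = (INR m + 1) * sin x ^ m * (1 - (sin x * sin x + cos x * cos x))) by ring end.
      rewrite E in *. lra.
    - intros x _. apply (ex_derive_continuous (fun x => (INR m + 2) * sin x ^ S (S m) - (INR m + 1) * sin x ^ m)).
      now auto_derive. }
  assert (H2 : is_RInt (fun x => (INR m + 2) * sin x ^ S (S m) - (INR m + 1) * sin x ^ m) 0 (PI / 2)
     ((INR m + 2) * wallis (S (S m)) - (INR m + 1) * wallis m)).
  { apply (is_RInt_minus (fun x => (INR m + 2) * sin x ^ S (S m)) (fun x => (INR m + 1) * sin x ^ m)).
    - apply (is_RInt_scal (fun x => sin x ^ S (S m)) 0 (PI / 2) (INR m + 2)), is_RInt_wallis.
    - apply (is_RInt_scal (fun x => sin x ^ m) 0 (PI / 2) (INR m + 1)), is_RInt_wallis. }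
  apply (is_RInt_unique (V := R_CompleteNormedModule)) in H.
  apply (is_RInt_unique (V := R_CompleteNormedModule)) in H2. rewrite H2 in H.
  rewrite cos_PI2, sin_0 in H. unfold minus, plus, opp in H; simpl in H. lra.
Qed.

Lemma wallis_0 : wallis 0 = PI / 2.
Proof.
  apply is_RInt_unique. evar_last; [apply (@is_RInt_const R_NormedModule 0 (PI / 2) 1)|].
  unfold scal; simpl; unfold mult; simpl. ring.
Qed.

Lemma wallis_1 : wallis 1 = 1.
Proof.
  apply is_RInt_unique. evar_last.
  - apply (is_RInt_derive (fun x => - cos x) (fun x => sin x ^ 1)).
    + intros x _. auto_derive; [easy|ring].
    + intros x _. apply continuous_sin_pow.
  - rewrite cos_PI2, cos_0. unfold minus, plus, opp; simpl. ring.
Qed.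

Lemma wallis_decr (m : nat) : wallis (S m) <= wallis m.
Proof.
  pose proof PI_RGT_0. apply (is_RInt_le _ _ 0 (PI / 2) _ _ ltac:(lra) (is_RInt_wallis (S m)) (is_RInt_wallis m)).
  intros x Hx. pose proof (sin_ge_0 x ltac:(lra) ltac:(lra)). pose proof (SIN_bound x).
  pose proof (pow_le (sin x) m ltac:(lra)). simpl. nra.
Qed.

Lemma wallis_odd (n : nat) : wallis (2 * n + 1) * oddprod 2 n = INR (fact n) * 2 ^ n.
Proof.
  induction n as [|n IH]; [simpl; rewrite wallis_1; ring|].
  replace (2 * S n + 1)%nat with (S (S (2 * n + 1))) by lia.
  pose proof (wallis_rec (2 * n + 1)) as H. rewrite plus_INR, mult_INR in H. simpl (INR 2) in H. simpl (INR 1) in H.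
  rewrite INR_fact_S, S_INR. cbn [oddprod pow]. pose proof (pos_INR n).
  replace (wallis (S (S (2 * n + 1))) * (oddprod 2 n * (2 + 2 * INR n + 1)))
    with (((1 + 1) * INR n + 1 + 2) * wallis (S (S (2 * n + 1))) * oddprod 2 n) by ring.
  rewrite H. replace (((1 + 1) * INR n + 1 + 1) * wallis (2 * n + 1) * oddprod 2 n)
    with (2 * (INR n + 1) * (wallis (2 * n + 1) * oddprod 2 n)) by ring.
  rewrite IH. ring.
Qed.

Lemma wallis_product (n : nat) : (2 * INR n + 1) * (wallis (2 * n) * wallis (2 * n + 1)) = PI / 2.
Proof.
  induction n as [|n IH].
  - simpl. rewrite wallis_0, wallis_1. ring.
  - replace (2 * S n + 1)%nat with (S (S (2 * n + 1))) by lia.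
    replace (2 * S n)%nat with (S (S (2 * n))) by lia.
    pose proof (wallis_rec (2 * n + 1)) as H1. pose proof (wallis_rec (2 * n)) as H2.
    rewrite plus_INR, mult_INR in H1. rewrite mult_INR in H2. simpl (INR 2) in *. simpl (INR 1) in *. rewrite S_INR.
    pose proof (pos_INR n).
    set (A := wallis (S (S (2 * n)))) in *. set (B := wallis (S (S (2 * n + 1)))) in *.
    apply (Rmult_eq_reg_l (2 * INR n + 2)); [|lra].
    replace ((2 * INR n + 2) * ((2 * (INR n + 1) + 1) * (A * B)))
      with ((((1 + 1) * INR n + 2) * A) * (((1 + 1) * INR n + 1 + 2) * B)) by ring.
    rewrite H1, H2, <- IH. ring.
Qed.

Lemma wallis_gt0 (n : nat) : 0 < wallis (2 * n + 1).
Proof.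
  pose proof (wallis_odd n) as H. pose proof (oddprod_gt0 2 n ltac:(lra)) as HO.
  pose proof (INR_fact_lt_0 n). pose proof (pow_lt 2 n ltac:(lra)).
  apply (Rmult_lt_reg_r (oddprod 2 n)); [easy|]. rewrite H, Rmult_0_l. now apply Rmult_lt_0_compat.
Qed.

(** The product of two consecutive integrals is known exactly, and their monotonicity compares it
    with a square. *)
Lemma wallis_sqr_bounds (n : nat) :
  PI / (4 * INR n + 4) <= wallis (2 * n + 1) ^ 2 <= PI / (4 * INR n + 2).
Proof.
  pose proof (wallis_product n) as P. pose proof (wallis_gt0 n) as H0. pose proof (pos_INR n) as Hn.
  pose proof (wallis_decr (2 * n)) as D1. replace (S (2 * n)) with (2 * n + 1)%nat in D1 by lia.
  pose proof (wallis_decr (2 * n + 1)) as D2. replace (S (2 * n + 1)) with (S (S (2 * n))) in D2 by lia.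
  pose proof (wallis_rec (2 * n)) as Rc. rewrite mult_INR in Rc. simpl (INR 2) in Rc.
  set (w := wallis (2 * n + 1)) in *. set (A := wallis (2 * n)) in *. set (B := wallis (S (S (2 * n)))) in *.
  split.
  - apply (Rmult_le_reg_r (4 * INR n + 4)); [lra|].
    replace (PI / (4 * INR n + 4) * (4 * INR n + 4)) with PI by (field; lra).
    assert (E : PI = 2 * (2 * INR n + 2) * B * w).
    { replace (2 * (2 * INR n + 2) * B * w) with (2 * (((1 + 1) * INR n + 2) * B) * w) by ring.
      rewrite Rc. lra. }
    rewrite E at 1. replace (w ^ 2 * (4 * INR n + 4)) with (2 * (2 * INR n + 2) * w * w) by ring.
    apply Rmult_le_compat_r; [lra|]. apply Rmult_le_compat_l; lra.
  - apply (Rmult_le_reg_r (4 * INR n + 2)); [lra|].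
    replace (PI / (4 * INR n + 2) * (4 * INR n + 2)) with PI by (field; lra).
    replace PI with ((4 * INR n + 2) * (A * w)) by lra.
    replace (w ^ 2 * (4 * INR n + 2)) with ((4 * INR n + 2) * (w * w)) by ring.
    apply Rmult_le_compat_l; [lra|]. apply Rmult_le_compat_r; lra.
Qed.

Lemma oddprod_succ_shift (n : nat) : oddprod 0 (S n) = oddprod 2 n.
Proof.
  induction n as [|n IH]; [simpl; ring|].
  change (oddprod 0 (S (S n))) with (oddprod 0 (S n) * (0 + 2 * INR (S n) + 1)).
  rewrite IH, S_INR. cbn [oddprod]. ring.
Qed.

(** For x = (p + 1) / 2 one has 2 (x + j) = p + 2j + 1, so the denominators of Euler's limit are the
    moment ratios. *)
Lemma gprod_oddprod (p : R) (n : nat) : gprod ((p + 1) / 2) n * 2 ^ S n = oddprod p (S n).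
Proof.
  induction n as [|n IH]; [simpl; field|].
  cbn [gprod]. change (oddprod p (S (S n))) with (oddprod p (S n) * (p + 2 * INR (S n) + 1)).
  rewrite <- IH. rewrite S_INR. simpl. field.
Qed.

Lemma gamma_seq_half (n : nat) : (1 <= n)%nat ->
  gamma_seq (/ 2) n = 2 * sqrt (INR n) * wallis (2 * n + 1).
Proof.
  intros Hn. unfold gamma_seq. assert (HN : 0 < INR n) by (apply lt_0_INR; lia).
  pose proof (wallis_odd n) as W. pose proof (gprod_oddprod 0 n) as G.
  replace ((0 + 1) / 2) with (/ 2) in G by field. rewrite oddprod_succ_shift in G.
  pose proof (oddprod_gt0 2 n ltac:(lra)) as HO. pose proof (pow_lt 2 n ltac:(lra)) as H2.
  cbn [pow] in G.
  assert (Hg : gprod (/ 2) n = oddprod 2 n / (2 * 2 ^ n)) by (rewrite <- G; field; lra).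
  rewrite Hg, Rpower_sqrt by easy.
  replace (INR (fact n)) with (wallis (2 * n + 1) * oddprod 2 n / 2 ^ n) by (rewrite W; field; lra).
  field. lra.
Qed.

Lemma gamma_seq_half_lim : is_lim_seq (fun n => gamma_seq (/ 2) (S n)) (sqrt PI).
Proof.
  pose proof PI_RGT_0 as HP.
  apply is_lim_seq_ext with (fun n => sqrt (4 * INR (S n) * wallis (2 * S n + 1) ^ 2)).
  - intros n. rewrite gamma_seq_half by lia. pose proof (pos_INR (S n)). pose proof (wallis_gt0 (S n)).
    rewrite sqrt_mult_alt by lra. rewrite sqrt_pow2 by lra. rewrite sqrt_mult_alt by lra.
    replace 4 with (2 * 2) by ring. now rewrite sqrt_square by lra.
  - apply (is_lim_seq_continuous sqrt); [apply continuity_pt_sqrt; lra|].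
    apply is_lim_seq_le_le with (fun n => PI * (INR (S n) / INR (S (S n)))) (fun _ => PI).
    + intros n. destruct (wallis_sqr_bounds (S n)) as [H1 H2]. rewrite (S_INR (S n)).
      assert (Hn : 0 < INR (S n)) by (apply lt_0_INR; lia). set (N := INR (S n)) in *. split.
      * eapply Rle_trans; [|apply Rmult_le_compat_l; [lra|apply H1]]. right. field. lra.
      * eapply Rle_trans; [apply Rmult_le_compat_l; [lra|apply H2]|].
        apply (Rmult_le_reg_r (4 * N + 2)); [lra|].
        replace (4 * N * (PI / (4 * N + 2)) * (4 * N + 2)) with (4 * N * PI) by (field; lra). nra.
    + replace (Finite PI) with (Finite (PI * 1)) by (f_equal; ring).
      apply (is_lim_seq_scal_l _ PI 1).
      eapply is_lim_seq_ext; [|apply (lim_ratio_power 1)].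
      intros n. apply Rpower_1, Rdiv_lt_0_compat; apply lt_0_INR; lia.
    + apply is_lim_seq_const.
Qed.

Lemma lim_half_ratio (M c q : R) : 0 < c ->
  is_lim_seq (fun n => M * Rpower (INR (S n) / (2 * INR (S n) + c)) q) (M * Rpower 2 (- q)).
Proof.
  intros Hc. apply (is_lim_seq_scal_l _ M (Rpower 2 (- q))).
  assert (HN : forall n, 0 < INR (S n)) by (intros; apply lt_0_INR; lia).
  apply is_lim_seq_ext with (fun n => Rpower (2 + c * / INR (S n)) (- q)).
  - intros n. specialize (HN n). unfold Rpower.
    replace (INR (S n) / (2 * INR (S n) + c)) with (/ (2 + c * / INR (S n))) by (field; lra).
    rewrite ln_Rinv; [f_equal; ring|].
    pose proof (Rinv_0_lt_compat _ HN). nra.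
  - apply lim_Rpower_pos; [lra|]. replace (Finite 2) with (Finite (2 + c * 0)) by (f_equal; ring).
    apply is_lim_seq_plus'; [apply is_lim_seq_const|].
    apply (is_lim_seq_scal_l _ c 0), lim_left_ends.
Qed.

(** The sequence is compared with the one at 1/2, whose limit is sqrt pi by Wallis; [nlim_squeeze]
    controls the quotient. *)
Lemma gamma_seq_lim (p M : R) : 0 < p < 2 -> 0 < M -> nlim p M ->
  is_lim_seq (fun n => gamma_seq ((p + 1) / 2) (S n)) (sqrt PI * (M * Rpower 2 (- (p / 2)))).
Proof.
  intros Hp HM0 HM.
  set (q := fun n => Rpower (INR (S n)) (p / 2) * oddprod 2 (S n) / oddprod p (S (S n))).
  apply is_lim_seq_ext with (fun n => gamma_seq (/ 2) (S n) * q n).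
  - intros n. unfold gamma_seq, q.
    pose proof (gprod_oddprod p (S n)) as G1. pose proof (gprod_oddprod 0 (S n)) as G2.
    replace ((0 + 1) / 2) with (/ 2) in G2 by field. rewrite oddprod_succ_shift in G2.
    pose proof (pow_lt 2 (S (S n)) ltac:(lra)) as HT.
    pose proof (oddprod_gt0 2 (S n) ltac:(lra)). pose proof (oddprod_gt0 p (S (S n)) ltac:(lra)).
    assert (E1 : gprod ((p + 1) / 2) (S n) = oddprod p (S (S n)) / 2 ^ S (S n)) by (rewrite <- G1; field; lra).
    assert (E2 : gprod (/ 2) (S n) = oddprod 2 (S n) / 2 ^ S (S n)) by (rewrite <- G2; field; lra).
    rewrite E1, E2. replace ((p + 1) / 2) with (/ 2 + p / 2) by field. rewrite Rpower_plus.
    field. lra.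
  - apply is_lim_seq_mult'; [apply gamma_seq_half_lim|].
    apply is_lim_seq_le_le with
      (fun n => M * Rpower (INR (S n) / (2 * INR (S n) + 3)) (p / 2))
      (fun n => M * Rpower (INR (S n) / (2 * INR (S n) + 1)) (p / 2)).
    + intros n. assert (HN : 0 < INR (S n)) by (apply lt_0_INR; lia).
      destruct (nlim_squeeze p M (S n) Hp HM0 HM ltac:(lia)) as [H1 H2].
      pose proof (oddprod_gt0 2 (S n) ltac:(lra)) as HO. pose proof (oddprod_gt0 p (S (S n)) ltac:(lra)) as HQ.
      rewrite !Rpower_div by lra. unfold q.
      set (O := oddprod 2 (S n)) in *. set (Q := oddprod p (S (S n))) in *.
      set (U := Rpower (2 * INR (S n) + 3) (p / 2)) in *. set (V := Rpower (2 * INR (S n) + 1) (p / 2)) in *.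
      set (P := Rpower (INR (S n)) (p / 2)).
      assert (0 < U) by apply Rpower_gt0. assert (0 < V) by apply Rpower_gt0. assert (0 < P) by apply Rpower_gt0.
      split.
      * apply (Rmult_le_reg_r (U * Q)); [now apply Rmult_lt_0_compat|].
        replace (M * (P / U) * (U * Q)) with (P * (Q * M)) by (field; lra).
        replace (P * O / Q * (U * Q)) with (P * (O * U)) by (field; lra).
        apply Rmult_le_compat_l; lra.
      * apply (Rmult_le_reg_r (V * Q)); [now apply Rmult_lt_0_compat|].
        replace (M * (P / V) * (V * Q)) with (P * (Q * M)) by (field; lra).
        replace (P * O / Q * (V * Q)) with (P * (O * V)) by (field; lra).
        apply Rmult_le_compat_l; lra.
    + apply lim_half_ratio; lra.
    + apply lim_half_ratio; lra.
Qed.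

(** * Gaussian moments in terms of Gamma, and the position of the threshold *)

Lemma Gamma_of_lim (x g : R) : is_lim_seq (fun n => gamma_seq x (S n)) g -> Gamma x = g.
Proof.
  intros H. apply is_lim_seq_incr_1 in H. apply is_lim_seq_Reals in H.
  unfold Gamma. apply (UL_sequence (gamma_seq x)); [|easy].
  apply epsilon_spec. now exists g.
Qed.

(** Consequently M <= 2^(p/2 - 1) is the condition Gamma ((p + 1) / 2) <= sqrt pi / 2. *)
Lemma Gamma_nlim (p M : R) : 0 < p < 2 -> 0 < M -> nlim p M ->
  M = Rpower 2 (p / 2) * (Gamma ((p + 1) / 2) / sqrt PI).
Proof.
  intros Hp HM HL. rewrite (Gamma_of_lim _ _ (gamma_seq_lim p M Hp HM HL)).
  pose proof (sqrt_lt_R0 PI PI_RGT_0). rewrite Rpower_Ropp. field.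
  split; try apply Rgt_not_eq, Rpower_gt0; lra.
Qed.

(** The moments are log-convex in the order, 2^(p/2 - 1) is log-affine, and the two agree at order
    2; so the bound propagates from p towards 2. *)
Lemma nlim_concave_bound (p q M N : R) : 0 < p < q -> q < 2 -> 0 < M -> 0 < N -> nlim p M -> nlim q N ->
  M <= Rpower 2 (p / 2 - 1) -> N <= Rpower 2 (q / 2 - 1).
Proof.
  intros Hp Hq HM0 HN0 HM HN H.
  set (a := (2 - q) / (2 - p)).
  assert (Ha : 0 <= a <= 1).
  { unfold a. split; [apply Rmult_le_pos; [lra|left; apply Rinv_0_lt_compat; lra]|].
    apply (Rmult_le_reg_r (2 - p)); [lra|]. replace ((2 - q) / (2 - p) * (2 - p)) with (2 - q) by (field; lra). lra. }
  replace q with (a * p + (1 - a) * 2) in HN by (unfold a; field; lra).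
  pose proof (nlim_interpolate p 2 a M 1 N Ha HM0 Rlt_0_1 HM nlim_2 HN) as I.
  rewrite Rpower_1_l, Rmult_1_r in I. eapply Rle_trans; [apply I|].
  replace (q / 2 - 1) with ((p / 2 - 1) * a) by (unfold a; field; lra).
  rewrite <- Rpower_mult. apply Rle_Rpower_l; lra.
Qed.

(** With a = 4 (p + 1) and b = 8 this is 4^k [oddprod p k], an integer for p = 7/4 and p = 2, which
    permits exact evaluation. *)
Fixpoint zprod (a b : Z) (k : nat) : Z :=
  match k with O => 1%Z | S j => (zprod a b j * (a + b * Z.of_nat j))%Z end.

Lemma zprod_oddprod (a : Z) (p : R) (k : nat) : 4 * (p + 1) = IZR a ->
  IZR (zprod a 8 k) = 4 ^ k * oddprod p k.
Proof.
  intros Ha. induction k as [|k IH]; [simpl; ring|]. cbn [zprod oddprod pow].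
  rewrite mult_IZR, plus_IZR, mult_IZR, IH, <- INR_IZR_INZ, <- Ha. ring.
Qed.

(* Log-convexity at distance [2 k] from [7/4]; [k = 40] is large enough for the numerical gap. *)
Lemma nlim_seven_fourths (M : R) : 0 < M -> nlim (7 / 4) M -> Rpower 2 ((7 / 4) / 2 - 1) < M.
Proof.
  intros HM0 HM. apply Rnot_le_lt. intros Hle.
  set (k := 40%nat).
  pose proof (nlim_iter (7 / 4) M k ltac:(lra) HM) as L.
  pose proof (nlim_iter 2 1 k ltac:(lra) nlim_2) as L1.
  pose proof (nlim_iter 2 1 (S k) ltac:(lra) nlim_2) as L2.
  rewrite Rmult_1_r in L1, L2. cbn [oddprod] in L2. rewrite S_INR in L2.
  pose proof (oddprod_gt0 2 k ltac:(lra)) as HO. pose proof (oddprod_gt0 (7 / 4) k ltac:(lra)) as HQ.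
  pose proof (pos_INR k) as Hk.
  set (O := oddprod 2 k) in *. set (Q := oddprod (7 / 4) k) in *.
  (* The order 2k + 2 is at distance 1/4 from 7/4 + 2k and at distance 2 from 2k + 4, whence the
     weights 8/9 and 1/9. *)
  replace (2 + 2 * INR k) with (8 / 9 * (7 / 4 + 2 * INR k) + (1 - 8 / 9) * (2 + 2 * (INR k + 1))) in L1 by field.
  assert (HQM : 0 < Q * M) by now apply Rmult_lt_0_compat.
  assert (HO2 : 0 < O * (2 + 2 * INR k + 1)) by (apply Rmult_lt_0_compat; lra).
  assert (Ha : 0 <= 8 / 9 <= 1) by lra.
  pose proof (nlim_interpolate _ _ _ _ _ _ Ha HQM HO2 L L2 L1) as I.
  assert (I2 : O ^ 8 <= (Q * M) ^ 8 * (2 + 2 * INR k + 1)).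
  { assert (I3 : Rpower O 9 <= Rpower (Q * M) 8 * (O * (2 + 2 * INR k + 1))).
    { eapply Rle_trans; [apply Rle_Rpower_l; [lra|split; [easy|apply I]]|].
      rewrite <- Rpower_mult_distr by apply Rpower_gt0. rewrite !Rpower_mult.
      replace (8 / 9 * 9) with 8 by field. replace ((1 - 8 / 9) * 9) with 1 by field.
      rewrite (Rpower_1 (O * _)) by easy. lra. }
    replace 9 with (INR 9) in I3 by (simpl; ring). replace 8 with (INR 8) in I3 at 1 by (simpl; ring).
    rewrite !Rpower_pow in I3 by easy.
    apply (Rmult_le_reg_l O); [easy|]. change (O * O ^ 8) with (O ^ 9). lra. }
  (* The eighth power turns the assumed bound 2^(-1/8) into a rational number. *)
  assert (M8 : M ^ 8 <= / 2).
  { apply Rle_trans with (Rpower 2 (7 / 4 / 2 - 1) ^ 8); [apply pow_incr; lra|].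
    rewrite <- (Rpower_pow 8) by apply Rpower_gt0. rewrite Rpower_mult.
    replace ((7 / 4 / 2 - 1) * INR 8) with (Ropp 1) by (simpl; field). rewrite Rpower_Ropp, Rpower_1; lra. }
  rewrite Rpow_mult_distr in I2.
  assert (I4 : 2 * O ^ 8 <= Q ^ 8 * (2 + 2 * INR k + 1)).
  { assert (0 < Q ^ 8) by now apply pow_lt.
    assert (Q ^ 8 * M ^ 8 * (2 + 2 * INR k + 1) <= Q ^ 8 * / 2 * (2 + 2 * INR k + 1)); [|lra].
    apply Rmult_le_compat_r; [lra|]. apply Rmult_le_compat_l; lra. }
  apply (Rmult_le_compat_l ((4 ^ k) ^ 8)) in I4; [|apply pow_le, pow_le; lra].
  replace ((4 ^ k) ^ 8 * (2 * O ^ 8)) with (2 * (4 ^ k * O) ^ 8) in I4 by (rewrite Rpow_mult_distr; ring).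
  replace ((4 ^ k) ^ 8 * (Q ^ 8 * (2 + 2 * INR k + 1))) with ((4 ^ k * Q) ^ 8 * (2 + 2 * INR k + 1))
    in I4 by (rewrite Rpow_mult_distr; ring).
  unfold O, Q in I4. rewrite <- (zprod_oddprod 12), <- (zprod_oddprod 11) in I4 by (simpl; field).
  rewrite !pow_IZR, INR_IZR_INZ, <- !mult_IZR, <- !plus_IZR, <- mult_IZR in I4.
  (* A comparison of two explicit integers remains, and it is false. *)
  apply le_IZR in I4. revert I4. unfold k. vm_compute. intros H. now apply H.
Qed.

(** Otherwise log-convexity would carry the bound from p0 up to 7/4, where it fails. *)
Lemma threshold_gt (p0 M : R) : 0 < p0 < 2 -> 0 < M -> nlim p0 M ->
  M <= Rpower 2 (p0 / 2 - 1) -> 7 / 4 < p0.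
Proof.
  intros Hp HM0 HM H. destruct (nlim_exists (7 / 4) ltac:(lra)) as [N [HN0 HN]].
  pose proof (nlim_seven_fourths N HN0 HN) as H1.
  destruct (Rtotal_order p0 (7 / 4)) as [Hl|[->|Hl]]; [exfalso|exfalso|easy].
  - pose proof (nlim_concave_bound p0 (7 / 4) M N ltac:(lra) ltac:(lra) HM0 HN0 HM HN H). lra.
  - rewrite (nlim_unique _ _ _ HM HN) in H. lra.
Qed.

(** * Haagerup's inequality *)

Definition sumlist (f : R -> R) (l : list R) : R := fold_right (fun a s => f a + s) 0 l.

Definition prodabs (l : list R) (t : R) : R := fold_right (fun a s => Rabs (cos (a * t)) * s) 1 l.

Lemma prodabs_prodcos (l : list R) (t : R) : prodabs l t = Rabs (prodcos l t).
Proof.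
  induction l as [|a l IH]; simpl; [now rewrite Rabs_R1|]. rewrite Rabs_mult, <- IH. easy.
Qed.

(** The inequality 1 + ln v <= v for v = |cos (a t)|^(1/a^2) / P, summed with weights a^2. Choosing
    [P] equal to the product of the cosines later cancels the logarithms. *)
Lemma weighted_amgm_aux (l : list R) (t P : R) : 0 < P -> 0 < prodabs l t ->
  sumsq l + ln (prodabs l t) - sumsq l * ln P <=
  sumlist (fun a => a ^ 2 * rpow (Rabs (cos (a * t))) (/ a ^ 2)) l / P.
Proof.
  intros HP. induction l as [|a l IH]; intros Hl; simpl in *.
  - rewrite ln_1. lra.
  - pose proof (Rabs_pos (cos (a * t))) as Hy. rewrite prodabs_prodcos in *. pose proof (Rabs_pos (prodcos l t)) as Hp.
    assert (Hy0 : 0 < Rabs (cos (a * t))) by nra. assert (Hp0 : 0 < Rabs (prodcos l t)) by nra.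
    specialize (IH Hp0). rewrite ln_mult by easy. set (y := Rabs (cos (a * t))) in *.
    assert (H : a * (a * 1) + ln y - a * (a * 1) * ln P <= a * (a * 1) * rpow y (/ (a * (a * 1))) / P).
    { destruct (Req_dec a 0) as [->|Ha].
      (* A zero coefficient has weight 0, so the default value of the inverse of 0 is harmless. *)
      - unfold y. rewrite !Rmult_0_l, cos_0, Rabs_R1, ln_1. lra.
      - assert (Ha2 : 0 < a * (a * 1)) by nra. set (w := a * (a * 1)) in *.
        rewrite rpow_pos by easy. unfold Rpower.
        pose proof (exp_ge_1x (/ w * ln y - ln P)) as E. unfold Rminus in E.
        rewrite exp_plus, exp_Ropp, exp_ln in E by easy.
        apply (Rmult_le_compat_l w) in E; [|lra].
        replace (w * (1 + (/ w * ln y + - ln P))) with (w + ln y - w * ln P) in E by (field; lra).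
        eapply Rle_trans; [apply E|]. right. field. lra. }
    lra.
Qed.

Lemma sumlist_ge0 (f : R -> R) (l : list R) : (forall a, 0 <= f a) -> 0 <= sumlist f l.
Proof. intros H. induction l as [|a l IH]; simpl; [lra|]. pose proof (H a). lra. Qed.

(* Weighted AM-GM with weights [a^2] applied to [|cos (a t)|^(1/a^2)]. *)
Lemma weighted_amgm (l : list R) (t : R) : sumsq l = 1 ->
  sumlist (fun a => a ^ 2 * cosdef (/ a ^ 2) (a * t)) l <= 1 - prodcos l t.
Proof.
  intros Hl. set (Z := sumlist (fun a => a ^ 2 * rpow (Rabs (cos (a * t))) (/ a ^ 2)) l).
  assert (E : sumlist (fun a => a ^ 2 * cosdef (/ a ^ 2) (a * t)) l = sumsq l - Z).
  { unfold Z. clear Hl. induction l as [|a l IH]; simpl in *; [ring|]. rewrite IH. unfold cosdef. ring. }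
  rewrite E, Hl. assert (prodcos l t <= Z); [|lra].
  eapply Rle_trans; [apply Rle_abs|]. rewrite <- prodabs_prodcos.
  destruct (Rle_or_lt (prodabs l t) 0) as [H|H].
  - apply Rle_trans with 0; [easy|]. apply sumlist_ge0. intros a.
    apply Rmult_le_pos; [apply pow2_ge_0|apply rpow_ge0].
  - pose proof (weighted_amgm_aux l t _ H H) as A. fold Z in A. rewrite Hl in A.
    apply (Rmult_le_compat_r (prodabs l t)) in A; [|lra].
    replace (Z / prodabs l t * prodabs l t) with Z in A by (field; lra). lra.
Qed.

Lemma gaussdef_scale (s t : R) : 0 < s -> gaussdef s t = gaussdef 1 (sqrt s * t).
Proof.
  intros Hs. unfold gaussdef. do 3 f_equal.
  replace ((sqrt s * t) ^ 2) with (sqrt s * sqrt s * t ^ 2) by ring.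
  rewrite sqrt_sqrt by lra. field.
Qed.

Lemma phi_gaussdef (p s J : R) : 0 < s -> is_phi p (gaussdef 1) J ->
  is_phi p (gaussdef s) (Rpower s (p / 2) * J).
Proof.
  intros Hs HJ. apply phi_ext with (fun t => gaussdef 1 (sqrt s * t)).
  - intros t _. now rewrite <- gaussdef_scale.
  - replace (Rpower s (p / 2)) with (Rpower (sqrt s) p).
    + apply (phi_dilate p (sqrt s) (gaussdef 1) J); [now apply sqrt_lt_R0|apply adm_gaussdef; lra|easy].
    + rewrite <- Rpower_sqrt, Rpower_mult by easy. f_equal. field.
Qed.

(** From 1 - cos^2 t = (1 - cos (2 t)) / 2. The case s = 2 of the comparison thereby becomes 2^(p/2)
    M <= 2^(p-1). *)
Lemma phi_cosdef_2 (p c : R) : is_phi p onemcos c -> is_phi p (cosdef 2) (Rpower 2 (p - 1) * c).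
Proof.
  intros Hc. apply phi_ext with (fun t => / 2 * onemcos (2 * t)).
  - intros t _. unfold cosdef, onemcos. rewrite rpow_2 by apply Rabs_pos. rewrite pow2_abs, cos_2a_cos. field.
  - evar_last.
    + apply (phi_scal p (/ 2) (fun t => onemcos (2 * t))); [lra|apply (adm_dilate 2 onemcos); [lra|apply adm_onemcos]|].
      apply (phi_dilate p 2 onemcos c); [lra|apply adm_onemcos|easy].
    + rewrite Rpower_pred by lra. field.
Qed.

Lemma cosdef_exists (p s : R) : 0 < p < 2 -> 1 <= s -> exists C, is_phi p (cosdef s) C.
Proof.
  intros Hp Hs. apply (phi_exists p (s / 2 + 1)); [easy|apply adm_cosdef; lra| |].
  - intros t _. pose proof (cosdef_le_sqr s t Hs). pose proof (pow2_ge_0 t). lra.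
  - intros t _. pose proof (cosdef_bounds s t ltac:(lra)). lra.
Qed.

Lemma cosdef_even (s a t : R) : cosdef s (a * t) = cosdef s (Rabs a * t).
Proof.
  unfold cosdef. destruct (Rle_or_lt 0 a) as [H|H]; [now rewrite (Rabs_pos_eq a)|].
  rewrite (Rabs_left a) by easy. now rewrite <- Ropp_mult_distr_l, cos_neg.
Qed.

(** With s = 1/a^2, the dilation by |a| produces |a|^p, which cancels the factor s^(p/2) of the
    Gaussian integral; each coefficient thus contributes at least a^2 (c M). The comparison applies
    because a^2 <= 1/2 means s >= 2. *)
Lemma phi_cosdef_sum (p c M : R) (l : list R) : 7 / 4 <= p < 2 -> 0 < M ->
  is_phi p onemcos c -> is_phi p (gaussdef 1) (c * M) -> M <= Rpower 2 (p / 2 - 1) -> 0 < c ->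
  (forall a, In a l -> a ^ 2 <= / 2) ->
  exists v, adm (fun t => sumlist (fun a => a ^ 2 * cosdef (/ a ^ 2) (a * t)) l)
    /\ is_phi p (fun t => sumlist (fun a => a ^ 2 * cosdef (/ a ^ 2) (a * t)) l) v
    /\ sumsq l * (c * M) <= v.
Proof.
  intros Hp HM Hc HJ HB Hc0. induction l as [|a l IH]; intros Hl.
  - exists 0. simpl. split; [apply adm_zero|]. split; [apply phi_zero|lra].
  - destruct IH as [v [Av [Pv Hv]]]; [intros b Hb; apply Hl; now right|].
    assert (H : exists u, adm (fun t => a ^ 2 * cosdef (/ a ^ 2) (a * t))
      /\ is_phi p (fun t => a ^ 2 * cosdef (/ a ^ 2) (a * t)) u /\ a ^ 2 * (c * M) <= u).
    { destruct (Req_dec a 0) as [->|Ha].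
      - exists 0. assert (E : forall t, 0 = 0 ^ 2 * cosdef (/ 0 ^ 2) (0 * t)) by (intros; ring).
        split; [now apply adm_ext with (1 := E), adm_zero|].
        split; [now apply phi_ext with (1 := fun t _ => E t), phi_zero|]. right; ring.
      - assert (Ha2 : 0 < a ^ 2) by nra. specialize (Hl a (or_introl eq_refl)).
        set (s := / a ^ 2). assert (Hs0 : 0 < s) by now apply Rinv_0_lt_compat.
        assert (Hs : 2 <= s).
        { unfold s. replace 2 with (/ / 2) by field. now apply Rinv_le_contravar. }
        destruct (cosdef_exists p s ltac:(lra) ltac:(lra)) as [C HC].
        pose proof (phi_gaussdef p s _ Hs0 HJ) as Pg. pose proof (phi_gaussdef p 2 _ Rlt_0_2 HJ) as Pg2.
        pose proof (phi_cosdef_2 p c Hc) as Pc2.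
        assert (Hcmp : Rpower s (p / 2) * (c * M) <= C).
        { apply (gauss_cos_comparison p s C _ _ _ Hp Hs HC Pg Pc2 Pg2).
          replace (p - 1) with (p / 2 + (p / 2 - 1)) by field. rewrite Rpower_plus, Rmult_assoc.
          apply Rmult_le_compat_l; [left; apply Rpower_gt0|]. rewrite Rmult_comm.
          apply Rmult_le_compat_r; lra. }
        assert (Habs : 0 < Rabs a) by now apply Rabs_pos_lt.
        assert (Ac : adm (cosdef s)) by now apply adm_cosdef.
        pose proof (adm_dilate _ _ Habs Ac) as Ad. pose proof (phi_dilate p _ _ _ Habs Ac HC) as Pd.
        exists (a ^ 2 * (Rpower (Rabs a) p * C)).
        split; [|split].
        + eapply adm_ext; [|apply (adm_scal (a ^ 2) _ ltac:(lra) Ad)].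
          intros t. simpl. now rewrite (cosdef_even s a).
        + eapply phi_ext; [|apply (phi_scal p (a ^ 2) _ _ ltac:(lra) Ad Pd)].
          intros t _. simpl. now rewrite (cosdef_even s a).
        + apply Rmult_le_compat_l; [lra|].
          apply Rle_trans with (Rpower (Rabs a) p * (Rpower s (p / 2) * (c * M))).
          * right. rewrite <- Rmult_assoc.
            replace (Rpower (Rabs a) p * Rpower s (p / 2)) with 1; [ring|].
            unfold s. rewrite <- pow2_abs, <- Rpower_2 by easy. rewrite <- Rpower_Ropp, Rpower_mult, <- Rpower_plus.
            replace (p + - (2) * (p / 2)) with 0 by field. symmetry; now apply Rpower_O.
          * apply Rmult_le_compat_l; [left; apply Rpower_gt0|easy]. }
    destruct H as [u [Au [Pu Hu]]]. exists (u + v). split; [|split].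
    + apply (adm_plus _ _ Au Av).
    + apply (phi_plus p _ _ _ _ Au Av Pu Pv).
    + simpl sumsq. replace (a * (a * 1)) with (a ^ 2) by ring. lra.
Qed.

Lemma sumsq_In (a : R) (l : list R) : In a l -> exists l', Permutation l (a :: l').
Proof.
  intros H. apply in_split in H as [l1 [l2 ->]]. exists (l1 ++ l2). symmetry. apply Permutation_middle.
Qed.

Lemma map_scale_back (c : R) (l : list R) : c <> 0 -> map (Rmult c) (map (Rmult (/ c)) l) = l.
Proof.
  intros Hc. rewrite map_map. rewrite <- (map_id l) at 2. apply map_ext. intros a. field. easy.
Qed.

Section Sharp.
Context (p M : R) (Hp : 7 / 4 <= p < 2) (HM0 : 0 < M) (HM : nlim p M)
  (HMle : M <= Rpower 2 (p / 2 - 1)).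

Lemma khintchine_flat_normalized (l : list R) : sumsq l = 1 -> (forall a, In a l -> a ^ 2 <= / 2) ->
  M <= mom p l 0.
Proof.
  intros Hl Ha. destruct (onemcos_exists p ltac:(lra)) as [c [Hc Pc]].
  destruct (gaussdef_exists p 1 ltac:(lra) ltac:(lra)) as [J [HJ PJ]].
  assert (EJ : J = c * M).
  { rewrite (nlim_unique p M (J / c) HM (nwalk_limit p c J ltac:(lra) Hc Pc PJ)). field; lra. }
  rewrite EJ in PJ.
  destruct (phi_cosdef_sum p c M l Hp HM0 Pc PJ HMle Hc Ha) as [v [Av [Pv Hv]]].
  destruct (phi_moment p c l Pc) as [Am Pm].
  pose proof (phi_le p _ _ _ _ Av Am (fun t _ => weighted_amgm l t Hl) Pv Pm) as H.
  rewrite Hl in Hv. apply (Rmult_le_reg_l c); [easy|]. lra.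
Qed.

Lemma khintchine_flat (l : list R) : 0 < sumsq l -> (forall a, In a l -> a ^ 2 <= sumsq l / 2) ->
  M * rpow (sumsq l) (p / 2) <= mom p l 0.
Proof.
  intros Hl Ha. set (S := sumsq l) in *. pose proof (sqrt_lt_R0 S Hl) as Hs.
  assert (Hi : 0 < / sqrt S) by now apply Rinv_0_lt_compat.
  assert (Ess : sqrt S ^ 2 = S) by (simpl; rewrite Rmult_1_r; apply sqrt_sqrt; lra).
  assert (E : (/ sqrt S) ^ 2 = / S) by (rewrite pow_inv, Ess; easy).
  assert (H : M <= mom p (map (Rmult (/ sqrt S)) l) 0).
  { apply khintchine_flat_normalized.
    - rewrite sumsq_scale, E. fold S. field. lra.
    - intros b Hb. apply in_map_iff in Hb as [a [<- Hin]]. rewrite Rpow_mult_distr, E.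
      specialize (Ha a Hin). apply (Rmult_le_reg_l S); [easy|].
      rewrite <- Rmult_assoc, Rinv_r by lra. lra. }
  replace 0 with (/ sqrt S * 0) in H by ring. rewrite mom_scale, (Rabs_pos_eq (/ sqrt S)) in H by lra.
  replace (rpow S (p / 2)) with (/ rpow (/ sqrt S) p).
  - pose proof (rpow_gt0 (/ sqrt S) p Hi). apply (Rmult_le_reg_l (rpow (/ sqrt S) p)); [easy|].
    replace (rpow (/ sqrt S) p * (M * / rpow (/ sqrt S) p)) with M by (field; lra). easy.
  - rewrite rpow_inv, Rinv_inv by easy. rewrite <- Ess at 2. rewrite <- rpow_2, rpow_rpow by lra. f_equal. field.
Qed.

(* The continuation of [(1 + x)^(p/2)] below 1 by point reflection at [x = 1]: it is convex there,
   so that the induction can merge two coefficients [a, b] into [a + b] and [a - b]. *)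
Definition hphi (x : R) : R :=
  if Rle_dec 1 x then rpow (1 + x) (p / 2) else 2 * rpow 2 (p / 2) - rpow (3 - x) (p / 2).

Lemma hphi_le1 (x : R) : x <= 1 -> hphi x = 2 * rpow 2 (p / 2) - rpow (3 - x) (p / 2).
Proof.
  intros Hx. unfold hphi. destruct (Rle_dec 1 x); [|easy].
  replace x with 1 by lra. replace (1 + 1) with 2 by ring. replace (3 - 1) with 2 by ring. ring.
Qed.

Lemma hphi_ge1 (x : R) : 1 <= x -> hphi x = rpow (1 + x) (p / 2).
Proof. intros Hx. unfold hphi. now destruct (Rle_dec 1 x). Qed.

Lemma hphi_ge (x : R) : 0 <= x -> rpow (1 + x) (p / 2) <= hphi x.
Proof.
  intros Hx. destruct (Rle_or_lt x 1) as [H|H].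
  - rewrite hphi_le1 by easy.
    pose proof (rpow_chord (1 + x) (3 - x) (/ 2) (p / 2) ltac:(lra) ltac:(lra) ltac:(lra) ltac:(lra)) as C.
    replace (/ 2 * (1 + x) + (1 - / 2) * (3 - x)) with 2 in C by field. lra.
  - rewrite hphi_ge1 by lra. lra.
Qed.

Lemma hphi_midpoint (u v : R) : 0 <= u -> 0 <= v -> u + v <= 2 ->
  2 * hphi ((u + v) / 2) <= hphi u + hphi v.
Proof.
  assert (W : forall u v, 0 <= u <= v -> u + v <= 2 -> 2 * hphi ((u + v) / 2) <= hphi u + hphi v).
  { clear u v. intros u v Huv Hs. rewrite (hphi_le1 ((u + v) / 2)), (hphi_le1 u) by lra.
    destruct (Rle_or_lt v 1) as [Hv|Hv].
    - rewrite (hphi_le1 v) by easy.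
      pose proof (rpow_chord (3 - u) (3 - v) (/ 2) (p / 2) ltac:(lra) ltac:(lra) ltac:(lra) ltac:(lra)) as C.
      replace (/ 2 * (3 - u) + (1 - / 2) * (3 - v)) with (3 - (u + v) / 2) in C by field. lra.
    - rewrite (hphi_ge1 v) by lra. set (L := 3 - u). assert (HL : 2 < L) by (unfold L; lra).
      (* Concavity puts z^(p/2) above its chord on [2, L]. The points 1 + v and, taken twice, 3 - (u
         + v) / 2 lie there and have the same sum as L, 2, 2, so adding the chord bounds gives the
         claim. *)
      assert (K : forall z, 2 <= z <= L ->
        (L - z) / (L - 2) * rpow 2 (p / 2) + (1 - (L - z) / (L - 2)) * rpow L (p / 2) <= rpow z (p / 2)).
      { intros z Hz. assert (Ht : 0 <= (L - z) / (L - 2) <= 1).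
        { split; [apply Rmult_le_pos; [lra|left; apply Rinv_0_lt_compat; lra]|].
          apply (Rmult_le_reg_r (L - 2)); [lra|].
          replace ((L - z) / (L - 2) * (L - 2)) with (L - z) by (field; lra). lra. }
        pose proof (rpow_chord 2 L _ (p / 2) ltac:(lra) ltac:(lra) ltac:(lra) Ht) as C.
        replace ((L - z) / (L - 2) * 2 + (1 - (L - z) / (L - 2)) * L) with z in C by (field; lra). easy. }
      pose proof (K (1 + v) ltac:(unfold L; lra)) as K1.
      pose proof (K (3 - (u + v) / 2) ltac:(unfold L; lra)) as K2.
      assert (E : (L - (1 + v)) / (L - 2) = 2 - 2 * ((L - (3 - (u + v) / 2)) / (L - 2)))
        by (unfold L; field; unfold L in HL; lra).
      rewrite E in K1. set (t := (L - (3 - (u + v) / 2)) / (L - 2)) in *. lra. }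
  intros Hu Hv Hs. destruct (Rle_or_lt u v) as [H|H]; [now apply W|].
  rewrite (Rplus_comm u v), (Rplus_comm (hphi u)). apply W; lra.
Qed.

(* Convexity of [U^q] in the exponent reduces [two_point] to an entropy inequality at [q = 1]. *)
Lemma rpow_ge_entropy (U q : R) : q <= 1 -> 0 <= U -> U - (1 - q) * (U * ln U) <= rpow U q.
Proof.
  intros Hq [HU| <-]; [|rewrite rpow_0; lra].
  rewrite rpow_pos by easy. replace q with (1 + - (1 - q)) at 2 by ring.
  rewrite Rpower_plus, Rpower_1 by easy. unfold Rpower.
  pose proof (exp_ge_1x (- (1 - q) * ln U)) as E.
  apply (Rmult_le_compat_l U) in E; lra.
Qed.

(** Equality holds at a = 1, which is why everything is expanded in d = 1 - a. Cubic bounds serve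
    for the two regular logarithms, and ln d <= d - 1 for the singular one. *)
Lemma entropy_le0 (a : R) : 0 <= a <= 1 ->
  (1 + a) ^ 2 / 4 * ln ((1 + a) ^ 2 / 4) + (1 - a) ^ 2 / 4 * ln ((1 - a) ^ 2 / 4)
    + (3 - a ^ 2) / 2 * ln ((3 - a ^ 2) / 2) <= 0.
Proof.
  intros Ha. set (d := 1 - a). assert (Hd : 0 <= d <= 1) by (unfold d; lra).
  pose proof (entropy_certificate d Hd) as C. cbv zeta in C.
  set (w := (1 - (1 - d) ^ 2) / 2) in *.
  replace a with (1 - d) by (unfold d; ring).
  assert (Hw : 0 <= w) by (unfold w; nra).
  replace ((3 - (1 - d) ^ 2) / 2) with (1 + w) by (unfold w; field).
  pose proof (ln_1p_le_cubic w Hw) as L3.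
  assert (T1 : (1 + (1 - d)) ^ 2 / 4 * ln ((1 + (1 - d)) ^ 2 / 4) <=
     1 / 2 * (2 - d) ^ 2 * (- (d / 2) - d ^ 2 / 8 - d ^ 3 / 24)).
  { replace ((1 + (1 - d)) ^ 2 / 4) with ((1 - d / 2) * (1 - d / 2)) by field.
    rewrite ln_mult by lra. pose proof (ln_1m_le_cubic (d / 2) ltac:(lra)) as L1.
    replace (- (d / 2) - (d / 2) ^ 2 / 2 - (d / 2) ^ 3 / 3) with (- (d / 2) - d ^ 2 / 8 - d ^ 3 / 24) in L1 by field.
    replace (1 / 2 * (2 - d) ^ 2 * (- (d / 2) - d ^ 2 / 8 - d ^ 3 / 24))
      with ((1 - d / 2) * (1 - d / 2) * (2 * (- (d / 2) - d ^ 2 / 8 - d ^ 3 / 24))) by field.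
    apply Rmult_le_compat_l; nra. }
  assert (T2 : d ^ 2 / 4 * ln (d ^ 2 / 4) <= 1 / 2 * d ^ 2 * (d - 169 / 100)).
  { destruct (proj1 Hd) as [Hd0|Hd0].
    2:{ rewrite <- Hd0. replace (0 ^ 2 / 4) with 0 by field. right; ring. }
    replace (d ^ 2 / 4) with (d / 2 * (d / 2)) by field.
    rewrite ln_mult by lra. unfold Rdiv at 3 4. rewrite ln_mult, ln_Rinv by lra.
    pose proof (ln_le_sub1 d Hd0). pose proof ln_2_gt.
    replace (1 / 2 * d ^ 2 * (d - 169 / 100)) with (d / 2 * (d / 2) * (2 * (d - 169 / 100))) by field.
    apply Rmult_le_compat_l; nra. }
  assert (T3 : (1 + w) * ln (1 + w) <= (1 + w) * (w - w ^ 2 / 2 + w ^ 3 / 3))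
    by (apply Rmult_le_compat_l; lra).
  lra.
Qed.

(** With q = p/2, U = (1 + a)^2 / 4, V = (1 - a)^2 / 4 and W = (3 - a^2) / 2, the claim for the
    largest admissible M is U^q + V^q + W^q >= 2, while U + V + W = 2. *)
Lemma two_point (a : R) : 0 <= a <= 1 ->
  M * hphi (a ^ 2) <= (rpow (1 + a) p + rpow (1 - a) p) / 2.
Proof.
  intros Ha. set (q := p / 2).
  assert (Hq : 0 < q <= 1) by (unfold q; lra).
  assert (Hh : 0 <= hphi (a ^ 2)).
  { eapply Rle_trans; [apply rpow_ge0|]. apply hphi_ge. nra. }
  apply Rle_trans with (Rpower 2 (q - 1) * hphi (a ^ 2)); [now apply Rmult_le_compat_r|].
  rewrite hphi_le1 by nra. fold q. rewrite <- (rpow_pos 2 (q - 1)) by lra.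
  pose proof (rpow_ge_entropy ((1 + a) ^ 2 / 4) q ltac:(lra) ltac:(nra)) as E1.
  pose proof (rpow_ge_entropy ((1 - a) ^ 2 / 4) q ltac:(lra) ltac:(nra)) as E2.
  pose proof (rpow_ge_entropy ((3 - a ^ 2) / 2) q ltac:(lra) ltac:(nra)) as E3.
  pose proof (entropy_le0 a Ha) as E0.
  set (U := (1 + a) ^ 2 / 4) in *. set (V := (1 - a) ^ 2 / 4) in *. set (W := (3 - a ^ 2) / 2) in *.
  assert (Hsum : U + V + W = 2) by (unfold U, V, W; field).
  assert (E : 2 <= rpow U q + rpow V q + rpow W q) by nra.
  assert (F : forall b, 0 <= b -> rpow b p = rpow 2 q * rpow 2 q * rpow (b ^ 2 / 4) q).
  { intros b Hb. rewrite <- !rpow_mult by (try apply Rmult_le_pos; try nra; lra).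
    replace (2 * 2 * (b ^ 2 / 4)) with (b ^ 2) by field.
    rewrite <- rpow_2, rpow_rpow by easy. f_equal. unfold q. field. }
  rewrite (F (1 + a)), (F (1 - a)) by lra. fold U V.
  replace (3 - a ^ 2) with (2 * W) by (unfold W; field).
  rewrite (rpow_mult 2 W) by (unfold W; nra).
  assert (G : rpow 2 q = 2 * rpow 2 (q - 1)).
  { replace q with (1 + (q - 1)) at 1 by ring. rewrite rpow_plus, rpow_1 by lra. easy. }
  pose proof (rpow_ge0 2 (q - 1)) as Hg. rewrite G. set (g := rpow 2 (q - 1)) in *.
  assert (0 <= g * g * 2 * (rpow U q + rpow V q + rpow W q - 2)) by (apply Rmult_le_pos; nra).
  lra.
Qed.

Lemma mom_cons_one (l : list R) : mom p (1 :: l) 0 = mom p l 1.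
Proof.
  unfold mom. simpl. replace (0 - 1) with (- (1)) by ring. rewrite Rplus_0_l.
  rewrite (av_even l); [field|]. intros y. now rewrite Rabs_Ropp.
Qed.

Lemma mom_factor (a : R) (l : list R) : a <> 0 ->
  mom p (a :: l) 0 = rpow (Rabs a) p * mom p (map (Rmult (/ a)) l) 1.
Proof.
  intros Ha. rewrite <- mom_cons_one, <- mom_scale. cbn [map].
  rewrite map_scale_back, Rmult_0_r, Rmult_1_r by easy. easy.
Qed.

(** Replacing a, b by a + b or by a - b shortens the list and keeps the mean of [sumsq], which is
    below 1; midpoint convexity of [hphi] then applies even if one of the two values exceeds 1. *)
Lemma khintchine_one_small (n : nat) :
  (forall l, (length l < n)%nat -> M * hphi (sumsq l) <= mom p l 1) ->
  forall l, length l = n -> sumsq l < 1 -> M * hphi (sumsq l) <= mom p l 1.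
Proof.
  intros IH l Hl Hx. destruct l as [|a [|b l]].
  - pose proof (two_point 0 ltac:(lra)) as T. unfold mom. simpl in *. rewrite Rabs_R1.
    rewrite Rplus_0_r, Rminus_0_r, !Rmult_0_l, rpow_1_l in *. lra.
  - simpl in Hx. assert (Ha : Rabs a <= 1).
    { apply Rabs_le. nra. }
    pose proof (Rabs_pos a). pose proof (two_point (Rabs a) ltac:(lra)) as T.
    rewrite pow2_abs in T. unfold mom. simpl. rewrite Rplus_0_r. simpl in T.
    eapply Rle_trans; [apply T|]. right. f_equal.
    destruct (Rle_or_lt 0 a) as [H0|H0].
    + rewrite (Rabs_pos_eq a) in * by easy. rewrite !Rabs_pos_eq by lra. easy.
    + rewrite (Rabs_left a) in * by easy. rewrite !Rabs_pos_eq by lra.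
      rewrite Rplus_comm. f_equal; f_equal; ring.
  - unfold mom. rewrite av_merge.
    pose proof (IH ((a + b) :: l) ltac:(simpl in *; lia)) as I1.
    pose proof (IH ((a - b) :: l) ltac:(simpl in *; lia)) as I2.
    pose proof (hphi_midpoint (sumsq ((a + b) :: l)) (sumsq ((a - b) :: l)) (sumsq_ge0 _) (sumsq_ge0 _)) as H.
    replace ((sumsq ((a + b) :: l) + sumsq ((a - b) :: l)) / 2) with (sumsq (a :: b :: l)) in H
      by (simpl; field).
    assert (Hs : sumsq ((a + b) :: l) + sumsq ((a - b) :: l) <= 2) by (simpl in *; nra).
    specialize (H Hs). apply (Rmult_le_compat_l M) in H; [|lra]. unfold mom in *. lra.
Qed.

(** For [sumsq l] >= 1 either no coefficient carries more than half of the total square sum, the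
    flat case, or one does; dividing by it makes it the new 1 and leaves a list of the same length
    with [sumsq] below 1. *)
Lemma khintchine_one (l : list R) : M * hphi (sumsq l) <= mom p l 1.
Proof.
  remember (length l) as n eqn:Hn. revert l Hn.
  induction n as [n IHn] using lt_wf_ind. intros l Hn.
  assert (IH : forall l, (length l < n)%nat -> M * hphi (sumsq l) <= mom p l 1)
    by (intros k Hk; now apply (IHn (length k))).
  destruct (Rlt_or_le (sumsq l) 1) as [Hx|Hx]; [now apply (khintchine_one_small n)|].
  rewrite hphi_ge1 by easy. rewrite <- mom_cons_one.
  assert (Es : sumsq (1 :: l) = 1 + sumsq l) by (simpl; ring).
  destruct (Classical_Prop.classic (exists a, In a l /\ (1 + sumsq l) / 2 < a ^ 2)) as [[a [Ha Hlt]]|Hno].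
  - destruct (sumsq_In a l Ha) as [l' HP].
    assert (Ha0 : a <> 0) by (intros ->; pose proof (sumsq_ge0 l); nra).
    assert (HP' : Permutation (1 :: l) (a :: 1 :: l')).
    { eapply Permutation_trans; [apply perm_skip, HP|apply perm_swap]. }
    unfold mom. rewrite (av_perm _ _ _ _ HP'). fold (mom p (a :: 1 :: l') 0). rewrite mom_factor by easy.
    set (k := map (Rmult (/ a)) (1 :: l')).
    assert (Ha2 : 0 < a ^ 2) by nra.
    assert (Ek : sumsq k = (1 + sumsq l) / a ^ 2 - 1).
    { unfold k. rewrite sumsq_scale, (sumsq_perm _ _ HP). rewrite pow_inv. simpl. field. easy. }
    assert (Hk : sumsq k < 1).
    { rewrite Ek. apply (Rmult_lt_reg_r (a ^ 2)); [easy|].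
      replace (((1 + sumsq l) / a ^ 2 - 1) * a ^ 2) with (1 + sumsq l - a ^ 2) by (field; easy). lra. }
    assert (Hlen : length k = n).
    { unfold k. rewrite length_map. apply Permutation_length in HP. simpl in *. lia. }
    pose proof (khintchine_one_small n IH k Hlen Hk) as H.
    pose proof (hphi_ge (sumsq k) (sumsq_ge0 k)) as Hg. rewrite Ek in Hg at 1.
    apply (Rmult_le_compat_l M) in Hg; [|lra].
    assert (Habs : 0 < Rabs a) by now apply Rabs_pos_lt.
    apply Rle_trans with (rpow (Rabs a) p * (M * rpow (1 + ((1 + sumsq l) / a ^ 2 - 1)) (p / 2))).
    + right. replace (1 + ((1 + sumsq l) / a ^ 2 - 1)) with (/ a ^ 2 * (1 + sumsq l)) by (field; easy).
      rewrite rpow_mult by (try lra; left; now apply Rinv_0_lt_compat).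
      rewrite rpow_inv by easy. rewrite <- pow2_abs, <- rpow_2, rpow_rpow by lra.
      replace (2 * (p / 2)) with p by field. pose proof (rpow_gt0 (Rabs a) p Habs). field. lra.
    + apply Rmult_le_compat_l; [apply rpow_ge0|lra].
  - rewrite <- Es. apply khintchine_flat; [rewrite Es; lra|].
    intros a [<-|Ha]; rewrite Es; [lra|].
    destruct (Rle_or_lt (a ^ 2) ((1 + sumsq l) / 2)) as [H|H]; [easy|exfalso; apply Hno; now exists a].
Qed.

Lemma sumsq_pos_In (l : list R) : 0 < sumsq l -> exists a, In a l /\ a <> 0.
Proof.
  induction l as [|a l IH]; simpl; [lra|]. intros H.
  destruct (Req_dec a 0) as [->|Ha]; [|exists a; tauto].
  destruct IH as [b [Hb Hb0]]; [lra|]. exists b. tauto.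
Qed.

Theorem khintchine_sharp (l : list R) : M * rpow (sumsq l) (p / 2) <= mom p l 0.
Proof.
  destruct (sumsq_ge0 l) as [Hl|Hl].
  2:{ rewrite <- Hl, rpow_0, Rmult_0_r. apply mom_ge0. }
  destruct (sumsq_pos_In l Hl) as [a [Ha Ha0]]. destruct (sumsq_In a l Ha) as [l' HP].
  unfold mom. rewrite (av_perm _ _ _ _ HP), (sumsq_perm _ _ HP). fold (mom p (a :: l') 0).
  rewrite mom_factor by easy. set (k := map (Rmult (/ a)) l').
  pose proof (khintchine_one k) as H. pose proof (hphi_ge (sumsq k) (sumsq_ge0 k)) as Hg.
  assert (Ha2 : 0 < a ^ 2) by nra. assert (Habs : 0 < Rabs a) by now apply Rabs_pos_lt.
  apply (Rmult_le_compat_l M) in Hg; [|lra].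
  apply Rle_trans with (rpow (Rabs a) p * (M * rpow (1 + sumsq k) (p / 2))).
  - right. assert (Ek : sumsq (a :: l') = a ^ 2 * (1 + sumsq k)).
    { unfold k. rewrite sumsq_scale, pow_inv. simpl. field. easy. }
    rewrite Ek. pose proof (sumsq_ge0 k). rewrite rpow_mult by lra.
    rewrite <- pow2_abs, <- rpow_2, rpow_rpow by lra. replace (2 * (p / 2)) with p by field. ring.
  - apply Rmult_le_compat_l; [apply rpow_ge0|lra].
Qed.
End Sharp.

(** * Rademacher integrals and the multiple inequality *)

(* Signs are indexed from 1; the value at index 0 is junk. *)
Definition scons (v : R) (e : nat -> R) (j : nat) : R :=
  match j with S (S i) => e (S i) | _ => v end.

Fixpoint Esign (n : nat) (H : (nat -> R) -> R) : R :=
  match n with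
  | O => H (fun _ => 0)
  | S k => (Esign k (fun e => H (scons 1 e)) + Esign k (fun e => H (scons (-1) e))) / 2
  end.

Definition depends_upto (n : nat) (H : (nat -> R) -> R) : Prop :=
  forall e e', (forall j, (1 <= j <= n)%nat -> e j = e' j) -> H e = H e'.

Lemma Esign_ext (n : nat) (F G : (nat -> R) -> R) : (forall e, F e = G e) -> Esign n F = Esign n G.
Proof.
  revert F G. induction n as [|n IH]; intros F G H; simpl; [apply H|].
  rewrite (IH (fun e => F (scons 1 e)) (fun e => G (scons 1 e))) by (intros; apply H).
  now rewrite (IH (fun e => F (scons (-1) e)) (fun e => G (scons (-1) e))) by (intros; apply H).
Qed.

Lemma Esign_le (n : nat) (F G : (nat -> R) -> R) : (forall e, F e <= G e) -> Esign n F <= Esign n G.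
Proof.
  revert F G. induction n as [|n IH]; intros F G H; simpl; [apply H|].
  pose proof (IH (fun e => F (scons 1 e)) (fun e => G (scons 1 e)) (fun e => H _)).
  pose proof (IH (fun e => F (scons (-1) e)) (fun e => G (scons (-1) e)) (fun e => H _)). lra.
Qed.

Lemma Esign_plus (n : nat) (F G : (nat -> R) -> R) :
  Esign n (fun e => F e + G e) = Esign n F + Esign n G.
Proof.
  revert F G. induction n as [|n IH]; intros F G; simpl; [easy|]. rewrite !IH. field.
Qed.

Lemma Esign_scal (n : nat) (c : R) (F : (nat -> R) -> R) :
  Esign n (fun e => c * F e) = c * Esign n F.
Proof. revert F. induction n as [|n IH]; intros F; simpl; [easy|]. rewrite !IH. field. Qed.

Lemma Esign_const (n : nat) (c : R) : Esign n (fun _ => c) = c.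
Proof. induction n as [|n IH]; simpl; [easy|]. rewrite !IH. field. Qed.

Lemma sgn_pos (x : R) : 0 < x -> sgn x = 1.
Proof. intros H. unfold sgn. now destruct (Rlt_dec 0 x). Qed.

Lemma sgn_neg (x : R) : x < 0 -> sgn x = -1.
Proof. intros H. unfold sgn. destruct (Rlt_dec 0 x); [lra|]. now destruct (Rlt_dec x 0). Qed.

Lemma rad_one_left (t : R) : 0 < t < / 2 -> rad 1 t = 1.
Proof. intros H. unfold rad. apply sgn_pos, sin_gt_0; pose proof PI_RGT_0; nra. Qed.

Lemma rad_one_right (t : R) : / 2 < t < 1 -> rad 1 t = -1.
Proof. intros H. unfold rad. apply sgn_neg, sin_lt_0; pose proof PI_RGT_0; nra. Qed.

Lemma rad_double (j : nat) (t : R) : rad (S j) t = rad j (2 * t).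
Proof. unfold rad. do 2 f_equal. simpl. ring. Qed.

Lemma rad_period (j : nat) (t : R) : rad (S j) (t - 1) = rad (S j) t.
Proof.
  unfold rad. f_equal. rewrite <- (sin_period (2 ^ S j * PI * (t - 1)) (2 ^ j)). f_equal.
  rewrite pow_INR. replace (INR 2) with 2 by (simpl; ring). simpl. ring.
Qed.

(** On each half of [0, 1] the first Rademacher function is constant and the others rescale to the
    whole interval. Its zero at 1/2 is an endpoint of both halves and does not affect the
    integrals. *)
Lemma is_RInt_rad (n : nat) (H : (nat -> R) -> R) : depends_upto n H ->
  is_RInt (fun t => H (fun j => rad j t)) 0 1 (Esign n H).
Proof.
  revert H. induction n as [|n IH]; intros H Hd.
  - apply is_RInt_ext with (fun _ => H (fun _ => 0)).
    + intros t _. apply Hd. intros; lia.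
    + evar_last; [apply (@is_RInt_const R_NormedModule 0 1)|]. unfold scal; simpl; unfold mult; simpl; ring.
  - assert (D : forall v, depends_upto n (fun e => H (scons v e))).
    { intros v e e' He. apply Hd. intros [|[|i]] Hj; simpl; try easy. apply He. lia. }
    pose proof (IH _ (D 1)) as I1. pose proof (IH _ (D (-1))) as I2. simpl.
    set (E1 := Esign n (fun e => H (scons 1 e))) in *. set (E2 := Esign n (fun e => H (scons (-1) e))) in *.
    replace ((E1 + E2) / 2) with (plus (scal (/ 2) E1) (scal (/ 2) E2))
      by (unfold plus, scal; simpl; unfold mult; simpl; field).
    apply (is_RInt_Chasles (V := R_NormedModule) _ 0 (/ 2) 1).
    + assert (J : is_RInt (fun t => H (scons 1 (fun j => rad j t))) (2 * 0 + 0) (2 * / 2 + 0) E1).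
      { replace (2 * 0 + 0) with 0 by ring. replace (2 * / 2 + 0) with 1 by field. exact I1. }
      pose proof (is_RInt_scal _ _ _ (/ 2) _ (is_RInt_comp_lin _ _ _ _ _ _ J)) as I.
      eapply is_RInt_ext; [|apply I]. intros t Ht. rewrite Rmin_left, Rmax_right in Ht by lra.
      unfold scal; simpl; unfold mult; simpl. rewrite <- Rmult_assoc, Rinv_l, Rmult_1_l by lra.
      apply Hd. intros [|[|i]] Hj; [lia| |]; simpl.
      * symmetry. now apply rad_one_left.
      * rewrite (rad_double (S i)), Rplus_0_r. easy.
    + assert (J : is_RInt (fun t => H (scons (-1) (fun j => rad j t))) (2 * / 2 + -1) (2 * 1 + -1) E2).
      { replace (2 * / 2 + -1) with 0 by field. replace (2 * 1 + -1) with 1 by ring. exact I2. }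
      pose proof (is_RInt_scal _ _ _ (/ 2) _ (is_RInt_comp_lin _ _ _ _ _ _ J)) as I.
      eapply is_RInt_ext; [|apply I]. intros t Ht. rewrite Rmin_left, Rmax_right in Ht by lra.
      unfold scal; simpl; unfold mult; simpl. rewrite <- Rmult_assoc, Rinv_l, Rmult_1_l by lra.
      apply Hd. intros [|[|i]] Hj; [lia| |]; simpl.
      * symmetry. now apply rad_one_right.
      * rewrite (rad_double (S i)), <- (rad_period i (2 * t)). reflexivity.
Qed.

Fixpoint coeffs (n : nat) (a : nat -> R) : list R :=
  match n with O => nil | S k => a 1%nat :: coeffs k (fun j => a (S j)) end.

Lemma sumN_front (n : nat) (g : nat -> R) : sumN (S n) g = g 1%nat + sumN n (fun j => g (S j)).
Proof.
  induction n as [|n IH]; [simpl; ring|].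
  change (sumN (S (S n)) g) with (sumN (S n) g + g (S (S n))). rewrite IH. simpl. ring.
Qed.

Lemma Esign_av (n : nat) (a : nat -> R) (g : R -> R) (x : R) :
  Esign n (fun e => g (x + sumN n (fun j => e j * a j))) = av (coeffs n a) g x.
Proof.
  revert a x. induction n as [|n IH]; intros a x; [simpl; f_equal; ring|].
  assert (Hs : forall v e, sumN (S n) (fun j => scons v e j * a j)
    = v * a 1%nat + sumN n (fun j => e j * a (S j))).
  { intros v e. rewrite sumN_front. f_equal. apply sumN_ext. intros [|j] Hj; [lia|easy]. }
  cbn [Esign coeffs av]. rewrite <- !IH. do 2 f_equal; apply Esign_ext; intros e; f_equal;
  rewrite Hs; ring.
Qed.

Lemma Esign_mom (n : nat) (a : nat -> R) (r : R) :
  Esign n (fun e => rpow (Rabs (sumN n (fun j => e j * a j))) r) = mom r (coeffs n a) 0.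
Proof.
  unfold mom. rewrite <- Esign_av. apply Esign_ext. intros e. now rewrite Rplus_0_l.
Qed.

Lemma sumsq_coeffs (n : nat) (a : nat -> R) : sumsq (coeffs n a) = sumN n (fun j => a j ^ 2).
Proof.
  revert a. induction n as [|n IH]; intros a; [easy|].
  rewrite sumN_front. cbn [coeffs sumsq fold_right]. fold (sumsq (coeffs n (fun j => a (S j)))).
  now rewrite IH.
Qed.

Lemma is_RInt_khintchine1 (r : R) (n : nat) (a : nat -> R) :
  is_RInt (fun t => rpow (Rabs (sumN n (fun j => a j * rad j t))) r) 0 1 (mom r (coeffs n a) 0).
Proof.
  rewrite <- Esign_mom.
  eapply is_RInt_ext; [|apply (is_RInt_rad n (fun e => rpow (Rabs (sumN n (fun j => e j * a j))) r))].
  - intros t _. simpl. do 2 f_equal. apply sumN_ext. intros; ring.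
  - intros e e' He. do 2 f_equal. apply sumN_ext. intros k Hk. now rewrite He.
Qed.

Lemma RiemannInt_eq (f : R -> R) (a b v : R) (pr : Riemann_integrable f a b) :
  is_RInt f a b v -> RiemannInt pr = v.
Proof. intros H. rewrite <- RInt_Reals. now apply is_RInt_unique. Qed.

Lemma sumN_plus (n : nat) (f g : nat -> R) : sumN n (fun i => f i + g i) = sumN n f + sumN n g.
Proof. induction n as [|n IH]; simpl; [ring|]. rewrite IH. ring. Qed.

Lemma sumN_zero (n : nat) : sumN n (fun _ => 0) = 0.
Proof. induction n as [|n IH]; simpl; [easy|]. rewrite IH. ring. Qed.

Lemma msum_ext (m N : nat) (f g : list nat -> R) : (forall l, f l = g l) -> msum m N f = msum m N g.
Proof.
  revert f g. induction m as [|m IH]; intros f g H; simpl; [apply H|].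
  apply sumN_ext. intros k _. apply IH. intros; apply H.
Qed.

Lemma msum_le (m N : nat) (f g : list nat -> R) : (forall l, f l <= g l) -> msum m N f <= msum m N g.
Proof.
  revert f g. induction m as [|m IH]; intros f g H; simpl; [apply H|].
  apply sumN_le. intros k _. apply IH. intros; apply H.
Qed.

Lemma msum_plus (m N : nat) (f g : list nat -> R) :
  msum m N (fun l => f l + g l) = msum m N f + msum m N g.
Proof.
  revert f g. induction m as [|m IH]; intros f g; simpl; [easy|].
  rewrite <- sumN_plus. apply sumN_ext. intros k _. now rewrite <- IH.
Qed.

Lemma msum_scal (m N : nat) (c : R) (f : list nat -> R) :
  msum m N (fun l => c * f l) = c * msum m N f.
Proof.
  revert f. induction m as [|m IH]; intros f; simpl; [easy|].
  rewrite Rmult_comm, <- sumN_scal. apply sumN_ext. intros k _. rewrite IH. ring.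
Qed.

Lemma msum_zero (m N : nat) : msum m N (fun _ => 0) = 0.
Proof.
  induction m as [|m IH]; simpl; [easy|].
  rewrite (sumN_ext N _ (fun _ => 0)) by (intros; apply IH). apply sumN_zero.
Qed.

Lemma msum_ge0 (m N : nat) (f : list nat -> R) : (forall l, 0 <= f l) -> 0 <= msum m N f.
Proof. intros H. rewrite <- (msum_zero m N). now apply msum_le. Qed.

Lemma sumN_msum (n m N : nat) (f : nat -> list nat -> R) :
  sumN n (fun i => msum m N (f i)) = msum m N (fun l => sumN n (fun i => f i l)).
Proof.
  induction n as [|n IH]; simpl; [now rewrite msum_zero|]. now rewrite IH, <- msum_plus.
Qed.

Lemma Esign_sumN (n N : nat) (f : nat -> (nat -> R) -> R) :
  Esign n (fun e => sumN N (fun i => f i e)) = sumN N (fun i => Esign n (f i)).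
Proof.
  induction N as [|N IH]; simpl; [apply Esign_const|]. now rewrite Esign_plus, IH.
Qed.

Lemma Esign_msum (n m N : nat) (f : list nat -> (nat -> R) -> R) :
  Esign n (fun e => msum m N (fun l => f l e)) = msum m N (fun l => Esign n (f l)).
Proof.
  revert f. induction m as [|m IH]; intros f; simpl; [easy|].
  rewrite Esign_sumN. apply sumN_ext. intros k _. now rewrite IH.
Qed.

(** * The iterated integral as an iterated average over signs *)

Fixpoint multimom (r : R) (N m : nat) (y : list nat -> R) : R :=
  match m with
  | O => rpow (Rabs (y nil)) r
  | S k => Esign N (fun e => multimom r N k (fun l => sumN N (fun i => e i * y (i :: l))))
  end.

Definition chaos (r : R) (N m : nat) (y : list nat -> R) (ts : list R) : R :=
  rpow (Rabs (msum m N (fun is_ => rprod is_ ts * y is_))) r.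

Lemma chaos_cons (r : R) (N m : nat) (y : list nat -> R) (t : R) :
  (fun ts => chaos r N (S m) y (t :: ts)) =
  chaos r N m (fun l => sumN N (fun i => rad i t * y (i :: l))).
Proof.
  apply functional_extensionality. intros ts. unfold chaos. do 2 f_equal.
  change (msum (S m) N ?f) with (sumN N (fun i => msum m N (fun l => f (i :: l)))).
  rewrite sumN_msum. apply msum_ext. intros l.
  rewrite Rmult_comm, <- sumN_scal. apply sumN_ext. intros i _. simpl. ring.
Qed.

Lemma multimom_depends (r : R) (N m : nat) (y : list nat -> R) :
  depends_upto N (fun e => multimom r N m (fun l => sumN N (fun i => e i * y (i :: l)))).
Proof.
  intros e e' He. f_equal. apply functional_extensionality. intros l.
  apply sumN_ext. intros k Hk. now rewrite He.
Qed.

(** The forward direction identifies an integral given as hypothesis; the converse supplies the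
    integral needed to test optimality. *)
Lemma is_iint_chaos (r : R) (N m : nat) (y : list nat -> R) (I : R) :
  is_iint m (chaos r N m y) I <-> I = multimom r N m y.
Proof.
  revert y I. induction m as [|m IH]; intros y I.
  - simpl. unfold chaos. simpl. now rewrite Rmult_1_l.
  - set (H := fun e : nat -> R => multimom r N m (fun l => sumN N (fun i => e i * y (i :: l)))).
    pose proof (is_RInt_rad N H (multimom_depends r N m y)) as HI.
    split.
    + intros [g [Hg [pr Hpr]]]. rewrite <- Hpr. apply RiemannInt_eq.
      eapply is_RInt_ext; [|apply HI]. intros t Ht. rewrite Rmin_left, Rmax_right in Ht by lra.
      specialize (Hg t ltac:(lra)). rewrite chaos_cons in Hg. apply IH in Hg. now rewrite Hg.
    + intros ->. exists (fun t => H (fun j => rad j t)). split.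
      * intros t _. rewrite chaos_cons. now apply IH.
      * assert (pr : Riemann_integrable (fun t => H (fun j => rad j t)) 0 1)
          by (apply ex_RInt_Reals_0; now exists (Esign N H)).
        exists pr. now apply RiemannInt_eq.
Qed.

Lemma rpow_sqr_abs (x r : R) : rpow (x ^ 2) (r / 2) = rpow (Rabs x) r.
Proof.
  rewrite <- pow2_abs, <- rpow_2, rpow_rpow by apply Rabs_pos. f_equal. field.
Qed.

(** Hoelder's inequality from the tangent of z^q at [T], evaluated at U / lam with weight lam. [T]
    is only an upper bound of the sum, so that a vanishing sum can be treated as well. *)
Lemma rpow_msum_tangent (q T : R) (m N : nat) (lam U : list nat -> R) : 0 < q <= 1 -> 0 < T ->
  (forall l, 0 <= lam l) -> (forall l, 0 <= U l) -> msum m N lam = 1 -> msum m N U <= T ->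
  msum m N (fun l => rpow (lam l) (1 - q) * rpow (U l) q) <= rpow T q.
Proof.
  intros Hq HT Hl HU H1 HS.
  assert (ET : rpow T q = T * rpow T (q - 1)).
  { replace q with (1 + (q - 1)) at 1 by ring. rewrite rpow_plus, rpow_1 by lra. easy. }
  apply Rle_trans with (msum m N (fun l => rpow T q * (1 - q) * lam l + q * rpow T (q - 1) * U l)).
  - apply msum_le. intros l. destruct (Hl l) as [HL|HL].
    + assert (Hz : 0 <= U l / lam l) by (apply Rmult_le_pos; [apply HU|left; now apply Rinv_0_lt_compat]).
      pose proof (rpow_tangent_concave T (U l / lam l) q Hq HT Hz) as K.
      apply (Rmult_le_compat_l (lam l)) in K; [|lra].
      replace (rpow (lam l) (1 - q) * rpow (U l) q) with (lam l * rpow (U l / lam l) q).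
      * eapply Rle_trans; [apply K|]. right. rewrite ET. field. lra.
      * replace (U l) with (lam l * (U l / lam l)) at 2 by (field; lra).
        rewrite rpow_mult by lra. rewrite <- (rpow_1 (lam l)) at 1 by lra.
        replace 1 with ((1 - q) + q) at 1 by ring. rewrite rpow_plus by lra. ring.
    + rewrite <- HL, rpow_0, !Rmult_0_l, Rmult_0_r, Rplus_0_l.
      apply Rmult_le_pos; [|apply HU]. apply Rmult_le_pos; [lra|apply rpow_ge0].
  - rewrite msum_plus, !msum_scal, H1, ET.
    assert (0 <= q * rpow T (q - 1)) by (apply Rmult_le_pos; [lra|apply rpow_ge0]). nra.
Qed.

Lemma rpow_msum_concave (q : R) (m N : nat) (lam U : list nat -> R) : 0 < q <= 1 ->
  (forall l, 0 <= lam l) -> (forall l, 0 <= U l) -> msum m N lam = 1 ->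
  msum m N (fun l => rpow (lam l) (1 - q) * rpow (U l) q) <= rpow (msum m N U) q.
Proof.
  intros Hq Hl HU H1. destruct (msum_ge0 m N U HU) as [HS|HS]; [now apply rpow_msum_tangent; try lra|].
  rewrite <- HS, rpow_0. set (Z := msum m N (fun l => rpow (lam l) (1 - q) * rpow (U l) q)).
  apply Rnot_lt_le. intros HZ.
  (* When the sum vanishes every positive bound is allowed; this one would give Z <= Z / 2. *)
  assert (HT : 0 < rpow (Z / 2) (/ q)) by (apply rpow_gt0; lra).
  pose proof (rpow_msum_tangent q _ m N lam U Hq HT Hl HU H1 ltac:(lra)) as K. fold Z in K.
  rewrite rpow_rpow, Rinv_l, rpow_1 in K by lra. lra.
Qed.

(** The mean of y^2 is [sumsq l], so the tangent of z^(r/2) at that point averages to its value at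
    the point of contact. *)
Lemma mom_ge_two (r : R) (l : list R) : 2 <= r -> rpow (sumsq l) (r / 2) <= mom r l 0.
Proof.
  intros Hr. destruct (sumsq_ge0 l) as [HS|HS].
  - set (S := sumsq l) in *.
    apply Rle_trans with (av l (fun y => rpow S (r / 2) * (1 - r / 2) + r / 2 * rpow S (r / 2 - 1) * y ^ 2) 0).
    + rewrite av_plus, av_const, av_scal, av_sqr. fold S. right.
      replace (rpow S (r / 2)) with (S * rpow S (r / 2 - 1)); [ring|].
      replace (r / 2) with (1 + (r / 2 - 1)) at 2 by ring. rewrite rpow_plus, rpow_1 by lra. easy.
    + apply av_le. intros y. rewrite <- rpow_sqr_abs.
      pose proof (rpow_tangent_convex S (y ^ 2) (r / 2) ltac:(lra) HS (pow2_ge_0 y)) as T.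
      eapply Rle_trans; [|apply T]. right.
      replace (rpow S (r / 2)) with (S * rpow S (r / 2 - 1)); [ring|].
      replace (r / 2) with (1 + (r / 2 - 1)) at 2 by ring. rewrite rpow_plus, rpow_1 by lra. easy.
  - rewrite <- HS, rpow_0. apply mom_ge0.
Qed.

Section Multi.
Context (r B : R) (Hr : 0 < r) (HB : 0 < B)
  (Hlow : forall l, B * rpow (sumsq l) (r / 2) <= mom r l 0)
  (Hcase : r <= 2 \/ B = 1 /\ 2 <= r).

(** For r <= 2 the weights lam proportional to b satisfy lam^(1-q) b^q = D^q lam, so Hoelder's
    inequality costs nothing against the scalar bounds. For r >= 2 the mean of the square sum is D,
    and convexity suffices. *)
Lemma vector_khintchine (m N : nat) (z : list nat -> nat -> R) :
  B * rpow (msum m N (fun l => sumN N (fun i => z l i ^ 2))) (r / 2) <=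
  Esign N (fun e => rpow (msum m N (fun l => (sumN N (fun i => e i * z l i)) ^ 2)) (r / 2)).
Proof.
  set (b := fun l => sumN N (fun i => z l i ^ 2)).
  assert (Hb : forall l, 0 <= b l).
  { intros l. unfold b. rewrite <- sumsq_coeffs. apply sumsq_ge0. }
  destruct (msum_ge0 m N b Hb) as [HD|HD].
  2:{ rewrite <- HD, rpow_0, Rmult_0_r. rewrite <- (Esign_const N 0). apply Esign_le. intros; apply rpow_ge0. }
  set (D := msum m N b) in *. set (q := r / 2).
  set (X := fun l (e : nat -> R) => sumN N (fun i => e i * z l i)).
  assert (Hmom : forall l s, Esign N (fun e => rpow (Rabs (X l e)) s) = mom s (coeffs N (z l)) 0)
    by (intros; apply Esign_mom).
  destruct Hcase as [Hle|[-> Hge]].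
  - set (lam := fun l => / D * b l).
    assert (Hlam : forall l, 0 <= lam l) by (intros l; apply Rmult_le_pos; [left; now apply Rinv_0_lt_compat|apply Hb]).
    assert (Hlam1 : msum m N lam = 1) by (unfold lam; rewrite msum_scal; fold D; field; lra).
    assert (Hq : 0 < q <= 1) by (unfold q; lra).
    apply Rle_trans with (Esign N (fun e => msum m N (fun l => rpow (lam l) (1 - q) * rpow (X l e ^ 2) q))).
    + rewrite Esign_msum.
      apply Rle_trans with (msum m N (fun l => B * rpow D q * lam l)).
      * rewrite msum_scal, Hlam1. lra.
      * apply msum_le. intros l. rewrite Esign_scal.
        rewrite (Esign_ext _ _ (fun e => rpow (Rabs (X l e)) r)) by (intros; apply rpow_sqr_abs).
        rewrite Hmom. apply Rle_trans with (rpow (lam l) (1 - q) * (B * rpow (b l) q)).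
        -- right. replace (b l) with (lam l * D) by (unfold lam; field; lra).
           rewrite rpow_mult by (try apply Hlam; lra).
           rewrite <- (rpow_1 (lam l)) at 1 by apply Hlam.
           replace 1 with ((1 - q) + q) at 1 by ring. rewrite rpow_plus by apply Hlam. ring.
        -- apply Rmult_le_compat_l; [apply rpow_ge0|]. unfold b. rewrite <- sumsq_coeffs. apply Hlow.
    + apply Esign_le. intros e.
      apply (rpow_msum_concave q m N lam (fun l => X l e ^ 2)); try easy. intros; apply pow2_ge_0.
  - assert (Hq : 1 <= q) by (unfold q; lra). rewrite Rmult_1_l.
    apply Rle_trans with (Esign N (fun e => rpow D q * (1 - q) + q * rpow D (q - 1) * msum m N (fun l => X l e ^ 2))).
    + rewrite Esign_plus, Esign_const, Esign_scal, Esign_msum.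
      rewrite (msum_ext m N _ b).
      * fold D. right. replace (rpow D q) with (D * rpow D (q - 1)); [ring|].
        replace q with (1 + (q - 1)) at 2 by ring. rewrite rpow_plus, rpow_1 by lra. easy.
      * intros l. rewrite (Esign_ext _ _ (fun e => rpow (Rabs (X l e)) 2)).
        -- rewrite Hmom, mom_2, sumsq_coeffs. unfold b. ring.
        -- intros e. rewrite rpow_2 by apply Rabs_pos. now rewrite pow2_abs.
    + apply Esign_le. intros e.
      pose proof (rpow_tangent_convex D (msum m N (fun l => X l e ^ 2)) q Hq HD
        (msum_ge0 m N _ (fun l => pow2_ge_0 _))) as T.
      eapply Rle_trans; [|apply T]. right.
      replace (rpow D q) with (D * rpow D (q - 1)); [ring|].
      replace q with (1 + (q - 1)) at 2 by ring. rewrite rpow_plus, rpow_1 by lra. easy.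
Qed.

(** Under the average over the first variable the induction hypothesis treats the others, leaving a
    vector-valued inequality in the first. *)
Lemma multimom_lower (m N : nat) (y : list nat -> R) :
  B ^ m * rpow (msum m N (fun l => y l ^ 2)) (r / 2) <= multimom r N m y.
Proof.
  revert y. induction m as [|m IH]; intros y.
  - simpl. rewrite Rmult_1_l. replace (y [] * (y [] * 1)) with (y [] ^ 2) by ring.
    rewrite rpow_sqr_abs. lra.
  - cbn [multimom].
    apply Rle_trans with (Esign N (fun e => B ^ m * rpow (msum m N (fun l => (sumN N (fun i => e i * y (i :: l))) ^ 2)) (r / 2))).
    + rewrite Esign_scal. cbn [pow]. rewrite (Rmult_comm B), Rmult_assoc.
      apply Rmult_le_compat_l; [apply pow_le; lra|].
      change (msum (S m) N ?f) with (sumN N (fun i => msum m N (fun l => f (i :: l)))).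
      rewrite sumN_msum. apply (vector_khintchine m N (fun l i => y (i :: l))).
    + apply Esign_le. intros e. apply IH.
Qed.

(** The scalar [c] absorbs the variables already averaged, so that sections of a tensor are again
    tensors. *)
Definition tensor (c : R) (a : nat -> R) (l : list nat) : R := c * fold_right (fun i s => a i * s) 1 l.

Lemma multimom_tensor (m N : nat) (c : R) (a : nat -> R) :
  multimom r N m (tensor c a) = rpow (Rabs c) r * mom r (coeffs N a) 0 ^ m.
Proof.
  revert c. induction m as [|m IH]; intros c.
  - simpl. unfold tensor. simpl. now rewrite !Rmult_1_r.
  - cbn [multimom].
    rewrite (Esign_ext N _ (fun e => rpow (Rabs c) r * mom r (coeffs N a) 0 ^ m * rpow (Rabs (sumN N (fun i => e i * a i))) r)).
    + rewrite Esign_scal, Esign_mom. simpl. ring.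
    + intros e. replace (fun l => sumN N (fun i => e i * tensor c a (i :: l)))
        with (tensor (c * sumN N (fun i => e i * a i)) a).
      * rewrite IH, Rabs_mult, rpow_mult by apply Rabs_pos. ring.
      * apply functional_extensionality. intros l. unfold tensor. simpl.
        set (f := fold_right (fun i s => a i * s) 1 l).
        replace (c * sumN N (fun i => e i * a i) * f) with (sumN N (fun i => e i * a i) * (c * f)) by ring.
        rewrite <- sumN_scal. apply sumN_ext. intros; ring.
Qed.

Lemma msum_tensor (m N : nat) (c : R) (a : nat -> R) :
  msum m N (fun l => tensor c a l ^ 2) = c ^ 2 * sumN N (fun i => a i ^ 2) ^ m.
Proof.
  revert c. induction m as [|m IH]; intros c; [unfold tensor; simpl; ring|].
  change (msum (S m) N ?f) with (sumN N (fun i => msum m N (fun l => f (i :: l)))).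
  rewrite (sumN_ext N _ (fun i => a i ^ 2 * (c ^ 2 * sumN N (fun i => a i ^ 2) ^ m))).
  - rewrite sumN_scal. simpl. ring.
  - intros i _. rewrite (msum_ext m N _ (fun l => tensor (c * a i) a l ^ 2)).
    + rewrite IH. ring.
    + intros l. unfold tensor. simpl. ring.
Qed.

Let A := Rpower B (- (1 / r)).

Lemma rpow_half_sqrt (x : R) : 0 <= x -> rpow x (/ 2) = sqrt x.
Proof.
  intros [Hx| <-]; [|now rewrite rpow_0, sqrt_0]. rewrite rpow_pos by easy. now apply Rpower_sqrt.
Qed.

Lemma root_bound (C S E : R) : 0 < C -> 0 <= S -> C * rpow S (r / 2) <= E ->
  sqrt S <= Rpower C (- (1 / r)) * rpow E (1 / r).
Proof.
  intros HC HS H. pose proof (rpow_ge0 S (r / 2)) as Hs.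
  assert (Hi : 0 < 1 / r) by (apply Rdiv_lt_0_compat; lra).
  pose proof (rpow_le (C * rpow S (r / 2)) E (1 / r) ltac:(lra) ltac:(split; [apply Rmult_le_pos; lra|easy])) as K.
  rewrite rpow_mult, rpow_rpow, (rpow_pos C) in K by lra.
  replace (r / 2 * (1 / r)) with (/ 2) in K by (field; lra). rewrite rpow_half_sqrt in K by easy.
  rewrite Rpower_Ropp. pose proof (Rpower_gt0 C (1 / r)) as HCr.
  apply (Rmult_le_reg_l (Rpower C (1 / r))); [easy|].
  rewrite <- Rmult_assoc, Rinv_r, Rmult_1_l by lra. easy.
Qed.

Lemma Rpower_pow_comm (x q : R) (m : nat) : 0 < x -> Rpower (x ^ m) q = Rpower x q ^ m.
Proof.
  intros Hx. rewrite <- !Rpower_pow by (try apply Rpower_gt0; easy). rewrite !Rpower_mult. f_equal. ring.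
Qed.

Lemma sqrt_pow_comm (x : R) (m : nat) : 0 <= x -> sqrt (x ^ m) = sqrt x ^ m.
Proof.
  intros Hx. induction m as [|m IH]; simpl; [apply sqrt_1|]. now rewrite sqrt_mult_alt, IH by easy.
Qed.

(** A sequence rather than a single extremal array, because for p0 < r < 2 the constant is reached
    through the central limit theorem. *)
Context (n : nat -> nat) (a : nat -> nat -> R).
Let E k := mom r (coeffs (n k) (a k)) 0.
Let S k := sumN (n k) (fun j => a k j ^ 2).
Context (HE : forall k, 0 < E k)
  (Hsharp : is_lim_seq (fun k => sqrt (S k) / Rpower (E k) (1 / r)) A).

Lemma smallest_khintchine1 : is_smallest (khintchine1 r) A.
Proof.
  split.
  - intros k b pr. rewrite (RiemannInt_eq _ _ _ _ pr (is_RInt_khintchine1 r k b)).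
    rewrite <- sumsq_coeffs. apply root_bound; [easy|apply sumsq_ge0|apply Hlow].
  - intros K HK.
    refine (is_lim_seq_le _ (fun _ => K) A K _ Hsharp (is_lim_seq_const _)).
    intros k. pose proof (is_RInt_khintchine1 r (n k) (a k)) as I.
    assert (pr : Riemann_integrable (fun t => rpow (Rabs (sumN (n k) (fun j => a k j * rad j t))) r) 0 1)
      by (apply ex_RInt_Reals_0; eexists; apply I).
    pose proof (HK (n k) (a k) pr) as H. rewrite (RiemannInt_eq _ _ _ _ pr I) in H.
    fold (E k) in H. fold (S k) in H. rewrite rpow_pos in H by apply HE.
    pose proof (Rpower_gt0 (E k) (1 / r)). apply (Rmult_le_reg_r (Rpower (E k) (1 / r))); [easy|].
    replace (sqrt (S k) / Rpower (E k) (1 / r) * Rpower (E k) (1 / r)) with (sqrt (S k)) by (field; lra).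
    easy.
Qed.

Lemma smallest_khintchine_multi (m : nat) : is_smallest (khintchine_multi m r) (A ^ m).
Proof.
  split.
  - intros N y I HI. apply (is_iint_chaos r N m y) in HI. rewrite HI.
    unfold A. rewrite <- Rpower_pow_comm by easy.
    apply root_bound; [now apply pow_lt|apply msum_ge0; intros; apply pow2_ge_0|apply multimom_lower].
  - intros K HK.
    refine (is_lim_seq_le (fun k => (sqrt (S k) / Rpower (E k) (1 / r)) ^ m) (fun _ => K) (A ^ m) K _ _ (is_lim_seq_const _)).
    + intros k. pose proof (HK (n k) (tensor 1 (a k)) (E k ^ m)) as H.
      rewrite msum_tensor in H. fold (S k) in H. rewrite pow1, Rmult_1_l in H.
      assert (HI : E k ^ m = multimom r (n k) m (tensor 1 (a k))).
      { rewrite multimom_tensor, Rabs_R1, rpow_1_l. fold (E k). ring. }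
      apply (is_iint_chaos r (n k) m (tensor 1 (a k))) in HI. specialize (H HI).
      rewrite rpow_pos, Rpower_pow_comm in H by (try apply pow_lt; apply HE).
      pose proof (Rpower_gt0 (E k) (1 / r)) as Hp.
      assert (HS : 0 <= S k) by (unfold S; rewrite <- sumsq_coeffs; apply sumsq_ge0).
      rewrite sqrt_pow_comm in H by easy. unfold Rdiv. rewrite Rpow_mult_distr, pow_inv.
      pose proof (pow_lt _ m Hp). apply (Rmult_le_reg_r (Rpower (E k) (1 / r) ^ m)); [easy|].
      rewrite Rmult_assoc, Rinv_l, Rmult_1_r by lra. easy.
    + apply (is_lim_seq_continuous (fun x => x ^ m)); [|apply Hsharp].
      apply derivable_continuous_pt, derivable_pt_pow.
Qed.
End Multi.

(** * The best constants *)

(* Hoelder interpolation of [p] between [r] and 2. *)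
Lemma two_point_constant_descends (r p : R) (l : list R) : 0 < r < p -> p < 2 ->
  Rpower 2 (p / 2 - 1) * rpow (sumsq l) (p / 2) <= mom p l 0 ->
  Rpower 2 (r / 2 - 1) * rpow (sumsq l) (r / 2) <= mom r l 0.
Proof.
  intros Hr Hp H. destruct (sumsq_ge0 l) as [HS|HS].
  2:{ rewrite <- HS, rpow_0, Rmult_0_r. apply mom_ge0. }
  set (S := sumsq l) in *. rewrite rpow_pos in * by easy.
  assert (HSx : 0 < 0 ^ 2 + sumsq l) by (fold S; lra).
  pose proof (mom_gt0 r l 0 HSx) as Hm. pose proof (mom_gt0 2 l 0 HSx) as Hm2.
  set (al := (2 - p) / (2 - r)).
  assert (Hal0 : 0 < al) by (apply Rdiv_lt_0_compat; lra).
  assert (Hal : 0 <= al <= 1).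
  { split; [lra|]. apply (Rmult_le_reg_r (2 - r)); [lra|].
    unfold al. replace ((2 - p) / (2 - r) * (2 - r)) with (2 - p) by (field; lra). lra. }
  pose proof (mom_interpolate r 2 al l 0 Hal Hm Hm2) as I.
  replace (al * r + (1 - al) * 2) with p in I by (unfold al; field; lra).
  rewrite mom_2 in I. fold S in I. replace (0 ^ 2 + S) with S in I by ring.
  assert (Ep : p / 2 = al * (r / 2) + (1 - al)) by (unfold al; field; lra).
  assert (K : Rpower (Rpower 2 (r / 2 - 1) * Rpower S (r / 2)) al <= Rpower (mom r l 0) al).
  { rewrite <- Rpower_mult_distr by apply Rpower_gt0. rewrite !Rpower_mult.
    apply (Rmult_le_reg_r (Rpower S (1 - al))); [apply Rpower_gt0|].
    rewrite Rmult_assoc, <- Rpower_plus.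
    replace (r / 2 * al + (1 - al)) with (p / 2) by lra.
    replace ((r / 2 - 1) * al) with (p / 2 - 1) by lra. lra. }
  assert (HC : 0 < Rpower 2 (r / 2 - 1) * Rpower S (r / 2)) by (apply Rmult_lt_0_compat; apply Rpower_gt0).
  rewrite <- (rpow_pos (mom r l 0)), <- (rpow_pos (Rpower 2 (r / 2 - 1) * Rpower S (r / 2))) in K by easy.
  apply rpow_le_inv in K; [|easy|lra|lra]. easy.
Qed.

Lemma coeffs_ones (n : nat) : coeffs n (fun _ => 1) = repeat 1 n.
Proof. induction n as [|n IH]; simpl; [easy|]. now rewrite IH. Qed.

Lemma is_smallest_both (r B : R) (m : nat) (n : nat -> nat) (a : nat -> nat -> R) :
  0 < r -> 0 < B -> (forall l, B * rpow (sumsq l) (r / 2) <= mom r l 0) ->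
  r <= 2 \/ B = 1 /\ 2 <= r ->
  (forall k, 0 < mom r (coeffs (n k) (a k)) 0) ->
  is_lim_seq (fun k => sqrt (sumN (n k) (fun j => a k j ^ 2))
    / Rpower (mom r (coeffs (n k) (a k)) 0) (1 / r)) (Rpower B (- (1 / r))) ->
  is_smallest (khintchine1 r) (Rpower B (- (1 / r))) /\
  is_smallest (khintchine_multi m r) (Rpower B (- (1 / r)) ^ m).
Proof.
  intros Hr HB Hlow Hcase HE HL. split.
  - now apply smallest_khintchine1 with n a.
  - now apply smallest_khintchine_multi with n a.
Qed.

Lemma sumN_ones (n : nat) : sumN n (fun _ => 1 ^ 2) = INR n.
Proof. rewrite <- (sumsq_coeffs n (fun _ => 1)), coeffs_ones. apply sumsq_ones. Qed.

Lemma smallest_large_exponent (r : R) (m : nat) : 2 <= r ->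
  is_smallest (khintchine1 r) 1 /\ is_smallest (khintchine_multi m r) (1 ^ m).
Proof.
  intros Hr. rewrite <- (Rpower_1_l (- (1 / r))) at 1 2.
  assert (E : mom r (coeffs 1 (fun _ => 1)) 0 = 1).
  { unfold mom. simpl. rewrite Rplus_0_l, Rminus_0_l, Rabs_Ropp, Rabs_R1, rpow_1_l. field. }
  apply is_smallest_both with (fun _ => 1%nat) (fun _ _ => 1); try lra.
  - intros l. rewrite Rmult_1_l. now apply mom_ge_two.
  - intros _. rewrite E. lra.
  - rewrite E, sumN_ones, Rpower_1_l. change (INR 1) with 1. rewrite sqrt_1, Rpower_1_l.
    replace (1 / 1) with 1 by field. apply is_lim_seq_const.
Qed.

(** Optimality comes from the coefficients 1, 1, whose signed sum is 0 or 2 in absolute value with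
    equal probability. *)
Lemma smallest_small_exponent (r p0 : R) (m : nat) : 0 < r <= p0 -> p0 < 2 ->
  (forall l, Rpower 2 (p0 / 2 - 1) * rpow (sumsq l) (p0 / 2) <= mom p0 l 0) ->
  is_smallest (khintchine1 r) (Rpower 2 (1 / r - 1 / 2)) /\
  is_smallest (khintchine_multi m r) (Rpower 2 (1 / r - 1 / 2) ^ m).
Proof.
  intros Hr Hp H.
  replace (Rpower 2 (1 / r - 1 / 2)) with (Rpower (Rpower 2 (r / 2 - 1)) (- (1 / r)))
    by (rewrite Rpower_mult; f_equal; field; lra).
  assert (E : mom r (coeffs 2 (fun _ => 1)) 0 = Rpower 2 (r - 1)).
  { unfold mom. simpl. replace (0 + 1 + 1) with 2 by ring. replace (0 + 1 - 1) with 0 by ring.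
    replace (0 - 1 + 1) with 0 by ring. replace (0 - 1 - 1) with (- (2)) by ring.
    rewrite Rabs_Ropp, Rabs_R0, rpow_0, Rabs_pos_eq, rpow_pos, Rpower_pred by lra. field. }
  apply is_smallest_both with (fun _ => 2%nat) (fun _ _ => 1); try lra.
  - apply Rpower_gt0.
  - intros l. destruct (Rle_lt_or_eq_dec r p0 (proj2 Hr)) as [Hl|Heq].
    + apply (two_point_constant_descends r p0); try easy; lra.
    + rewrite Heq. apply H.
  - intros _. rewrite E. apply Rpower_gt0.
  - rewrite E, sumN_ones. replace (INR 2) with 2 by (simpl; ring).
    replace (sqrt 2 / Rpower (Rpower 2 (r - 1)) (1 / r)) with (Rpower (Rpower 2 (r / 2 - 1)) (- (1 / r))).
    + apply is_lim_seq_const.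
    + rewrite <- (Rpower_sqrt 2) by lra. unfold Rdiv at 3. rewrite <- Rpower_Ropp, !Rpower_mult, <- Rpower_plus.
      f_equal. field. lra.
Qed.

(** For n coefficients equal to 1 the ratio of the two sides is [nwalk r n] to the power - 1/r,
    which converges to the constant. *)
Lemma smallest_middle_exponent (r M : R) (m : nat) : 7 / 4 <= r < 2 -> 0 < M -> nlim r M ->
  M <= Rpower 2 (r / 2 - 1) ->
  is_smallest (khintchine1 r) (Rpower M (- (1 / r))) /\
  is_smallest (khintchine_multi m r) (Rpower M (- (1 / r)) ^ m).
Proof.
  intros Hr HM HL Hle.
  apply is_smallest_both with S (fun _ _ => 1); try lra.
  - now apply khintchine_sharp.
  - intros k. rewrite coeffs_ones. apply walk_gt0. lia.
  - apply is_lim_seq_ext with (fun k => Rpower (nwalk r (S k)) (- (1 / r))).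
    + intros k. rewrite coeffs_ones, sumN_ones. fold (walk r (S k)). unfold nwalk.
      assert (HN : 0 < INR (S k)) by (apply lt_0_INR; lia). pose proof (walk_gt0 r (S k) ltac:(lia)) as Hw.
      rewrite Rpower_Ropp, Rpower_div, Rpower_mult by (try apply Rpower_gt0; easy).
      replace (r / 2 * (1 / r)) with (/ 2) by (field; lra). rewrite Rpower_sqrt by easy.
      pose proof (sqrt_lt_R0 _ HN). field. split; try apply Rgt_not_eq, Rpower_gt0; lra.
    + now apply lim_Rpower_pos.
Qed.

Theorem theorem3p4 (r : R) (m : nat) (p0 : R)
  (hr : 0 < r) (hm : (1 <= m)%nat)
  (hp0 : 1 < p0 < 2) (hp0G : Gamma ((p0 + 1) / 2) = sqrt PI / 2) :
  exists A : R,
    is_smallest (khintchine1 r) A /\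
    is_smallest (khintchine_multi m r) (A ^ m) /\
    (2 <= r -> A ^ m = 1) /\
    (r <= p0 -> A ^ m = (Rpower 2 (1 / r - 1 / 2)) ^ m) /\
    (p0 < r < 2 ->
       A ^ m = (/ sqrt 2 * Rpower (Gamma ((r + 1) / 2) / sqrt PI) (- (1 / r))) ^ m).
Proof.
  destruct (nlim_exists p0 ltac:(lra)) as [M0 [HM0 L0]].
  pose proof (sqrt_lt_R0 PI PI_RGT_0) as HsP.
  (* The equation for p0 says that the Gaussian and the two-point constants coincide there. *)
  assert (E0 : M0 = Rpower 2 (p0 / 2 - 1)).
  { rewrite (Gamma_nlim p0 M0 ltac:(lra) HM0 L0), hp0G, Rpower_pred by lra. field. lra. }
  assert (Hp0 : 7 / 4 < p0) by (apply (threshold_gt p0 M0); lra || easy).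
  destruct (Rle_lt_dec 2 r) as [Hr2|Hr2].
  { destruct (smallest_large_exponent r m Hr2) as [H1 H2]. exists 1.
    split; [easy|]. split; [easy|]. split; [intros; apply pow1|]. split; intros; lra. }
  destruct (Rle_lt_dec r p0) as [Hrp|Hrp].
  - destruct (smallest_small_exponent r p0 m ltac:(lra) ltac:(lra)) as [H1 H2].
    { rewrite <- E0. apply khintchine_sharp; try easy; lra. }
    exists (Rpower 2 (1 / r - 1 / 2)).
    split; [easy|]. split; [easy|]. split; [lra|]. split; [easy|lra].
  - destruct (nlim_exists r ltac:(lra)) as [M [HM L]].
    assert (Hle : M <= Rpower 2 (r / 2 - 1)).
    { apply (nlim_concave_bound p0 r M0 M); try easy; lra. }
    destruct (smallest_middle_exponent r M m ltac:(lra) HM L Hle) as [H1 H2].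
    exists (Rpower M (- (1 / r))).
    split; [easy|]. split; [easy|]. split; [lra|]. split; [lra|]. intros _. f_equal.
    pose proof (Gamma_nlim r M ltac:(lra) HM L) as EM.
    set (g := Gamma ((r + 1) / 2) / sqrt PI) in *.
    (* Positivity of the Gamma quotient is read off from M > 0. *)
    pose proof (Rpower_gt0 2 (r / 2)) as H2r. assert (Hg : 0 < g) by nra.
    rewrite EM, <- Rpower_mult_distr, Rpower_mult by easy. f_equal.
    replace (r / 2 * - (1 / r)) with (- / 2) by (field; lra).
    rewrite Rpower_Ropp, Rpower_sqrt by lra. easy.
Qed.
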